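(* Let $\gamma=(\gamma_t)_{0\leqslant t\leqslant 1}$, $\gamma_t=(x_t,y_t)$, be a weakly geometric rough path over $\mathbb{R}^2$ satisfying $x_0=y_0=0$ and $x_1=1$. Suppose that $\log S(\gamma)$ has infinite radius of convergence. Then the identity $$(1-\cosh b)\int_{0<s<t<1}\big(e^{2k\pi i\cdot x_s+b(x_t-x_s)}-e^{2k\pi i\cdot x_t+b(x_s-x_t)}\big)dy_sdy_t+(\sinh b)\Big(\int_0^1e^{bx_s}dy_s\Big)\Big(\int_0^1e^{(2k\pi i-b)x_s}dy_s\Big)=0$$ holds true for all $k\in\mathbb{Z}\backslash\{0\}$ and $b\in\mathbb{C}$.
   Context: $T((V))=\prod_{n\geqslant 0}V^{\otimes n}$ is the algebra of formal tensor series with product $(\xi\otimes\eta)_n=\sum_{k=0}^n\xi_k\otimes\eta_{n-k}$. For $\xi$ with $\xi_0=1$, $\log\xi=\sum_{n\geqslant1}\frac{(-1)^{n-1}}{n}(\xi-\mathbf{1})^{\otimes n}$. Each $V^{\otimes n}$ carries the projective tensor norm. The radius of convergence of $\xi\in T((V))$ is that of the power series $\sum_{n\geqslant0}\|\xi_n\|z^n$. A $p$-rough path over $V$ ($p\geqslant1$) is a continuous map $\mathbf{X}=(1,X^1,\dots,X^{[p]})$ on $\{0\leqslant s\leqslant t\leqslant 1\}$ with values in the tensor algebra truncated at level $[p]$, such that $\mathbf{X}_{s,u}=\mathbf{X}_{s,t}\otimes\mathbf{X}_{t,u}$ and $\sum_{i=1}^{[p]}\sup_{\mathcal P}\sum_{t_l\in\mathcal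 P}\|X^i_{t_{l-1},t_l}\|^{p/i}<\infty$. It is weakly geometric if it takes values in the truncated group of group-like elements (exponentials of Lie polynomials). By Lyons' extension theorem it extends uniquely to a multiplicative functional $S(\mathbf{X})_{\cdot,\cdot}$ in $T((V))$ whose truncations have finite $p$-variation; $S(\mathbf{X})_{0,1}$ is the signature and its logarithm the logarithmic signature. ''A rough path $\gamma$'' refers to the path $\gamma$ which is the first level component of a rough path $\mathbf{X}$, and $S(\gamma)=S(\mathbf{X})_{0,1}$. When $p=1$, $\gamma$ is a continuous path of bounded variation and $S(\gamma)$ is the sequence of its iterated Lebesgue-Stieltjes integrals. (Iterated) integrals along $\gamma$ are rough path integrals with respect to the underlying rough path (Lebesgue-Stieltjes integrals in the bounded variation case). *)

(* Defs.v *)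
From HB Require Import structures.
From mathcomp Require Import all_boot all_order all_algebra.
From mathcomp Require Import all_classical all_reals all_analysis.
From mathcomp Require Import complex.

Set Implicit Arguments.
Unset Strict Implicit.
Unset Printing Implicit Defensive.

Import Order.TTheory GRing.Theory Num.Theory.
Import numFieldNormedType.Exports.

Local Open Scope classical_set_scope.
Local Open Scope ring_scope.
Local Open Scope complex_scope.

(* An element xi of T((R^d)) is given by its coordinates in the basis
   e_w = e_(w_1) (x) ... (x) e_(w_n) indexed by words w; the component xi_n
   is the restriction of xi to the words of length n.  The truncated tensor
   algebra of degree N consists of the series vanishing on words longer
   than N. *)
Definition tseries (R : realType) (d : nat) := seq 'I_d -> R.

Definition tone (R : realType) (d : nat) : tseries R d :=
  fun w => (w == [::])%:R.

Definition tmul (R : realType) (d : nat) (xi eta : tseries R d) : tseries R d :=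
  fun w => \sum_(k < (size w).+1) xi (take k w) * eta (drop k w).

Definition tpow (R : realType) (d : nat) (xi : tseries R d) (n : nat) :
    tseries R d :=
  iter n (tmul xi) (@tone R d).

(* For xi_0 = 0 (exp), resp. xi_0 = 1 (log), the n-th term of the series
   vanishes on words shorter than n, hence the finite range of n. *)
Definition texp (R : realType) (d : nat) (xi : tseries R d) : tseries R d :=
  fun w => \sum_(0 <= n < (size w).+1) tpow xi n w / n`!%:R.

Definition tlog (R : realType) (d : nat) (xi : tseries R d) : tseries R d :=
  fun w => \sum_(1 <= n < (size w).+1)
    (-1) ^+ n.-1 / n%:R * tpow (fun v => xi v - tone R v) n w.

(* (R^d)^{(x) n} *)
Definition tensor (R : realType) (d n : nat) := {ffun n.-tuple 'I_d -> R}.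

Definition component (R : realType) (d : nat) (xi : tseries R d) (n : nat) :
    tensor R d n :=
  [ffun w : n.-tuple 'I_d => xi w].

Definition euclidean_norm (R : realType) (d : nat) (v : 'rV[R]_d) : R :=
  Num.sqrt (\sum_i v 0 i ^+ 2).

Definition pure_tensor (R : realType) (d n : nat) (v : 'I_n -> 'rV[R]_d) :
    tensor R d n :=
  [ffun w : n.-tuple 'I_d => \prod_(i < n) v i 0 (tnth w i)].

(* The scalars c only matter for n = 0, where every pure tensor is 1. *)
Definition projective_norm (R : realType) (d n : nat) (a : tensor R d n) : R :=
  inf [set r : R | exists (m : nat) (c : 'I_m -> R)
                          (v : 'I_m -> 'I_n -> 'rV[R]_d),
    a = \sum_(j < m) c j *: pure_tensor (v j) /\
    r = \sum_(j < m) `|c j| * \prod_(i < n) euclidean_norm (v j i)].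

Definition convergence_radius (R : realType) (a : nat -> R) : \bar R :=
  ereal_sup [set r%:E | r in [set r : R | 0 <= r /\
    cvgn (series (fun n => `|a n| * r ^+ n))]].

Definition tseries_radius (R : realType) (d : nat) (xi : tseries R d) : \bar R :=
  convergence_radius (fun n => projective_norm (component xi n)).

Definition tvec (R : realType) (d : nat) (v : 'rV[R]_d) : tseries R d :=
  fun w => if w is [:: i] then v 0 i else 0.

Inductive lie_polynomial (R : realType) (d : nat) : tseries R d -> Prop :=
| LieVec (v : 'rV[R]_d) : lie_polynomial (tvec v)
| LieAdd (a b : tseries R d) : lie_polynomial a -> lie_polynomial b ->
    lie_polynomial (fun w => a w + b w)
| LieScale (c : R) (a : tseries R d) : lie_polynomial a ->
    lie_polynomial (fun w => c * a w)
| LieBracket (a b : tseries R d) : lie_polynomial a -> lie_polynomial b ->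
    lie_polynomial (fun w => tmul a b w - tmul b a w).

(* A partition a = t_0 < t_1 < ... < t_m = b is encoded, as in
   itv_partition, by the sequence t = [:: t_1; ...; t_m]. *)
Definition partition_sum (R : realType) (M : nmodType) (a : R) (t : seq R)
    (f : R -> R -> M) : M :=
  \sum_(0 <= l < size t) f (nth a (a :: t) l) (nth a t l).

Definition mesh_lt (R : realType) (a : R) (t : seq R) (delta : R) : Prop :=
  forall l, (l < size t)%N -> nth a t l - nth a (a :: t) l < delta.

Definition simplex (R : realType) : set (R * R) :=
  [set st | [/\ 0 <= st.1, st.1 <= st.2 & st.2 <= 1]].

(* Multiplicative functional of degree N with finite p-variation; only the
   components of X of degree at most N are involved. *)
Definition multiplicative_functional (R : realType) (d : nat) (p : R) (N : nat)
    (X : R -> R -> tseries R d) : Prop :=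
  [/\ forall s t, simplex (s, t) -> X s t [::] = 1,
      forall w, (size w <= N)%N ->
        {within @simplex R, continuous (fun st : R * R => X st.1 st.2 w)},
      forall s t u, 0 <= s -> s <= t -> t <= u -> u <= 1 ->
        forall w, (size w <= N)%N -> X s u w = tmul (X s t) (X t u) w &
      forall n, (0 < n <= N)%N -> exists M : R,
        forall t, itv_partition 0 1 t ->
        partition_sum 0 t (fun u v =>
          projective_norm (component (X u v) n) `^ (p / n%:R)) <= M].

Definition rough_path (R : realType) (d : nat) (p : R)
    (X : R -> R -> tseries R d) : Prop :=
  [/\ 1 <= p,
      multiplicative_functional p (Num.truncn p) X &
      forall s t w, (Num.truncn p < size w)%N -> X s t w = 0].

Definition weakly_geometric (R : realType) (d : nat) (p : R)
    (X : R -> R -> tseries R d) : Prop :=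
  rough_path p X /\
  forall s t, simplex (s, t) -> exists2 l : tseries R d, lie_polynomial l &
    forall w, (size w <= Num.truncn p)%N -> X s t w = texp l w.

(* gamma is the path underlying X (up to its starting point, which X does
   not record) *)
Definition first_level (R : realType) (d : nat) (X : R -> R -> tseries R d)
    (gamma : R -> 'rV[R]_d) : Prop :=
  forall s t, simplex (s, t) -> forall i,
    X s t [:: i] = gamma t 0 i - gamma s 0 i.

(* S = S(X): such an S exists and is unique by Lyons' extension theorem. *)
Definition lyons_extension (R : realType) (d : nat) (p : R)
    (X S : R -> R -> tseries R d) : Prop :=
  (forall n, multiplicative_functional p n S) /\
  forall s t, simplex (s, t) ->
    forall w, (size w <= Num.truncn p)%N -> S s t w = X s t w.

(* Rough integration against the coordinate j of X.  The integrand is a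
   controlled path: F [::] is the integrand itself and F w, for a nonempty
   word w, its Gubinelli derivative in the direction e_w, so that
     F v t = \sum_w F (w v) s * X_(s,t) w + remainder.
   The integral is the limit, as the mesh of the partition of [0, T] tends
   to 0, of the compensated Riemann sums of
   \sum_(|w| < [p]) F w u * X_(u,v) (w j).  If [p] = 1, these are the usual
   Riemann-Stieltjes sums. *)
Definition rough_riemann_sum (R : realType) (d : nat) (p : R)
    (X : R -> R -> tseries R d) (j : 'I_d) (F : seq 'I_d -> R -> R[i])
    (t : seq R) : R[i] :=
  partition_sum 0 t (fun u v =>
    \sum_(n < Num.truncn p) \sum_(w : n.-tuple 'I_d)
      F w u * (X u v (rcons w j))%:C).

Definition is_rough_integral (R : realType) (d : nat) (p : R)
    (X : R -> R -> tseries R d) (j : 'I_d) (F : seq 'I_d -> R -> R[i])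
    (T : R) (I : R[i]) : Prop :=
  forall e : R, 0 < e -> exists2 delta : R, 0 < delta &
    forall t, itv_partition 0 T t -> mesh_lt 0 t delta ->
      ComplexField.Normc.normc (rough_riemann_sum p X j F t - I) < e.

Definition rough_integral (R : realType) (d : nat) (p : R)
    (X : R -> R -> tseries R d) (j : 'I_d) (F : seq 'I_d -> R -> R[i])
    (T : R) : R[i] :=
  xget 0 [set I | is_rough_integral p X j F T I].

(* The indefinite integral t |-> \int_0^t F dX^j as a controlled path: its
   derivative in the direction w j is F w. *)
Definition indefinite_integral (R : realType) (d : nat) (p : R)
    (X : R -> R -> tseries R d) (j : 'I_d) (F : seq 'I_d -> R -> R[i])
    (w : seq 'I_d) (t : R) : R[i] :=
  if rev w is i :: v then if i == j then F (rev v) t else 0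
  else rough_integral p X j F t.

Definition pderiv (R : realType) (d : nat) (i : 'I_d) (f : 'rV[R]_d -> R[i])
    (v : 'rV[R]_d) : R[i] :=
  'D_(delta_mx 0 i) (fun u => complex.Re (f u) : R^o) v +i*
  'D_(delta_mx 0 i) (fun u => complex.Im (f u) : R^o) v.

Definition pderivs (R : realType) (d : nat) (w : seq 'I_d)
    (f : 'rV[R]_d -> R[i]) : 'rV[R]_d -> R[i] :=
  foldr (@pderiv R d) f w.

(* f(gamma) as a controlled path, for f smooth and X weakly geometric *)
Definition lift_function (R : realType) (d : nat) (gamma : R -> 'rV[R]_d)
    (f : 'rV[R]_d -> R[i]) (w : seq 'I_d) (t : R) : R[i] :=
  pderivs w f (gamma t).

Definition line_integral (R : realType) (d : nat) (p : R)
    (X : R -> R -> tseries R d) (gamma : R -> 'rV[R]_d) (j : 'I_d)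
    (f : 'rV[R]_d -> R[i]) : R[i] :=
  rough_integral p X j (lift_function gamma f) 1.

(* t |-> \int_0^t K(gamma_s, gamma_t) dX^j_s as a controlled path.  By the
   product rule for controlled paths, which is dual to the shuffle product,
   its derivative in the direction w is the sum, over all ways of splitting
   w into complementary subwords u and u', of the derivative in the direction
   u' of t |-> \int_0^t (\partial_u K(gamma_s, _))(q) dX^j_s at q = gamma_t. *)
Definition inner_integral (R : realType) (d : nat) (p : R)
    (X : R -> R -> tseries R d) (gamma : R -> 'rV[R]_d) (j : 'I_d)
    (K : 'rV[R]_d -> 'rV[R]_d -> R[i]) (w : seq 'I_d) (t : R) : R[i] :=
  \sum_(m : (size w).-tuple bool)
    indefinite_integral p X j
      (lift_function gamma (fun a => pderivs (mask m w) (K a) (gamma t)))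
      (mask (map negb m) w) t.

(* \int_(0<s<t<1) K(gamma_s, gamma_t) dX^i_s dX^j_t *)
Definition double_line_integral (R : realType) (d : nat) (p : R)
    (X : R -> R -> tseries R d) (gamma : R -> 'rV[R]_d) (i j : 'I_d)
    (K : 'rV[R]_d -> 'rV[R]_d -> R[i]) : R[i] :=
  rough_integral p X j (inner_integral p X gamma i K) 1.

Definition cexp (R : realType) (z : R[i]) : R[i] :=
  (expR (complex.Re z))%:C *
  (cos (complex.Im z) +i* sin (complex.Im z)).

Definition ccosh (R : realType) (z : R[i]) : R[i] := (cexp z + cexp (- z)) / 2.

Definition csinh (R : realType) (z : R[i]) : R[i] := (cexp z - cexp (- z)) / 2.

Definition xcoord (R : realType) (v : 'rV[R]_2) : R[i] := (v 0 0)%:C.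

Definition ycoord : 'I_2 := 1.

Definition freq (R : realType) (k : int) : R[i] := 0 +i* (2 * k%:~R * pi).

(* Main.v *)
(* Map the tensor algebra to upper triangular 3 x 3 matrices by sending e_x to
   diag(l0, l1, l2) and e_y to E01 + E12, and take (l0, l1, l2) = (c, b, 0) with
   c = 2 k pi i.  The image G of the signature has diagonal (1, e^b, 1), and
   its entries above the diagonal are the line integrals of e^(b x) and (up to
   the factor e^b) of e^((c - b) x), and the double integral A(b) of
   e^(c x_s + b (x_t - x_s)).  Since log S(gamma) has infinite radius of
   convergence it also has an image l, with diagonal (c, b, 0), and G l = l G
   because a series commutes with its logarithm.  As e^c = 1, the unknown
   corner entry of l drops out of this relation, which becomes
     (e^b - 1) A(b) = e^b (int e^((c - b) x) dy) (int e^(b x) dy).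
   The theorem is a combination of the cases b and c - b.

   The entries of G are rough integrals because, by Chen's identity, their
   increments over [u, v] differ from the compensated Riemann terms by the part
   of degree > [p] of a series in S_(u,v), which is O(om(u,v)^th) with th > 1:
   there are a control om and q < [p] + 1 such that every coefficient of
   S_(u,v) of degree n is at most (K om(u,v)^(1/q))^n. *)

From mathcomp Require Import all_boot all_order all_algebra.
From mathcomp Require Import all_classical all_reals all_analysis.
From mathcomp Require Import complex.
From mathcomp Require Import zify ring lra.
Require Import Defs.

Set Implicit Arguments.
Unset Strict Implicit.
Unset Printing Implicit Defensive.

Import Order.TTheory GRing.Theory Num.Theory.
Import numFieldNormedType.Exports.
Import ComplexField.Normc.

Local Open Scope classical_set_scope.
Local Open Scope ring_scope.
Local Open Scope complex_scope.

(** * Partitions and controls *)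

(** [S] is known only through Chen's identity, its finite p-variation in each degree and, up to
    degree [p], the exponentials of Lie polynomials. That it is group-like in every degree is never
    proved. Two consequences of that property are needed: the coefficients (x_t - x_s)^n / n! of the
    words x...x, and the identity that takes a factor e^(beta x) out of an entry of the development.
    Both come from one principle. The Lie polynomial gives the identity in low degree, so the
    discrepancy over [u,v] is O(om(u,v)^th) with th > 1; by Chen's identity the discrepancy is, up
    to a bounded factor, the increment of a function of time; such a function is constant
    ([almost_constant]).

    A development sums over all degrees, so the bound on [S] must be uniform in the degree n. Sewing
    is therefore run with a constant depending only on a lower bound th0 of the exponents n / q, n >
    [p].

    The relations are kept in the form (e^b - 1) A(b) = ... and never divided by e^b - 1, so that
    every complex b is covered; at the end they are combined through 1 - cosh b = (1 - e^b)(1 -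
    e^(-b)) / 2. *)

Section Partitions.
Variable R : realType.
Implicit Types (f g h : R -> R -> R) (D : seq R) (s t u v d : R).

(** Agrees with [partition_sum]; the recursion on the list makes induction along a partition and
    cutting it in two immediate. *)
Fixpoint psum (M : nmodType) (f : R -> R -> M) (s : R) (D : seq R) : M :=
  if D is x :: D' then f s x + psum f x D' else 0.

Lemma partition_sumE (M : nmodType) (f : R -> R -> M) s D :
  partition_sum s D f = psum f s D.
Proof.
rewrite /partition_sum; elim: D s => [|x D IH] s; first by rewrite big_nil.
rewrite /= -IH big_nat_recl //=; congr (_ + _).
apply: eq_big_nat => i /andP[_ hi].
rewrite (set_nth_default x s) ?(set_nth_default x s (s := D)) //=.
exact: ltnW.
Qed.

Lemma psum_cat (M : nmodType) (f : R -> R -> M) s D D' :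
  psum f s (D ++ D') = psum f s D + psum f (last s D) D'.
Proof. by elim: D s => [|x D IH] s /=; rewrite ?add0r // IH addrA. Qed.

Lemma partition_bounds s t D : itv_partition s t D ->
  {in D, forall x, s < x <= t}.
Proof.
elim: D s => [//|x D IH] s /[dup] /itv_partition_cons hD [/= /andP[sx _] _] y.
rewrite inE => /predU1P[->|yD].
  by rewrite sx (itv_partition_le hD).
by have /andP[xy ->] := IH _ hD _ yD; rewrite (lt_trans sx xy).
Qed.

Lemma le_psum f g s t D :
    (forall u v, s <= u -> u <= v -> v <= t -> f u v <= g u v) ->
  itv_partition s t D -> psum f s D <= psum g s D.
Proof.
elim: D s => [//|x D IH] s fg /[dup] /itv_partition_cons hD [/= /andP[sx _] _].
have xt := itv_partition_le hD.
rewrite lerD ?fg ?(ltW sx) // IH // => u v xu; apply: fg.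
exact: le_trans (ltW sx) xu.
Qed.

Lemma psum_ge0 f s t D : (forall u v, 0 <= f u v) ->
  itv_partition s t D -> 0 <= psum f s D.
Proof.
move=> f0; elim: D s => [//|x D IH] s /itv_partition_cons hD /=.
by rewrite addr_ge0 // IH.
Qed.

Lemma psumZ (a : R) f s D : psum (fun u v => a * f u v) s D = a * psum f s D.
Proof. by elim: D s => [|x D IH] s /=; rewrite ?mulr0 // IH mulrDr. Qed.

Lemma psum_sum (I : Type) (r : seq I) (F : I -> R -> R -> R) s D :
  psum (fun u v => \sum_(i <- r) F i u v) s D = \sum_(i <- r) psum (F i) s D.
Proof.
elim: D s => [|x D IH] s /=; first by rewrite big1.
by rewrite IH big_split.
Qed.

Lemma mesh_lt_cons s x D d :
  mesh_lt s (x :: D) d <-> (x - s < d) /\ mesh_lt x D d.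
Proof.
split=> [H|[H0 H]].
  split; first exact: (H 0).
  move=> l lD; have := H l.+1 lD.
  rewrite /= (set_nth_default x s) // (set_nth_default x s (s := x :: D)) //=.
  exact: ltnW.
move=> [|l] lD //=.
have := H l lD; rewrite (set_nth_default s x) //.
by rewrite (set_nth_default s x (s := x :: D)) //= ltnW.
Qed.

Lemma le_psum_mesh f g s t D d :
    (forall u v, s <= u -> u <= v -> v <= t -> v - u < d -> f u v <= g u v) ->
  itv_partition s t D -> mesh_lt s D d -> psum f s D <= psum g s D.
Proof.
elim: D s => [//|x D IH] s fg /[dup] /itv_partition_cons hD [/= /andP[sx _] _].
move=> /mesh_lt_cons[xsd hm]; have xt := itv_partition_le hD.
rewrite lerD ?fg ?(ltW sx) // IH // => u v xu; apply: fg.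
exact: le_trans (ltW sx) xu.
Qed.

Lemma uniform_partition s t d : s <= t -> 0 < d ->
  exists2 D, itv_partition s t D & mesh_lt s D d.
Proof.
(* Steps of length d / 2 keep the mesh strictly below d; n bounds their number and carries the
   induction. *)
move=> st d0; have [n] : exists n : nat, t - s <= n%:R * (d / 2).
  exists (Num.truncn ((t - s) / (d / 2))).+1.
  by rewrite -ler_pdivrMr ?divr_gt0 // ltW // truncnS_gt.
elim: n s st => [|n IH] s st.
  rewrite mul0r subr_le0 => ts; exists [::] => //.
  by split => //=; rewrite eq_le st ts.
have [ts|st'] := leP t s.
  by exists [::] => //; split => //=; rewrite eq_le st ts.
have [tsd|dts] := leP (t - s) (d / 2).
  exists [:: t]; first exact: itv_partition1.
  by apply/mesh_lt_cons; split => //; lra.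
move=> h; have [||D hD mD] := IH (s + d / 2); first lra.
  by move: h; rewrite -natr1 mulrDl mul1r; lra.
exists (s + d / 2 :: D); last by apply/mesh_lt_cons; split => //; lra.
by case: hD => hD1 hD2; split => //=; rewrite hD1 andbT; lra.
Qed.

(** A partition of [s, t] extends to one of [0, 1] by at most one interval on each side, which only
    adds nonnegative terms. *)
Lemma psum_sub h M s t D : (forall u v, 0 <= h u v) ->
    (forall D, itv_partition 0 1 D -> psum h 0 D <= M) ->
    0 <= s -> t <= 1 -> itv_partition s t D -> psum h s D <= M.
Proof.
move=> h0 hM s0 t1 hD.
have [E hE] : exists E, itv_partition 0 s E.
  have [->|s0'] := eqVneq s 0; first by exists [::].
  by exists [:: s]; apply: itv_partition1; rewrite lt_def s0'.
have [E' hE'] : exists E', itv_partition t 1 E'.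
  have [->|s0'] := eqVneq t 1; first by exists [::].
  by exists [:: 1]; apply: itv_partition1; rewrite lt_neqAle s0'.
apply: le_trans (hM _ (itv_partition_cat hE (itv_partition_cat hD hE'))).
rewrite !psum_cat.
have -> : last 0 E = s by case: hE => _ /eqP.
have -> : last s D = t by case: hD => _ /eqP.
rewrite addrCA lerDl addr_ge0 //; first exact: psum_ge0 hE.
exact: psum_ge0 hE'.
Qed.

End Partitions.

Lemma last_take (T : Type) (x0 : T) i (r : seq T) : (0 < i <= size r)%N ->
  last x0 (take i r) = nth x0 r i.-1.
Proof.
case: i => // i /= hi; rewrite (last_nth x0) size_takel //=.
by rewrite nth_take.
Qed.

Section Control.
Variable R : realType.
Implicit Types (f g h om : R -> R -> R) (D : seq R) (s t u v d e : R).

(** The last clause, uniform smallness on short intervals, stands in for joint continuity: it is the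
    form in which a small mesh is used. *)
Definition control om : Prop :=
  [/\ forall s t, 0 <= s -> s <= t -> t <= 1 -> 0 <= om s t,
      forall s t u, 0 <= s -> s <= t -> t <= u -> u <= 1 ->
        om s t + om t u <= om s u &
      forall e, 0 < e -> exists2 d, 0 < d &
        forall s t, 0 <= s -> s <= t -> t <= 1 -> t - s < d -> om s t <= e].

Definition variation_control h s t :=
  sup [set psum h s D | D in itv_partition s t].

Section VariationControl.
Variables (h : R -> R -> R) (M : R).
Hypothesis h0 : forall u v, 0 <= h u v.
Hypothesis hM : forall D, itv_partition 0 1 D -> psum h 0 D <= M.
Local Notation om := (variation_control h).

Lemma psum_le_variation s t D : 0 <= s -> t <= 1 -> itv_partition s t D ->
  psum h s D <= om s t.
Proof.
move=> s0 t1 hD; apply: ub_le_sup; last by exists D.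
by exists M => _ [D' hD' <-]; apply: psum_sub hD'.
Qed.

Lemma partition_exists (s t : R) : s <= t -> exists D, itv_partition s t D.
Proof.
by move=> st; have [D hD _] := uniform_partition st ltr01; exists D.
Qed.

Lemma variation_le e s t : s <= t ->
    (forall D, itv_partition s t D -> psum h s D <= e) -> om s t <= e.
Proof.
move=> st H; apply: ge_sup => [|_ [D hD <-]]; last exact: H.
by have [D hD] := partition_exists st; exists (psum h s D), D.
Qed.

Lemma variation_ge0 s t : 0 <= s -> s <= t -> t <= 1 -> 0 <= om s t.
Proof.
move=> s0 st t1; have [D hD] := partition_exists st.
exact: le_trans (psum_ge0 h0 hD) (psum_le_variation s0 t1 hD).
Qed.

Lemma variation_superadditive s t u : 0 <= s -> s <= t -> t <= u -> u <= 1 ->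
  om s t + om t u <= om s u.
Proof.
move=> s0 st tu u1; rewrite -lerBrDr; apply: variation_le => // D hD.
rewrite lerBrDr addrC -lerBrDr; apply: variation_le => // D' hD'.
rewrite lerBrDr addrC; have := psum_cat h s D D'.
have -> : last s D = t by case: hD => _ /eqP.
move=> <-; apply: psum_le_variation => //.
exact: itv_partition_cat hD hD'.
Qed.

End VariationControl.

Lemma control_diag om s : control om -> 0 <= s -> s <= 1 -> om s s = 0.
Proof.
move=> [om0 omD _] s0 s1; have := omD s s s s0 (lexx _) (lexx _) s1.
by have := om0 s s s0 (lexx _) s1; lra.
Qed.

Lemma control_mono om s t u v : control om -> 0 <= s -> s <= t -> t <= u ->
  u <= v -> v <= 1 -> om t u <= om s v.
Proof.
move=> [om0 omD _] s0 st tu uv v1.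
have t0 := le_trans s0 st; have u1 := le_trans uv v1.
have := omD s t v s0 st (le_trans tu uv) v1.
have := omD t u v t0 tu uv v1.
have := om0 s t s0 st (le_trans tu u1).
by have := om0 u v (le_trans t0 tu) uv v1; lra.
Qed.


Lemma psum_control om s t D : control om -> 0 <= s -> s <= t -> t <= 1 ->
  itv_partition s t D -> psum om s D <= om s t.
Proof.
move=> hom s0 st t1; elim: D s s0 st => [|x D IH] s s0 st.
  by case: hom => om0 _ _ _; exact: om0.
move=> /[dup] /itv_partition_cons hD [/= /andP[sx _] _].
have xt := itv_partition_le hD; have x0 := le_trans s0 (ltW sx).
case: (hom) => _ omD _.
by apply: le_trans (omD s x t s0 (ltW sx) xt t1); rewrite lerD2l IH.
Qed.

(* The partition is cut at the first point where the control reaches half of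
   its total value, so that both remaining parts carry at most half of it. *)
Lemma sewing_partition om f (B th th0 C : R) : control om -> 1 < th0 ->
    th0 <= th -> 0 <= B -> 2 + 2 * C * 2 `^ (- th0) <= C -> 0 <= C ->
    (forall s t u, 0 <= s -> s <= t -> t <= u -> u <= 1 ->
      `|f s u - f s t - f t u| <= B * om s u `^ th) ->
  forall s t D, 0 <= s -> s <= t -> t <= 1 -> itv_partition s t D ->
    `|f s t - psum f s D| <= C * B * om s t `^ th.
Proof.
move=> hom th0_gt1 th0th B0 hC C0 hf s t D.
have th_gt0 : 0 < th by lra.
have th_neq0 : th != 0 by lra.
have [n] := ubnP (size D); elim: n s t D => // n IH s t D /ltnSE leD s0 st t1.
case: (hom) => om0 omD _.
have [->|D0] := eqVneq D [::].
  move=> /itv_partition_nil est; rewrite -est /= subr0.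
  have s1 : s <= 1 by lra.
  have := hf s s s s0 (lexx _) (lexx _) s1.
  rewrite (control_diag hom s0 s1) powR0 // !mulr0.
  by rewrite subrr sub0r normrN.
move=> hD; pose P := [pred x | om s t / 2 <= om s x].
have lastD : last s D = t by case: hD => _ /eqP.
have hasP : has P D.
  apply/hasP; exists t => /=; last by have := om0 s t s0 st t1; lra.
  by case: (D) D0 lastD => //= x D' _ <-; exact: mem_last.
set i := find P D; have iD : (i < size D)%N by rewrite -has_find.
set D1 := take i D; set t' := nth s D i; set D2 := drop i.+1 D.
have defD : D = D1 ++ t' :: D2 by rewrite -drop_nth // cat_take_drop.
set s1 := last s D1.
have Pt' : om s t / 2 <= om s t' by exact: (nth_find s hasP).
have [pD1 [s1t' pD2]] : path <%O s D1 /\ s1 < t' /\ path <%O t' D2.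
  by case: hD; rewrite defD cat_path /= => /and3P[-> -> ->].
have hD1 : itv_partition s s1 D1 by split.
have hD2 : itv_partition t' t D2.
  by split => //; rewrite -lastD defD last_cat.
have ss1 := itv_partition_le hD1; have t't := itv_partition_le hD2.
have s1t := le_trans (ltW s1t') t't.
have Ps1 : om s s1 <= om s t / 2.
  have [e|] := eqVneq D1 [::].
    rewrite /s1 e /= (control_diag hom s0); last by lra.
    by have := om0 s t s0 st t1; lra.
  move=> nD1; rewrite leNgt; apply/negP => lt.
  have i0 : (0 < i)%N by rewrite lt0n; apply: contra_neq nD1 => i0; rewrite /D1 i0 take0.
  have := @before_find _ s P D i.-1; rewrite ltn_predL => /(_ i0) /negP; apply.
  rewrite /=; suff -> : nth s D i.-1 = s1 by exact: ltW.
  by rewrite /s1 last_take // i0 ltnW.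
have Pt'2 : om t' t <= om s t / 2.
  have := omD s t' t s0 (le_trans ss1 (ltW s1t')) t't t1; lra.
have szD : (size D1 + (size D2).+1 = size D)%N.
  by rewrite [in RHS]defD size_cat.
have half u v : 0 <= u -> u <= v -> v <= 1 -> om u v <= om s t / 2 ->
    om u v `^ th <= 2 `^ (- th0) * om s t `^ th.
  move=> u0 uv v1 h.
  have omst := om0 s t s0 st t1.
  have: om u v `^ th <= (om s t / 2) `^ th.
    by rewrite ge0_ler_powR ?nnegrE ?(ltW th_gt0) ?om0 ?divr_ge0.
  move=> /le_trans; apply; rewrite powRM // mulrC ler_wpM2r ?powR_ge0 //.
  rewrite -powR_inv1 // -powRrM mulN1r ler_powR //; last by rewrite lerN2.
  by rewrite ler1n.
have szD1 : (size D1 < n)%N.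
  by apply: leq_trans leD; rewrite -szD addnS ltnS leq_addr.
have szD2 : (size D2 < n)%N by apply: leq_trans leD; rewrite -szD leq_addl.
have s11 := le_trans s1t t1.
have s10 := le_trans s0 ss1; have t'0 := le_trans s10 (ltW s1t').
have e1 : `|f s s1 - psum f s D1| <= C * B * (2 `^ (- th0) * om s t `^ th).
  apply: le_trans (IH _ _ _ szD1 s0 ss1 s11 hD1) _.
  by rewrite ler_wpM2l ?mulr_ge0 // half.
have e2 : `|f t' t - psum f t' D2| <= C * B * (2 `^ (- th0) * om s t `^ th).
  apply: le_trans (IH _ _ _ szD2 t'0 t't t1 hD2) _.
  by rewrite ler_wpM2l ?mulr_ge0 // half.
have e3 := hf s s1 t s0 ss1 s1t t1.
have e4 := hf s1 t' t s10 (ltW s1t') t't t1.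
have mono : B * om s1 t `^ th <= B * om s t `^ th.
  rewrite ler_wpM2l // ge0_ler_powR ?nnegrE ?(ltW th_gt0) ?om0 //.
  exact: (control_mono hom).
have BZ : 0 <= B * om s t `^ th by rewrite mulr_ge0 ?powR_ge0.
have hCZ := ler_wpM2r BZ hC.
rewrite [in psum f s D]defD psum_cat /= -/s1.
(* Cutting at s1 and t' costs two defects, each at most B om^th. Each of the two remaining parts
   costs C B (om / 2)^th at most. This is the origin of the condition 2 + 2 C 2^(-th0) <= C. *)
have -> : f s t - (psum f s D1 + (f s1 t' + psum f t' D2)) =
   (f s t - f s s1 - f s1 t) + (f s1 t - f s1 t' - f t' t) +
   (f s s1 - psum f s D1) + (f t' t - psum f t' D2) by ring.
apply: le_trans (ler_normD _ _) _.
apply: le_trans (lerD (le_trans (ler_normD _ _) (lerD (ler_normD _ _) (lexx _))) (lexx _)) _.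
apply: le_trans (lerD (lerD (lerD e3 (le_trans e4 mono)) e1) e2) _.
move: hCZ; clear; set Z := om s t `^ th; lra.
Qed.
End Control.

Section Sewing.
Variable R : realType.
Implicit Types (f om : R -> R -> R) (D : seq R) (s t u v d e : R).

(** Partition sums of f vanish as the mesh shrinks, so f is bounded by what sewing along a partition
    loses. The constant depends on th0 and not on th, hence is the same for all degrees n when th =
    n / q. *)
Lemma sewing om f (B th th0 : R) : control om -> 1 < th0 ->
    th0 <= th -> 0 <= B ->
    (forall s t u, 0 <= s -> s <= t -> t <= u -> u <= 1 ->
      `|f s u - f s t - f t u| <= B * om s u `^ th) ->
    (forall e, 0 < e -> exists2 d, 0 < d & forall s t D, 0 <= s -> t <= 1 ->
      itv_partition s t D -> mesh_lt s D d ->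
      psum (fun u v => `|f u v|) s D <= e) ->
  forall s t, 0 <= s -> s <= t -> t <= 1 ->
    `|f s t| <= 2 / (1 - 2 * 2 `^ (- th0)) * B * om s t `^ th.
Proof.
move=> hom th0_gt1 th0th B0 hf hv s t s0 st t1.
have q1 : 2 * 2 `^ (- th0) < 1 :> R.
  rewrite -[X in X * _](@powRr1 R 2) // -powRD; last by rewrite pnatr_eq0 implybT.
  rewrite /powR pnatr_eq0 /= expR_lt1 pmulr_llt0 ?subr_lt0 //.
  by rewrite ln_gt0 // ltr1n.
set q := 2 * 2 `^ (- th0) in q1 *; set C := 2 / (1 - q).
(* C is the fixed point of C = 2 + 2 C 2^(-th0), which is positive because th0 > 1. *)
have hC : 2 + 2 * C * 2 `^ (- th0) <= C.
  suff -> : 2 + 2 * C * 2 `^ (- th0) = C by [].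
  rewrite mulrAC -/q /C; field; lra.
have C0 : 0 <= C by rewrite divr_ge0 // subr_ge0 ltW.
apply/ler_addgt0Pr => e e0; have [d d0 hd] := hv e e0.
have [D hD mD] := uniform_partition st d0.
have := sewing_partition hom th0_gt1 th0th B0 hC C0 hf s0 st t1 hD.
have := hd s t D s0 t1 hD mD.
have : `|psum f s D| <= psum (fun u v => `|f u v|) s D.
  elim: (D) (s) => [|x D' IH] y /=; first by rewrite normr0.
  by apply: le_trans (ler_normD _ _) _; rewrite lerD2l IH.
have := ler_normD (f s t - psum f s D) (psum f s D).
by rewrite subrK; lra.
Qed.

End Sewing.

Section Tensors.
Variables (R : realType) (d : nat).
Implicit Types (xi eta : tseries R d) (w : seq 'I_d).

(** For series with constant term 1 the two end terms are eta w and xi w, so the defect of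
    additivity of a multiplicative functional is the remaining sum, over strictly shorter words. *)
Lemma tmul_ends xi eta w : (0 < size w)%N ->
  tmul xi eta w = xi [::] * eta w + xi w * eta [::] +
    \sum_(1 <= k < size w) xi (take k w) * eta (drop k w).
Proof.
move=> w0; rewrite /tmul big_ord_recr /= take_size drop_size.
rewrite -(big_mkord xpredT (fun k => xi (take k w) * eta (drop k w))).
by rewrite big_ltn // take0 drop0 addrAC.
Qed.

Lemma coord_le_projective_norm (n : nat) (a : tensor R d n) (w : n.-tuple 'I_d) :
  `|a w| <= projective_norm a.
Proof.
apply: lb_le_inf.
  (* The infimum is over a nonempty set: it contains the value of the expansion of a in the
     basis. *)
  pose v (j : 'I_#|{: n.-tuple 'I_d}|) (i : 'I_n) : 'rV[R]_d :=
    delta_mx 0 (tnth (enum_val j) i).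
  pose c (j : 'I_#|{: n.-tuple 'I_d}|) := a (enum_val j).
  exists (\sum_j `|c j| * \prod_i euclidean_norm (v j i)), #|{: n.-tuple 'I_d}|, c, v.
  split => //; apply/ffunP => u; rewrite sum_ffunE (bigD1 (enum_rank u)) //=.
  rewrite big1 ?addr0 => [|j ju].
    rewrite !ffunE /c enum_rankK big1 ?[_%:A]mulr1 // => i _.
    by rewrite /v enum_rankK mxE !eqxx.
  rewrite !ffunE; have [i hi] : exists i, tnth (enum_val j) i != tnth u i.
    apply/existsP; apply: contraNT ju; rewrite negb_exists => /forallP H.
    rewrite -(enum_valK j); apply/eqP; congr enum_rank; apply: eq_from_tnth => i.
    by apply/eqP; have := H i; rewrite negbK.
  by rewrite (bigD1 i) //= /v mxE eqxx /= eq_sym (negPf hi) mul0r scaler0.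
move=> _ [m [c [v [-> ->]]]].
rewrite sum_ffunE; apply: le_trans (ler_norm_sum _ _ _) _.
apply: ler_sum => j _; rewrite !ffunE normrM ler_wpM2l // normr_prod.
apply: ler_prod => i _; rewrite normr_ge0 /=.
rewrite /euclidean_norm -sqrtr_sqr ler_wsqrtr //.
by rewrite (bigD1 (tnth w i)) //= lerDl sumr_ge0 // => k _; rewrite sqr_ge0.
Qed.

Lemma coef_le_projective_norm xi w :
  `|xi w| <= projective_norm (component xi (size w)).
Proof.
have := coord_le_projective_norm (component xi (size w)) (in_tuple w).
by rewrite ffunE.
Qed.


End Tensors.

(** * Geometric decay of multiplicative functionals *)

Section PVariation.
Variables (R : realType) (d : nat) (p : R) (S : R -> R -> tseries R d).
Hypothesis p_ge1 : 1 <= p.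
Hypothesis hS : forall n, multiplicative_functional p n S.
Implicit Types (s t u v e : R) (w : seq 'I_d).

Lemma mf_nil s t : 0 <= s -> s <= t -> t <= 1 -> S s t [::] = 1.
Proof. by move=> s0 st t1; case: (hS 0) => H _ _ _; apply: H; split. Qed.

Lemma mf_mul s t u w : 0 <= s -> s <= t -> t <= u -> u <= 1 ->
  S s u w = tmul (S s t) (S t u) w.
Proof. by move=> *; case: (hS (size w)) => _ _ H _; apply: H. Qed.

Lemma mf_diag s w : 0 <= s -> s <= 1 -> (0 < size w)%N -> S s s w = 0.
Proof.
move=> s0 s1; have [n] := ubnP (size w); elim: n w => // n IH w /ltnSE wn w0.
have := mf_mul w s0 (lexx s) (lexx s) s1.
rewrite tmul_ends // mf_nil // mulr1 mul1r big_nat big1 ?addr0; first by lra.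
move=> k /andP[k0 kw]; rewrite IH ?mul0r // size_takel ?(ltnW kw) //.
exact: leq_trans kw wn.
Qed.

(** Continuity at the points of the diagonal, where S vanishes on nonempty words, made uniform by
    the compactness of [0, 1]. *)
Lemma mf_small w e : (0 < size w)%N -> 0 < e -> exists2 r, 0 < r &
  forall s t, 0 <= s -> s <= t -> t <= 1 -> t - s < r -> `|S s t w| <= e.
Proof.
move=> w0 e0; case: (hS (size w)) => _ hc _ _.
have {}hc := (subspace_continuousP _ _).1 (hc w (leqnn _)).
pose P (r x : R) := forall t, 0 <= x -> x <= t -> t <= 1 -> t - x < r ->
  `|S x t w| <= e.
have : \forall r \near 0^'+, `[0, 1]%classic `<=` P r.
  apply: ((compact_near_coveringP _).1 (@segment_compact R 0 1)).
  move=> x; rewrite /= in_itv /= => /andP[x0 x1].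
  have xx : simplex (x, x) by split => /=.
  have /cvgrPdist_lt/(_ e e0) := hc (x, x) xx.
  rewrite /within /= => /nbhs_ballP [r /= r0 hr].
  exists (ball x (r / 2), [set y | 0 < y < r / 2]) => /=.
    split; first by apply: nbhsx_ballx; rewrite divr_gt0.
    by near=> y; apply/andP; split; near: y;
      [exact: nbhs_right_gt|apply: nbhs_right_lt; rewrite divr_gt0].
  move=> [y b] /= [xy /andP[b0 br]] t y0 yt t1 tyb.
  move: xy; rewrite /ball /= => xy.
  have := hr (y, t); rewrite /from_subspace /= mf_diag // sub0r normrN => /(_ _ _)/ltW; apply.
    split; rewrite /ball /=; first by lra.
    have -> : x - t = (x - y) - (t - y) by ring.
    apply: le_lt_trans (ler_normB _ _) _; rewrite (ger0_norm (_ : 0 <= t - y)) ?subr_ge0 //.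
    lra.
  by split.
move=> H; near (0 : R)^'+ => r.
have r0 : 0 < r by near: r; exact: nbhs_right_gt.
have hr : `[0, 1]%classic `<=` P r by near: r.
exists r => // s t s0 st t1 str; apply: hr => //=.
by rewrite in_itv /= s0 (le_trans st).
Unshelve. all: by end_near. Qed.

Lemma mf_pvar w : (0 < size w)%N -> exists M, forall D, itv_partition 0 1 D ->
  psum (fun u v => `|S u v w| `^ (p / (size w)%:R)) 0 D <= M.
Proof.
move=> w0; case: (hS (size w)) => _ _ _ /(_ (size w)).
rewrite w0 leqnn => /(_ isT)[M hM]; exists M => D hD.
apply: le_trans (hM D hD); rewrite partition_sumE; apply: le_psum hD.
move=> u v _ _ _.
have cw := coef_le_projective_norm (S u v) w.
apply: ge0_ler_powR => //; rewrite ?nnegrE ?(le_trans _ cw) //.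
by rewrite divr_ge0 // (le_trans ler01).
Qed.

End PVariation.

Section Words.
Variable T : finType.

(** Words are plain sequences rather than tuples, so that concatenating and splitting them involves
    no casts. *)
Fixpoint words (n : nat) : seq (seq T) :=
  if n is n'.+1 then [seq a :: w | a <- enum T, w <- words n'] else [:: [::]].

Lemma mem_words n w : (w \in words n) = (size w == n).
Proof.
elim: n w => [|n IH] w /=; first by rewrite inE size_eq0.
apply/allpairsP/idP => [[[a v] /= [_ vn ->]]|]; first by rewrite /= eqSS -IH.
case: w => // a v; rewrite /= eqSS -IH => vn.
by exists (a, v); rewrite mem_enum.
Qed.

Lemma uniq_words n : uniq (words n).
Proof.
elim: n => //= n IH; apply: allpairs_uniq => //; first exact: enum_uniq.
by move=> [a v] [b w] _ _ /= [-> ->].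
Qed.

Lemma big_words_tuple (V : nmodType) n (F : seq T -> V) :
  \sum_(w : n.-tuple T) F w = \sum_(w <- words n) F w.
Proof.
rewrite -(big_map val xpredT F); apply: perm_big; apply: uniq_perm.
- by rewrite map_inj_uniq ?index_enum_uniq //; exact: val_inj.
- exact: uniq_words.
move=> w; rewrite mem_words; apply/mapP/eqP => [[u _ ->]|e].
  by rewrite size_tuple.
by exists (Tuple (introT eqP e)).
Qed.

Lemma big_words0 (V : nmodType) (F : seq T -> V) :
  \sum_(w <- words 0) F w = F [::].
Proof. by rewrite big_seq1. Qed.

Lemma big_wordsS (V : nmodType) n (F : seq T -> V) :
  \sum_(w <- words n.+1) F w = \sum_a \sum_(w <- words n) F (a :: w).
Proof. by rewrite big_allpairs_dep /= big_enum. Qed.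

Lemma big_words_cat (V : nmodType) m n (F : seq T -> V) :
  \sum_(w <- words (m + n)) F w =
  \sum_(u <- words m) \sum_(v <- words n) F (u ++ v).
Proof.
elim: m F => [|m IH] F; first by rewrite big_words0.
rewrite addSn !big_wordsS; apply: eq_bigr => a _.
exact: IH (fun w => F (a :: w)).
Qed.

Lemma big_words_rcons (V : nmodType) n (F : seq T -> V) :
  \sum_(w <- words n.+1) F w = \sum_(w <- words n) \sum_a F (rcons w a).
Proof.
rewrite -addn1 big_words_cat; apply: eq_bigr => w _.
rewrite big_wordsS; apply: eq_bigr => a _.
by rewrite big_words0 cats1.
Qed.

Lemma size_words n : size (words n) = (#|T| ^ n)%N.
Proof.
elim: n => [|n IH] /=; first by rewrite expn0.
by rewrite size_allpairs IH -cardE expnS.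
Qed.

End Words.

Lemma common_radius (R : realType) (I : eqType) (r : seq I) (P : R -> I -> Prop) :
    (forall d d' i, 0 < d' -> d' <= d -> P d i -> P d' i) ->
    {in r, forall i, exists2 d, 0 < d & P d i} ->
  exists2 d, 0 < d & {in r, forall i, P d i}.
Proof.
move=> Pmono; elim: r => [|i r IH] H; first by exists 1.
have [j jr|d d0 hd] := IH; first by apply: H; rewrite inE jr orbT.
have [d' d'0 hd'] := H i (mem_head _ _).
have m0 : 0 < Num.min d d' by rewrite lt_min d0.
exists (Num.min d d') => // j; rewrite inE => /predU1P[->|jr].
  by apply: Pmono m0 _ hd'; rewrite ge_min lexx orbT.
by apply: Pmono m0 _ (hd j jr); rewrite ge_min lexx.
Qed.

Section ControlExists.
Variables (R : realType) (d : nat) (p : R) (S : R -> R -> tseries R d).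
Hypothesis p_ge1 : 1 <= p.
Hypothesis hS : forall n, multiplicative_functional p n S.
Implicit Types (s t u v e : R) (w : seq 'I_d).

(* Taking q > p rather than p makes the control vanish on the diagonal
   without knowing that the p-variation is a continuous function of the
   interval. *)
Lemma control_exists (q : R) (N : nat) : p < q ->
  exists2 om, control om & forall w s t, (0 < size w <= N)%N ->
    0 <= s -> s <= t -> t <= 1 -> `|S s t w| <= (om s t `^ q^-1) ^+ size w.
Proof.
move=> pq; have p0 : 0 < p := lt_le_trans ltr01 p_ge1.
have q0 : 0 < q := lt_trans p0 pq.
pose th := q / p; have th1 : 0 < th - 1 by rewrite subr_gt0 ltr_pdivlMr ?mul1r.
have th0 : 0 < th by rewrite divr_gt0.
pose r := [seq w <- flatten [seq words 'I_d n | n <- iota 0 N.+1] | (0 < size w)%N].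
have mem_r w : (w \in r) = (0 < size w <= N)%N.
  rewrite mem_filter; congr (_ && _); apply/flatten_mapP/idP.
    by move=> [n]; rewrite mem_iota mem_words => /andP[_ nN] /eqP ->.
  by move=> wN; exists (size w); rewrite ?mem_iota ?mem_words.
pose y w u v := `|S u v w| `^ (p / (size w)%:R).
have y0 w u v : 0 <= y w u v by rewrite powR_ge0.
(* Since th = q / p, the summand is |S_(u,v) w|^(q / size w), so that [h] adds up the q-variations
   of all coefficients of degree at most N. *)
pose h u v := \sum_(w <- r) y w u v `^ th.
have h0 u v : 0 <= h u v by rewrite sumr_ge0 // => w _; rewrite powR_ge0.
have [M hM] : exists M, {in r, forall w D, itv_partition 0 1 D ->
    psum (y w) 0 D <= M}.
  have : {in r, forall w, exists M, forall D, itv_partition 0 1 D ->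
      psum (y w) 0 D <= M}.
    by move=> w; rewrite mem_r => /andP[w0 _]; exact: (mf_pvar p_ge1 hS w0).
  elim: (r) => [|w r' IH] H; first by exists 0.
  have [w' w'r|M hM] := IH; first by apply: H; rewrite inE w'r orbT.
  have [M' hM'] := H w (mem_head _ _).
  exists (Num.max M M') => w'; rewrite inE => /predU1P[->|w'r] D hD.
    by apply: le_trans (hM' D hD) _; rewrite le_max lexx orbT.
  by apply: le_trans (hM w' w'r D hD) _; rewrite le_max lexx.
have subM w s t D : w \in r -> 0 <= s -> t <= 1 -> itv_partition s t D ->
    psum (y w) s D <= M.
  by move=> wr s0 t1; apply: psum_sub (hM w wr) s0 t1.
have [r0|[w1 w1r]] : r = [::] \/ exists w, w \in r.
  by case: (r) => [|w r']; [left|right; exists w; rewrite mem_head].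
  exists (fun _ _ => 0); last by move=> w s t; rewrite -mem_r r0.
  by split => [*|*|e e0]; rewrite ?addr0 //; exists 1 => // *; exact: ltW.
have M0 : 0 <= M.
  have [D hD] := partition_exists (@ler01 R).
  exact: le_trans (psum_ge0 (y0 w1) hD) (hM w1 w1r D hD).
(* Interpolation: y^th <= e^(th - 1) y wherever y <= e. Bounded p-variation sums and small
   coefficients thus give small q-variation. *)
have bnd e s t D : 0 <= e -> 0 <= s -> t <= 1 -> itv_partition s t D ->
    (forall w u v, w \in r -> s <= u -> u <= v -> v <= t -> y w u v <= e) ->
    psum h s D <= (size r)%:R * (e `^ (th - 1) * M).
  move=> e0 s0 t1 hD hy.
  rewrite psum_sum -sum1_size natr_sum mulr_suml !big_seq.
  apply: ler_sum => w wr; rewrite mul1r.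
  apply: le_trans (_ : e `^ (th - 1) * psum (y w) s D <= _); last first.
    by rewrite ler_wpM2l ?powR_ge0 // (subM w s t).
  rewrite -psumZ; apply: le_psum hD => u v su uv vt.
  rewrite -(mulr_powRB1 (y0 w u v) th0) mulrC; apply: ler_wpM2r => //.
  by rewrite ge0_ler_powR ?nnegrE ?(ltW th1) ?hy.
have hbd D : itv_partition 0 1 D -> psum h 0 D <= (size r)%:R * (M `^ (th - 1) * M).
  (* The bound e = M is admissible because a single interval [u, v] is already a partition of
     itself. *)
  move=> hD; apply: (bnd M 0 1) hD _ => // w u v wr u0 uv v1.
  have [->|uv'] := eqVneq u v.
    rewrite /y (mf_diag hS) //; first by rewrite normr0 powR0 //;
      rewrite mulf_neq0 ?invr_neq0 ?(gt_eqF p0) // pnatr_eq0;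
      move: wr; rewrite mem_r; case: size.
    exact: le_trans u0 uv.
    by move: wr; rewrite mem_r => /andP[].
  have := subM w u v [:: v] wr u0 v1; rewrite /= addr0; apply.
  by apply: itv_partition1; rewrite lt_neqAle uv'.
exists (variation_control h).
  split.
  - exact: variation_ge0 h0 hbd.
  - exact: variation_superadditive h0 hbd.
  move=> e e0; pose K := (size r)%:R * M + 1.
  have K0 : 0 < K by rewrite ltr_wpDl // mulr_ge0.
  pose eta := (e / K) `^ (th - 1)^-1.
  have eta0 : 0 < eta by rewrite powR_gt0 // divr_gt0.
  pose P (b : R) w := forall s t, 0 <= s -> s <= t -> t <= 1 -> t - s < b ->
    y w s t <= eta.
  have [b b0 hb] : exists2 b, 0 < b & {in r, forall w, P b w}.
    apply: common_radius => [b b' w b'0 b'b H s t s0 st t1 tsb|w].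
      by apply: H => //; exact: lt_le_trans tsb b'b.
    rewrite mem_r => /andP[w0 _].
    have n0 : 0 < (size w)%:R :> R by rewrite ltr0n.
    have [//||b b0 hb] := mf_small hS (w := w) (e := eta `^ ((size w)%:R / p)).
      by rewrite powR_gt0.
    exists b => // s t s0 st t1 tsb; have := hb s t s0 st t1 tsb.
    have eta_eq : (eta `^ ((size w)%:R / p)) `^ (p / (size w)%:R) = eta.
      rewrite -powRrM (_ : _ * _ = 1) ?powRr1 ?(ltW eta0) //.
      by field; rewrite !gt_eqF.
    move=> H; rewrite -eta_eq /y.
    have pn0 : 0 <= p / (size w)%:R by rewrite divr_ge0 ?ltW.
    by apply: (ge0_ler_powR pn0) H; rewrite nnegrE ?powR_ge0.
  exists b => // s t s0 st t1 tsb; apply: variation_le => // D hD.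
  apply: le_trans (bnd eta s t D (ltW eta0) s0 t1 hD _) _.
    move=> w u v wr su uv vt; apply: hb => //; [exact: le_trans su|exact: le_trans t1|lra].
  rewrite /eta -powRrM mulVf ?gt_eqF // powRr1; last by rewrite divr_ge0 // ltW.
  rewrite mulrCA mulrAC ler_pdivrMr // ler_wpM2l //; first exact: ltW.
  by rewrite /K lerDl.
move=> w s t wN s0 st t1.
have wr : w \in r by rewrite mem_r.
have /andP[w0 _] := wN.
have n0 : 0 < (size w)%:R :> R by rewrite ltr0n.
have [e|st'] := eqVneq s t.
  by rewrite -e (mf_diag hS) // ?normr0 ?exprn_ge0 ?powR_ge0 // e.
have : h s t <= variation_control h s t.
  have := psum_le_variation h0 hbd (s := s) (t := t) (D := [:: t]) s0 t1.
  rewrite /= addr0; apply; apply: itv_partition1.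
  by rewrite lt_neqAle st'.
have : y w s t `^ th <= h s t.
  by rewrite /h (big_rem w) //= lerDl sumr_ge0 // => *; rewrite powR_ge0.
move=> /le_trans H /H{H} H.
rewrite -powR_mulrn ?powR_ge0 // -powRrM.
have -> : `|S s t w| = (y w s t `^ th) `^ (q^-1 * (size w)%:R).
  rewrite /y -!powRrM (_ : _ * _ = 1) ?powRr1 //.
  by rewrite /th; field; rewrite !gt_eqF.
apply: ge0_ler_powR; rewrite ?nnegrE ?powR_ge0 //.
  by rewrite mulr_ge0 ?invr_ge0 // ltW.
exact: le_trans (powR_ge0 _ _) H.
Qed.

End ControlExists.

Section GeometricBound.
Variables (R : realType) (d : nat) (p : R) (S : R -> R -> tseries R d).
Hypothesis p_ge1 : 1 <= p.
Hypothesis hS : forall n, multiplicative_functional p n S.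
Implicit Types (s t u v e : R) (w : seq 'I_d).

(** |S w| = y^th with th = size w / p > 1, where the sums of y stay bounded. On a fine mesh y <=
    eta, so the sums of y^th are at most eta^(th - 1) times a constant. This is the vanishing
    hypothesis of [sewing]. *)
Lemma mf_vanish w e : p < (size w)%:R -> 0 < e -> exists2 r, 0 < r &
  forall s t D, 0 <= s -> t <= 1 -> itv_partition s t D -> mesh_lt s D r ->
    psum (fun u v => `|S u v w|) s D <= e.
Proof.
move=> pw e0; have p0 : 0 < p := lt_le_trans ltr01 p_ge1.
have n0 : 0 < (size w)%:R :> R := lt_trans p0 pw.
have w0 : (0 < size w)%N by rewrite -(ltr0n R).
pose th := (size w)%:R / p.
have th1 : 0 < th - 1 by rewrite subr_gt0 ltr_pdivlMr ?mul1r.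
pose y u v := `|S u v w| `^ (p / (size w)%:R).
have yE u v : y u v `^ th = `|S u v w|.
  rewrite /y -powRrM (_ : _ * _ = 1) ?powRr1 //.
  by rewrite /th; field; rewrite !gt_eqF.
have [M hM] := mf_pvar p_ge1 hS w0.
pose K := `|M| + 1; have K0 : 0 < K by rewrite ltr_wpDl.
pose eta := (e / K) `^ (th - 1)^-1.
have eta0 : 0 < eta by rewrite powR_gt0 // divr_gt0.
have etaE : eta `^ (th - 1) = e / K.
  by rewrite /eta -powRrM mulVf ?gt_eqF // powRr1 // divr_ge0 // ltW.
have [//||b b0 hb] := mf_small hS (w := w) (e := eta `^ th); first by rewrite powR_gt0.
exists b => // s t D s0 t1 hD mD.
apply: le_trans (_ : eta `^ (th - 1) * psum y s D <= e); last first.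
  have : psum y s D <= K.
    apply: le_trans (psum_sub (M := M) _ _ s0 t1 hD) _ => //.
      by move=> u v; exact: powR_ge0.
    by rewrite /K (le_trans (ler_norm M)) // lerDl.
  by rewrite etaE mulrAC ler_pdivrMr // ler_pM2l.
rewrite -psumZ; apply: le_psum_mesh hD mD => u v su uv vt uvb.
have ysm : y u v <= eta.
  have := hb u v (le_trans s0 su) uv (le_trans vt t1) uvb.
  have pn0 : 0 <= p / (size w)%:R by rewrite divr_ge0 ?ltW.
  move/(ge0_ler_powR pn0); rewrite !nnegrE !powR_ge0 !normr_ge0.
  move=> /(_ isT isT); rewrite -/(y u v) -powRrM (_ : th * _ = 1) ?powRr1 //.
    exact: ltW.
  by rewrite /th; field; rewrite !gt_eqF.
rewrite -yE.
have y0 : 0 <= y u v by exact: powR_ge0.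
have thgt0 : 0 < th by lra.
have le1 : y u v `^ (th - 1) <= eta `^ (th - 1).
  by apply: (ge0_ler_powR (ltW th1)) ysm; rewrite nnegrE ?powR_ge0 // ltW.
rewrite -(mulr_powRB1 y0 thgt0) mulrC; exact: (ler_wpM2r y0 le1).
Qed.

Lemma sum_invsqr_le2 n : \sum_(1 <= k < n) k%:R^-2 <= 2 :> R.
Proof.
case: n => [|[|n]]; [by rewrite big_geq|by rewrite big_geq|].
(* The bound is strengthened so that the induction step telescopes. *)
apply: le_trans (_ : 2 - n.+1%:R^-1 <= _ :> R); last by rewrite gerBl invr_ge0.
elim: n => [|n IH]; first by rewrite big_nat1 invr1 expr1n invr1; lra.
rewrite big_nat_recr //=; apply: le_trans (lerD IH (lexx _)) _.
set x := (n%:R : R); have x0 : 0 <= x by [].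
have -> : n.+1%:R = x + 1 by rewrite natr1.
have -> : n.+2%:R = x + 1 + 1 by rewrite !natr1.
rewrite -subr_ge0.
have -> : 2 - (x + 1 + 1)^-1 - (2 - (x + 1)^-1 + (x + 1 + 1) ^- 2) =
  ((x + 1) * (x + 1 + 1) ^+ 2)^-1.
  field; lra.
by rewrite invr_ge0 mulr_ge0 ?sqr_ge0 // addr_ge0.
Qed.

(** n^2 / (k^2 (n - k)^2) = (1/k + 1/(n - k))^2 <= 2/k^2 + 2/(n - k)^2, and each of the two sums of
    inverse squares is at most 2, whence 8 = 2 * 2 + 2 * 2. *)
Lemma sum_invsqr_convolution n :
  \sum_(1 <= k < n) k%:R^-2 * (n - k)%:R^-2 <= 8 * n%:R^-2 :> R.
Proof.
have [->|n0] := posnP n; first by rewrite big_geq // mulr_ge0 // invr_ge0 sqr_ge0.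
have N0 : 0 < n%:R :> R by rewrite ltr0n.
rewrite ler_pdivlMr ?exprn_gt0 // mulr_suml.
apply: le_trans (_ : \sum_(1 <= k < n) (2 * k%:R^-2 + 2 * (n - k)%:R^-2) <= _).
  rewrite !big_nat; apply: ler_sum => k /andP[k0 kn].
  have a0 : 0 < k%:R :> R by rewrite ltr0n.
  have b0 : 0 < (n - k)%:R :> R by rewrite ltr0n subn_gt0.
  rewrite -{2}(subnKC (ltnW kn)) natrD; move: a0 b0.
  set a := k%:R; set b := (n - k)%:R => a0 b0; rewrite -subr_ge0.
  have -> : 2 * a ^- 2 + 2 * b ^- 2 - a ^- 2 * b ^- 2 * (a + b) ^+ 2 =
     (a^-1 - b^-1) ^+ 2 by field; rewrite !gt_eqF.
  exact: sqr_ge0.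
rewrite big_split /= -!mulr_sumr [X in _ + 2 * X]big_nat_rev /=.
have -> : \sum_(1 <= k < n) (n - (1 + n - k.+1))%:R ^- 2 =
   \sum_(1 <= k < n) k%:R^-2 :> R.
  by apply: eq_big_nat => k /andP[_ kn]; rewrite add1n subSS subKn // ltnW.
by have := sum_invsqr_le2 n; lra.
Qed.

(* The weights kap * K^n / n^2 are, up to a constant, stable under
   convolution; they play the part of the factorial decay in Lyons'
   extension theorem, but only give geometric decay. *)
Lemma geometric_bound : exists q K om, [/\ 0 < q, q < (Num.truncn p).+1%:R,
  0 <= K, control om & forall w s t, 0 <= s -> s <= t -> t <= 1 ->
    `|S s t w| <= (K * om s t `^ q^-1) ^+ size w].
Proof.
set N := Num.truncn p; have p0 : 0 < p := lt_le_trans ltr01 p_ge1.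
have pN : p < N.+1%:R by rewrite truncnS_gt.
(* q > p is required by [control_exists], and q < N + 1 makes the exponents n / q exceed 1 for all n
   > N. *)
pose q := (p + N.+1%:R) / 2.
have pq : p < q by rewrite /q; lra.
have qN : q < N.+1%:R by rewrite /q; lra.
have q0 : 0 < q := lt_trans p0 pq.
have [om hom hlow] := control_exists p_ge1 hS N pq.
pose th0 := N.+1%:R / q; have th0_gt1 : 1 < th0 by rewrite ltr_pdivlMr ?mul1r.
pose C : R := 2 / (1 - 2 * 2 `^ (- th0)).
have C0 : 0 < C.
  rewrite divr_gt0 // subr_gt0 -[X in X * _](@powRr1 R 2) // -powRD; last first.
    by rewrite pnatr_eq0 implybT.
  rewrite /powR pnatr_eq0 /= expR_lt1 pmulr_llt0 ?subr_lt0 //.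
  by rewrite ln_gt0 // ltr1n.
(* The convolution costs a factor 8 kap and sewing a factor C; with 8 kap C = 1 the bound [a n]
   reproduces itself in the induction. *)
pose kap := (8 * C)^-1; have kap0 : 0 < kap by rewrite invr_gt0 mulr_gt0.
have C2 : 2 <= C.
  have q0' : 0 <= 2 * 2 `^ (- th0) :> R by rewrite mulr_ge0 ?powR_ge0.
  have : 0 < 1 - 2 * 2 `^ (- th0) :> R.
    by move: C0; rewrite /C pmulr_rgt0 // invr_gt0.
  by move=> den0; rewrite /C ler_pdivlMr // -[leRHS]mulr1 ler_pM2l // gerBl.
have kap1 : kap <= 1.
  have C8 : 0 < 8 * C by rewrite pmulr_rgt0.
  by rewrite /kap invf_le1 //; move: C2; generalize C => c; lra.
(* Chosen so that kap K >= N^2: the weights [a n] are then at least 1 for 0 < n <= N, where [hlow]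
   starts the induction. *)
pose K := 1 + N%:R ^+ 2 / kap.
have K1 : 1 <= K by rewrite /K lerDl divr_ge0 ?sqr_ge0 // ltW.
have K0 : 0 <= K := le_trans ler01 K1.
pose a n := kap * K ^+ n / n%:R ^+ 2.
have a0 n : 0 <= a n.
  by rewrite /a divr_ge0 ?sqr_ge0 // mulr_ge0 ?exprn_ge0 ?(ltW kap0).
pose z s t := om s t `^ q^-1.
have z0 s t : 0 <= z s t by exact: powR_ge0.
have zmono s t u v : 0 <= s -> s <= t -> t <= u -> u <= v -> v <= 1 ->
    z t u <= z s v.
  move=> s0 st tu uv v1; have qV : 0 <= q^-1 by rewrite invr_ge0 ltW.
  have [om0 _ _] := hom.
  apply: (ge0_ler_powR qV); rewrite ?nnegrE.
  - by rewrite om0 // (le_trans s0 st, le_trans uv v1).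
  - by rewrite om0 // (le_trans st (le_trans tu uv)).
  exact: control_mono hom s0 st tu uv v1.
have key w s t : (0 < size w)%N -> 0 <= s -> s <= t -> t <= 1 ->
    `|S s t w| <= a (size w) * z s t ^+ size w.
  have [n] := ubnP (size w); elim: n w s t => // n IH w s t /ltnSE wn w0 s0 st t1.
  have W0 : 0 < (size w)%:R :> R by rewrite ltr0n.
  have [wN|Nw] := leqP (size w) N.
    apply: le_trans (hlow w s t _ s0 st t1) _; first by rewrite w0.
    rewrite -[leLHS]mul1r ler_wpM2r ?exprn_ge0 ?powR_ge0 //.
    rewrite /a ler_pdivlMr ?exprn_gt0 // mul1r.
    apply: le_trans (_ : kap * K <= _); last first.
      by rewrite ler_pM2l //; apply: ler_eXnr.
    rewrite /K mulrDr mulr1 mulrCA divff ?gt_eqF // mulr1.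
    apply: le_trans (_ : N%:R ^+ 2 <= _); last by rewrite lerDr ltW.
    by rewrite lerXn2r ?nnegrE // ler_nat.
  pose th := (size w)%:R / q.
  have zE s' t' : z s' t' ^+ size w = om s' t' `^ th.
    by rewrite -powR_mulrn // -powRrM mulrC.
  have th0th : th0 <= th by rewrite ler_pM2r ?invr_gt0 // ler_nat.
  pose B := 8 * kap * a (size w).
  have B0 : 0 <= B by rewrite mulr_ge0 ?a0 // mulr_ge0 ?(ltW kap0).
  have defect s' t' u' : 0 <= s' -> s' <= t' -> t' <= u' -> u' <= 1 ->
      `|S s' u' w - S s' t' w - S t' u' w| <= B * om s' u' `^ th.
    move=> s'0 s't' t'u' u'1; rewrite -zE.
    have t'0 := le_trans s'0 s't'; have t'1 := le_trans t'u' u'1.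
    rewrite (mf_mul hS w s'0 s't' t'u' u'1) tmul_ends // !(mf_nil hS) //.
    have E (x y c : R) : y + x + c - x - y = c by ring.
    rewrite mul1r mulr1 E.
    apply: le_trans (ler_norm_sum _ _ _) _.
    apply: le_trans (_ : \sum_(1 <= k < size w)
        (a k * a (size w - k)%N) * z s' u' ^+ size w <= _).
      rewrite !big_nat; apply: ler_sum => k /andP[k0 kw].
      have h1 : size (take k w) = k by rewrite size_takel // ltnW.
      have h2 := size_drop k w.
      have -> : z s' u' ^+ size w = z s' u' ^+ k * z s' u' ^+ (size w - k).
        by rewrite -exprD subnKC // ltnW.
      rewrite normrM mulrACA.
      apply: ler_pM => //.
        have := IH (take k w) s' t'; rewrite h1 => /(_ _ _ _ _ _)/le_trans; apply => //.
          exact: leq_trans kw wn.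
        by rewrite ler_wpM2l // lerXn2r ?nnegrE // zmono.
      have := IH (drop k w) t' u'; rewrite h2 => /(_ _ _ _ _ _)/le_trans; apply => //.
      - by apply: leq_trans wn; rewrite ltn_subrL k0.
      - by rewrite subn_gt0.
      by rewrite ler_wpM2l // lerXn2r ?nnegrE // zmono.
    rewrite -mulr_suml ler_wpM2r ?exprn_ge0 //.
    apply: le_trans (_ : kap ^+ 2 * K ^+ size w *
       \sum_(1 <= k < size w) k%:R^-2 * (size w - k)%:R^-2 <= _).
      rewrite mulr_sumr !big_nat; apply: ler_sum => k /andP[k0 kw].
      have -> : K ^+ size w = K ^+ k * K ^+ (size w - k).
        by rewrite -exprD subnKC // ltnW.
      rewrite /a le_eqVlt; apply/orP; left.
      by apply/eqP; ring.
    have kk0 : 0 <= kap ^+ 2 * K ^+ size w by rewrite mulr_ge0 ?sqr_ge0 ?exprn_ge0.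
    apply: le_trans (ler_wpM2l kk0 (sum_invsqr_convolution _)) _.
    by rewrite /B /a le_eqVlt; apply/orP; left; apply/eqP; ring.
  have vanish e : 0 < e -> exists2 r, 0 < r & forall s t D, 0 <= s -> t <= 1 ->
      itv_partition s t D -> mesh_lt s D r ->
      psum (fun u v => `|S u v w|) s D <= e.
    by apply: mf_vanish; apply: lt_le_trans pN _; rewrite ler_nat.
  have := sewing (f := fun u v => S u v w) hom th0_gt1 th0th B0 defect vanish s0 st t1.
  rewrite -/C zE; suff -> : C * B = a (size w) by [].
  rewrite /B /kap; field; rewrite gt_eqF //.
exists q, K, om; split => // w s t s0 st t1.
have [w0|w0] := posnP (size w).
  by move/size0nil: w0 => ->; rewrite (mf_nil hS) // normr1 expr0.
apply: le_trans (key w s t w0 s0 st t1) _.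
rewrite exprMn ler_wpM2r ?exprn_ge0 // /a.
have W1 : 1 <= (size w)%:R ^+ 2 :> R.
  by rewrite exprn_ege1 // ler1n.
rewrite ler_pdivrMr ?(lt_le_trans ltr01 W1) //.
apply: le_trans (_ : 1 * K ^+ size w <= _).
  by rewrite ler_wpM2r ?exprn_ge0.
by rewrite mulrC ler_wpM2l ?exprn_ge0.
Qed.

End GeometricBound.

(** * Entire sequences of complex numbers *)


Section ComplexSeries.
Variable R : realType.
Local Notation normc := (@ComplexField.Normc.normc R).
Implicit Types (u v : nat -> R[i]) (z : R[i]).

Lemma normc_ge0 z : 0 <= normc z.
Proof. by case: z => a b; exact: sqrtr_ge0. Qed.

Lemma normcD z z' : normc (z + z') <= normc z + normc z'.
Proof. exact: (@le_normcD R). Qed.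

Lemma normc_opp z : normc (- z) = normc z.
Proof. exact: (@normcN R). Qed.

Lemma normcB z z' : normc (z - z') <= normc z + normc z'.
Proof. by rewrite -(normc_opp z') normcD. Qed.

Lemma normcDC z z' : normc (z - z') = normc (z' - z).
Proof. by rewrite -normc_opp opprB. Qed.

Lemma normc_sum (I : Type) (r : seq I) (P : pred I) (F : I -> R[i]) :
  normc (\sum_(i <- r | P i) F i) <= \sum_(i <- r | P i) normc (F i).
Proof.
elim/big_rec2: _ => [|i y x _ le]; first by rewrite normc0.
by apply: le_trans (normcD _ _) _; rewrite lerD2l.
Qed.

Lemma normcR (x : R) : normc x%:C = `|x|.
Proof. by rewrite /= expr0n addr0 sqrtr_sqr. Qed.

Lemma Re_le_normc z : `|complex.Re z| <= normc z.
Proof.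
by case: z => a b /=; rewrite -sqrtr_sqr ler_wsqrtr // lerDl sqr_ge0.
Qed.

Lemma Im_le_normc z : `|complex.Im z| <= normc z.
Proof.
by case: z => a b /=; rewrite -sqrtr_sqr ler_wsqrtr // lerDr sqr_ge0.
Qed.

Lemma normc_le_ReIm z : normc z <= `|complex.Re z| + `|complex.Im z|.
Proof.
have {1}-> : z = (complex.Re z)%:C + 'i * (complex.Im z)%:C by case: z => a b; simpc.
apply: le_trans (normcD _ _) _; rewrite normcM !normcR.
have -> : normc 'i = 1 by rewrite /= expr0n add0r expr1n sqrtr1.
by rewrite mul1r.
Qed.

Lemma geometric_tail (a : nat -> R) (M rho : R) n : 0 <= rho <= 2^-1 ->
    (forall k, `|a k| <= M * rho ^+ k) ->
  `|limn (series a) - \sum_(0 <= k < n) a k| <= 2 * M * rho ^+ n.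
Proof.
move=> /andP[rho0 rho1] ha.
have M0 : 0 <= M by have := ha 0; rewrite expr0 mulr1; apply: le_trans.
have cv : cvgn (series a).
  apply: normed_cvg; apply: (@series_le_cvg _ _ (geometric M rho)) => [k|k|k|].
  - exact: normr_ge0.
  - by rewrite /geometric /= mulr_ge0 ?exprn_ge0.
  - exact: ha.
  by apply: is_cvg_geometric_series; rewrite ger0_norm //; lra.
apply/ler_addgt0Pr => e e0.
have /cvgrPdist_lt /(_ e e0) [m _ hm] := cv.
have := hm (m + n)%N (leq_addr _ _); rewrite /= => h1.
have tail : `|\sum_(n <= k < m + n) a k| <= 2 * M * rho ^+ n.
  apply: le_trans (ler_norm_sum _ _ _) _.
  apply: le_trans (_ : \sum_(n <= k < m + n) M * rho ^+ k <= _).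
    by apply: ler_sum => k _; exact: ha.
  have -> : \sum_(n <= k < m + n) M * rho ^+ k =
      M * rho ^+ n * \sum_(0 <= k < m) rho ^+ k.
    rewrite -{1}[n]add0n big_addn addnK mulr_sumr; apply: eq_bigr => k _.
    by rewrite exprD; ring.
  have : \sum_(0 <= k < m) rho ^+ k <= 2.
    apply: le_trans (_ : 2 - 2 * (2^-1) ^+ m <= _ :> R); last first.
      by rewrite gerBl mulr_ge0 // exprn_ge0 // invr_ge0.
    elim: (m) => [|j IH]; first by rewrite big_geq // expr0; lra.
    rewrite big_nat_recr //= exprS.
    have : rho ^+ j <= (2^-1) ^+ j by rewrite lerXn2r ?nnegrE ?invr_ge0.
    lra.
  have : 0 <= M * rho ^+ n by rewrite mulr_ge0 ?exprn_ge0.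
  by move=> h2 /(ler_wpM2l h2); rewrite mulrC mulrA; lra.
have : series a (m + n)%N = \sum_(0 <= k < n) a k + \sum_(n <= k < m + n) a k.
  by rewrite /series /= -big_cat_nat ?leq_addl.
move: h1 tail; set l := limn _; set A := series a _.
set B := \sum_(0 <= k < n) _; set T := \sum_(n <= k < _) _ => h1 h2 h3.
have -> : l - B = (l - A) + T by rewrite h3; ring.
by have := ler_normD (l - A) T; lra.
Qed.

Definition entire_seq u := forall rho : R, 0 < rho ->
  exists M, forall n, normc (u n) <= M * rho ^+ n.

Definition csum u : R[i] :=
  limn (series (fun n => complex.Re (u n))) +i*
  limn (series (fun n => complex.Im (u n))).

Lemma csum_tail u (M rho : R) n : 0 <= rho <= 2^-1 ->
    (forall k, normc (u k) <= M * rho ^+ k) ->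
  normc (csum u - \sum_(0 <= k < n) u k) <= 4 * M * rho ^+ n.
Proof.
move=> hr hu; apply: le_trans (normc_le_ReIm _) _.
have -> : \sum_(0 <= k < n) u k = (\sum_(0 <= k < n) complex.Re (u k)) +i*
    (\sum_(0 <= k < n) complex.Im (u k)).
  elim: n => [|n IH]; first by rewrite !big_geq.
  by rewrite !big_nat_recr //= IH; case: (u n) => a b; simpc.
rewrite /csum; simpc => /=.
have h1 := geometric_tail (a := fun n => complex.Re (u n)) n hr
  (fun k => le_trans (Re_le_normc _) (hu k)).
have h2 := geometric_tail (a := fun n => complex.Im (u n)) n hr
  (fun k => le_trans (Im_le_normc _) (hu k)).
by lra.
Qed.

Lemma geometric_small (M e : R) : 0 < e -> exists n, M * (2^-1) ^+ n < e.
Proof.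
move=> e0; have [M0|M0] := ler0P M.
  by exists 0; rewrite expr0 mulr1; exact: le_lt_trans e0.
have : (fun n => M * (2^-1) ^+ n) @ \oo --> (0 : R).
  have : geometric M (2^-1 : R) @ \oo --> (0 : R).
    by apply: cvg_geometric; rewrite ger0_norm ?invr_ge0 // invf_lt1 ?ltr1n.
  by [].
move=> /cvgrPdist_lt/(_ e e0) [n _ /(_ n (leqnn _))] /=.
by rewrite sub0r normrN ger0_norm ?mulr_ge0 ?exprn_ge0 ?invr_ge0 ?ltW //; exists n.
Qed.

(** Working with the one rate 2^(-n) lets the algebraic rules for sums be proved from partial sums
    alone. *)
Lemma csum_unique u z (M : R) :
    (forall n, normc (z - \sum_(0 <= k < n) u k) <= M * (2^-1) ^+ n) ->
    entire_seq u ->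
  csum u = z.
Proof.
move=> hz hu; have [|M' hM'] := hu (2^-1); first by rewrite invr_gt0.
apply/eqP; rewrite -subr_eq0; apply/eqP; apply: eq0_normc.
apply/eqP; rewrite eq_le normc_ge0 andbT; apply/ler_addgt0Pr => e e0.
have [n hn] := geometric_small (M + 4 * M') e0.
have half : 0 <= (2^-1 : R) <= 2^-1 by rewrite invr_ge0 lexx ler0n.
have h1 := csum_tail n half hM'; have h2 := hz n.
rewrite normcDC in h2.
have -> : csum u - z = (csum u - \sum_(0 <= k < n) u k) + (\sum_(0 <= k < n) u k - z).
  by ring.
by have := normcD (csum u - \sum_(0 <= k < n) u k) (\sum_(0 <= k < n) u k - z); lra.
Qed.

Lemma csum_small u : entire_seq u -> exists M : R, 0 <= M /\ forall n,
  normc (csum u - \sum_(0 <= k < n) u k) <= M * (2^-1) ^+ n.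
Proof.
move=> hu; have [|M hM] := hu (2^-1); first by rewrite invr_gt0.
have M0 : 0 <= M by have := hM 0; rewrite expr0 mulr1; apply: le_trans; exact: normc_ge0.
exists (4 * M); split; first by rewrite mulr_ge0.
by move=> n; apply: csum_tail => //; rewrite invr_ge0 lexx ler0n.
Qed.

Lemma eq_csum u v : u =1 v -> csum u = csum v.
Proof. by move=> /funext ->. Qed.

Lemma entire_seq0 : entire_seq (fun _ => 0).
Proof. by move=> rho _; exists 0 => n; rewrite normc0 mul0r. Qed.

Lemma csum0 : csum (fun _ => 0) = 0.
Proof.
apply: (@csum_unique _ _ 0); last exact: entire_seq0.
by move=> n; rewrite big1 // subr0 normc0 mul0r.
Qed.

Lemma entire_seqD u v : entire_seq u -> entire_seq v ->
  entire_seq (fun n => u n + v n).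
Proof.
move=> hu hv rho r0; have [M hM] := hu rho r0; have [M' hM'] := hv rho r0.
exists (M + M') => n; rewrite mulrDl; apply: le_trans (normcD _ _) _.
exact: lerD.
Qed.

Lemma csumD u v : entire_seq u -> entire_seq v ->
  csum (fun n => u n + v n) = csum u + csum v.
Proof.
move=> hu hv; have [M [_ hM]] := csum_small hu; have [M' [_ hM']] := csum_small hv.
apply: (@csum_unique _ _ (M + M')); last exact: entire_seqD.
move=> n; rewrite big_split opprD addrACA mulrDl.
by apply: le_trans (normcD _ _) _; apply: lerD.
Qed.

Lemma entire_seqZ z u : entire_seq u -> entire_seq (fun n => z * u n).
Proof.
move=> hu rho r0; have [M hM] := hu rho r0; exists (normc z * M) => n.
by rewrite normcM -mulrA ler_wpM2l // normc_ge0.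
Qed.

Lemma csumZ z u : entire_seq u -> csum (fun n => z * u n) = z * csum u.
Proof.
move=> hu; have [M [_ hM]] := csum_small hu.
apply: (@csum_unique _ _ (normc z * M)); last exact: entire_seqZ.
move=> n; rewrite -mulr_sumr -mulrBr normcM -mulrA.
by rewrite ler_wpM2l // normc_ge0.
Qed.

Lemma entire_seq_sum (I : Type) (r : seq I) (F : I -> nat -> R[i]) :
  (forall i, entire_seq (F i)) -> entire_seq (fun n => \sum_(i <- r) F i n).
Proof.
move=> hF; elim: r => [|i r IH].
  rewrite (_ : (fun _ => _) = fun=> 0); first exact: entire_seq0.
  by apply/funext => n; rewrite big_nil.
rewrite (_ : (fun _ => _) = fun n => F i n + \sum_(i <- r) F i n).
  exact: entire_seqD.
by apply/funext => n; rewrite big_cons.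
Qed.

Lemma csum_sum (I : Type) (r : seq I) (F : I -> nat -> R[i]) :
  (forall i, entire_seq (F i)) ->
  csum (fun n => \sum_(i <- r) F i n) = \sum_(i <- r) csum (F i).
Proof.
move=> hF; elim: r => [|i r IH].
  rewrite big_nil -[RHS]csum0; apply: eq_csum => n; exact: big_nil.
rewrite big_cons -IH -csumD //; last exact: entire_seq_sum.
by apply: eq_csum => n; rewrite big_cons.
Qed.

Definition cauchy u v n := \sum_(0 <= k < n.+1) u k * v (n - k)%N.

Lemma natr_le_exp2 n : n.+1%:R <= 2 ^+ n :> R.
Proof. by rewrite -natrX ler_nat ltn_expl. Qed.

(** The n + 1 terms of the convolution are absorbed by n + 1 <= 2^n, which doubles the rate. *)
Lemma cauchy_bound u v (M M' rho : R) n : 0 <= rho ->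
    (forall k, normc (u k) <= M * rho ^+ k) ->
    (forall k, normc (v k) <= M' * rho ^+ k) ->
  normc (cauchy u v n) <= M * M' * (2 * rho) ^+ n.
Proof.
move=> r0 hu hv.
have M0 : 0 <= M by have := hu 0; rewrite expr0 mulr1; apply: le_trans; exact: normc_ge0.
have M0' : 0 <= M' by have := hv 0; rewrite expr0 mulr1; apply: le_trans; exact: normc_ge0.
apply: le_trans (normc_sum _ _ _) _.
apply: le_trans (_ : \sum_(0 <= k < n.+1) M * M' * rho ^+ n <= _).
  rewrite !big_nat; apply: ler_sum => k /andP[_ kn].
  rewrite normcM -(subnKC (n := n) (m := k)) // exprD mulrACA addKn.
  by apply: ler_pM; rewrite ?normc_ge0.
rewrite sumr_const_nat subn0 exprMn mulrCA -[leLHS]mulr_natl.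
by rewrite ler_wpM2r ?natr_le_exp2 // !mulr_ge0 ?exprn_ge0.
Qed.

Lemma entire_cauchy u v : entire_seq u -> entire_seq v -> entire_seq (cauchy u v).
Proof.
move=> hu hv rho r0; have r2 : 0 < rho / 2 by rewrite divr_gt0.
have [M hM] := hu _ r2; have [M' hM'] := hv _ r2.
exists (M * M') => n.
have -> : rho = 2 * (rho / 2) by field.
by apply: cauchy_bound => //; exact: ltW.
Qed.

(** Both sequences are truncated to polynomials of degree below n. The coefficients of their product
    agree with the Cauchy product below n; the n further ones are O(4^(-n)), as the rate 1/8 doubles
    under convolution, and n 4^(-n) <= 2^(-n). *)
Lemma csum_cauchy u v : entire_seq u -> entire_seq v ->
  csum (cauchy u v) = csum u * csum v.
Proof.
move=> hu hv; have r8 : 0 < (8^-1 : R) by rewrite invr_gt0.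
have [M1 hM1] := hu _ r8; have [M1' hM1'] := hv _ r8.
have [M [M0 hM]] := csum_small hu; have [M' [M'0 hM']] := csum_small hv.
have M10 : 0 <= M1 by have := hM1 0; rewrite expr0 mulr1; apply: le_trans; exact: normc_ge0.
have M10' : 0 <= M1' by have := hM1' 0; rewrite expr0 mulr1; apply: le_trans; exact: normc_ge0.
apply: (@csum_unique _ _ (normc (csum u) * M' + M * (normc (csum v) + M') + M1 * M1'));
  last exact: entire_cauchy.
move=> n; set P := \sum_(0 <= k < n) u k; set Q := \sum_(0 <= k < n) v k.
have PQ : normc (P * Q - \sum_(0 <= k < n) cauchy u v k) <= M1 * M1' * (2^-1) ^+ n.
  pose p := \poly_(i < n) u i; pose q := \poly_(i < n) v i.
  have -> : P * Q = \sum_(0 <= k < n + n) (p * q)`_k.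
    have -> : P = p.[1].
      by rewrite horner_poly /P /Q big_mkord; apply: eq_bigr => i _; rewrite expr1n mulr1.
    have -> : Q = q.[1].
      by rewrite horner_poly /P /Q big_mkord; apply: eq_bigr => i _; rewrite expr1n mulr1.
    rewrite -hornerM (@horner_coef_wide _ (n + n)).
      by rewrite big_mkord; apply: eq_bigr => i _; rewrite expr1n mulr1.
    apply: leq_trans (size_polyMleq _ _) _; apply: leq_trans (leq_pred _) _.
    by apply: leq_add; exact: size_poly.
  rewrite (big_cat_nat (n := n)) ?leq_addr //=.
  have -> : \sum_(0 <= k < n) (p * q)`_k = \sum_(0 <= k < n) cauchy u v k.
    apply: eq_big_nat => k /andP[_ kn]; rewrite coefM /cauchy big_mkord.
    apply: eq_bigr => i _; rewrite !coef_poly.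
    have -> : (i < n)%N by rewrite (leq_ltn_trans _ kn) // -ltnS.
    by have -> : (k - i < n)%N by rewrite (leq_ltn_trans _ kn) // leq_subr.
  rewrite addrAC subrr add0r; apply: le_trans (normc_sum _ _ _) _.
  apply: le_trans (_ : \sum_(n <= k < n + n) M1 * M1' * (4^-1) ^+ k <= _).
    apply: ler_sum => k _; rewrite coefM -(big_mkord xpredT (fun j => p`_j * q`_(k - j))).
    have := @cauchy_bound (fun j => p`_j) (fun j => q`_j) M1 M1' 8^-1 k.
    rewrite (_ : 2 * 8^-1 = 4^-1); last by field.
    apply; first exact: ltW.
      move=> j; rewrite coef_poly; case: ifP => // _.
      by rewrite normc0 mulr_ge0 // exprn_ge0 // ltW.
    move=> j; rewrite coef_poly; case: ifP => // _.
    by rewrite normc0 mulr_ge0 // exprn_ge0 // ltW.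
  rewrite -mulr_sumr ler_wpM2l ?mulr_ge0 //.
  apply: le_trans (_ : \sum_(n <= k < n + n) (4^-1) ^+ n <= _).
    rewrite !big_nat; apply: ler_sum => k /andP[nk _].
    by rewrite ler_wiXn2l ?invr_ge0 // invf_le1 ?ler1n.
  rewrite sumr_const_nat addKn -[leLHS]mulr_natl.
  have -> : (4^-1 : R) ^+ n = (2^-1) ^+ n * (2^-1) ^+ n by rewrite -exprMn; congr (_ ^+ _); field.
  rewrite mulrA -[leRHS]mul1r ler_wpM2r ?exprn_ge0 ?invr_ge0 //.
  rewrite exprVn ler_pdivrMr ?exprn_gt0 // mul1r.
  by apply: le_trans (natr_le_exp2 n); rewrite ler_nat.
set W := \sum_(0 <= k < n) cauchy u v k in PQ *.
have hP := hM n; have hQ := hM' n; rewrite -/P in hP; rewrite -/Q in hQ.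
have h2 : 0 <= (2^-1 : R) ^+ n <= 1.
  by rewrite exprn_ge0 ?invr_ge0 // exprn_ile1 ?invr_ge0 // invf_le1 ?ler1n.
have Qb : normc Q <= normc (csum v) + M'.
  have -> : Q = csum v - (csum v - Q) by ring.
  apply: le_trans (normcB _ _) _; rewrite lerD2l; apply: le_trans hQ _.
  by rewrite ler_piMr //; case/andP: h2.
have -> : csum u * csum v - W =
  csum u * (csum v - Q) + (csum u - P) * Q + (P * Q - W) by ring.
apply: le_trans (normcD _ _) _; rewrite [leRHS]mulrDl; apply: lerD => //.
apply: le_trans (normcD _ _) _; rewrite [leRHS]mulrDl; apply: lerD.
  by rewrite normcM -mulrA ler_wpM2l // normc_ge0.
rewrite normcM mulrAC.
by apply: ler_pM; rewrite ?normc_ge0.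
Qed.

End ComplexSeries.

Section ComplexExponential.
Variable R : realType.
Local Notation normc := (@ComplexField.Normc.normc R).
Implicit Types (z w : R[i]).

Lemma pow_div_fact_le (x : R) n : 0 <= x -> x ^+ n / n`!%:R <= expR x.
Proof.
move=> x0; rewrite /expR; apply: le_trans (_ : series (exp_coeff x) n.+1 <= _).
  rewrite /series /= big_nat_recr //= lerDr sumr_ge0 // => i _.
  exact: exp_coeff_ge0.
apply: nondecreasing_cvgn_le; last exact: is_cvg_series_exp_coeff.
by apply: nondecreasing_series => k _ _; exact: exp_coeff_ge0.
Qed.

Lemma normcX z n : normc (z ^+ n) = normc z ^+ n.
Proof.
elim: n => [|n IH]; first exact: normc1.
by rewrite !exprS normcM IH.
Qed.

Lemma normc_natV n : normc (n%:R^-1) = n%:R^-1.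
Proof.
have -> : n%:R^-1 = (n%:R^-1)%:C :> R[i] by rewrite fmorphV /= rmorph_nat.
by rewrite normcR ger0_norm.
Qed.

Definition cexp_terms z n : R[i] := z ^+ n / n`!%:R.

Lemma entire_cexp z : entire_seq (cexp_terms z).
Proof.
move=> rho r0; exists (expR (normc z / rho)) => n.
rewrite normcM normcX normc_natV -ler_pdivrMr ?exprn_gt0 //.
rewrite mulrAC -expr_div_n; apply: pow_div_fact_le.
by rewrite divr_ge0 ?normc_ge0 // ltW.
Qed.

Lemma csum_cexp_termsD z w :
  csum (cexp_terms (z + w)) = csum (cexp_terms z) * csum (cexp_terms w).
Proof.
rewrite -csum_cauchy; try exact: entire_cexp.
apply: eq_csum => n; rewrite /cauchy /cexp_terms addrC exprDn mulr_suml big_mkord.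
apply: eq_bigr => i _; rewrite -[X in X / _]mulr_natr.
have nz k : k`!%:R != 0 :> R[i] by rewrite pnatr_eq0 -lt0n fact_gt0.
have -> : 'C(n, i)%:R = n`!%:R / (i`!%:R * (n - i)`!%:R) :> R[i].
  apply: (canRL (mulfK _)); first by rewrite mulf_neq0.
  by rewrite -!natrM bin_fact // -ltnS.
by field; rewrite !nz.
Qed.

Lemma csum_real (x : R) : csum (cexp_terms x%:C) = (expR x)%:C.
Proof.
have E n : cexp_terms x%:C n = (x ^+ n / n`!%:R)%:C.
  by rewrite /cexp_terms rmorphM fmorphV rmorphXn rmorph_nat.
rewrite /csum; congr (_ +i* _).
  by rewrite /expR; congr (lim (series _ @ \oo)); apply/funext => n; rewrite E.
rewrite (_ : (fun n => _) = fun=> 0); last by apply/funext => n; rewrite E.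
rewrite (_ : series _ = fun=> 0); last first.
  by apply/funext => n; rewrite /series /= big1.
exact: lim_cst.
Qed.

Lemma csum_imaginary (y : R) : csum (cexp_terms (0 +i* y)) = cos y +i* sin y.
Proof.
have E n : cexp_terms (0 +i* y) n = cos_coeff y n +i* sin_coeff y n.
  have P k : (0 +i* y) ^+ k = ((~~ odd k)%:R * (-1) ^+ k./2 * y ^+ k) +i*
      ((odd k)%:R * (-1) ^+ k.-1./2 * y ^+ k).
    elim: k => [|k IH]; first by rewrite /= !expr0 !mul1r mul0r mul0r.
    rewrite exprS IH; apply/eqP; rewrite eq_complex /= negbK.
    have ko : odd k -> k.+1./2 = k.-1./2.+1 by case: (k) => // j /=.
    apply/andP; split.
      case: (boolP (odd k)) => hk; last by rewrite !mul0r mulr0 subrr.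
      by rewrite -[uphalf k]/(k.+1./2) (ko hk) !mul1r mul0r !exprS; apply/eqP; ring.
    case: (boolP (odd k)) => hk; first by rewrite !mul0r mulr0 addr0.
    by rewrite !mul1r !mul0r add0r exprS; apply/eqP; ring.
  have -> : cexp_terms (0 +i* y) n = (0 +i* y) ^+ n * (n`!%:R^-1)%:C.
    by rewrite /cexp_terms fmorphV /= rmorph_nat.
  by rewrite P; simpc.
by rewrite /csum; congr (_ +i* _); rewrite unlock;
   congr (limn (series _)); apply/funext => n; rewrite E.
Qed.

Lemma csum_cexp z : csum (cexp_terms z) = cexp z.
Proof.
case: z => a b; have -> : a +i* b = a%:C + (0 +i* b) by simpc.
by rewrite csum_cexp_termsD csum_real csum_imaginary /cexp; simpc.
Qed.

Lemma cexpD z w : cexp (z + w) = cexp z * cexp w.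
Proof. by rewrite -!csum_cexp csum_cexp_termsD. Qed.

Lemma cexp0 : cexp 0 = 1 :> R[i].
Proof. by rewrite /cexp /= expR0 cos0 sin0 mul1r. Qed.

Lemma cexpN z : cexp z * cexp (- z) = 1.
Proof. by rewrite -cexpD subrr cexp0. Qed.

Lemma cexp_freq (k : int) : cexp (freq R k) = 1.
Proof.
have H (n : nat) : cexp (0 +i* (2 * n%:R * pi)) = 1 :> R[i].
  elim: n => [|n IH]; first by rewrite mulr0 mul0r; exact: cexp0.
  have -> : 0 +i* (2 * n.+1%:R * pi) = (0 +i* (2 * n%:R * pi)) + (0 +i* (pi *+ 2)) :> R[i].
    by apply/eqP; rewrite eq_complex /= addr0 eqxx -natr1 /=; apply/eqP; ring.
  rewrite cexpD IH mul1r /cexp /= expR0 cos2pi sin2pi mul1r //.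
rewrite /freq; case: k => n; first exact: H.
rewrite NegzE rmorphN /=; have := cexpN (0 +i* (2 * n.+1%:R * pi)).
rewrite H mul1r => <-; congr cexp; apply/eqP; rewrite eq_complex /= oppr0 eqxx /=.
by apply/eqP; ring.
Qed.

End ComplexExponential.

(** * Representations of the tensor algebra *)

Section Homogeneous.
Variables (R : realType) (d : nat) (A : nzRingType) (iota : {rmorphism R -> A}).
Hypothesis central : forall r a, iota r * a = a * iota r.
Implicit Types (rho : 'I_d -> A) (xi eta : tseries R d) (w : seq 'I_d).

(* The image of xi_n under the algebra morphism e_i |-> rho i. *)
Definition hom rho xi (n : nat) : A :=
  \sum_(w <- words 'I_d n) iota (xi w) * \prod_(i <- w) rho i.

Lemma eq_hom rho xi eta n : (forall w, size w = n -> xi w = eta w) ->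
  hom rho xi n = hom rho eta n.
Proof.
move=> H; rewrite /hom !big_seq; apply: eq_bigr => w.
by rewrite mem_words => /eqP /H ->.
Qed.

Lemma hom0 rho xi : hom rho xi 0 = iota (xi [::]).
Proof. by rewrite /hom big_words0 big_nil mulr1. Qed.

Lemma homD rho xi eta n :
  hom rho (fun w => xi w + eta w) n = hom rho xi n + hom rho eta n.
Proof.
by rewrite /hom -big_split; apply: eq_bigr => w _; rewrite rmorphD mulrDl.
Qed.

Lemma homZ rho c xi n : hom rho (fun w => c * xi w) n = iota c * hom rho xi n.
Proof.
by rewrite /hom mulr_sumr; apply: eq_bigr => w _; rewrite rmorphM mulrA.
Qed.

Lemma hom_zero rho xi n : (forall w, size w = n -> xi w = 0) -> hom rho xi n = 0.
Proof.
move=> H; rewrite /hom big_seq big1 // => w.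
by rewrite mem_words => /eqP/H ->; rewrite rmorph0 mul0r.
Qed.

Lemma hom_tone rho n : hom rho (@tone R d) n = (n == 0)%:R.
Proof.
case: n => [|n]; first by rewrite hom0 /tone eqxx rmorph1.
by apply: hom_zero => -[|a w].
Qed.

Lemma hom_tmul rho xi eta n :
  hom rho (tmul xi eta) n = \sum_(k < n.+1) hom rho xi k * hom rho eta (n - k).
Proof.
have -> : hom rho (tmul xi eta) n = \sum_(k < n.+1) \sum_(w <- words 'I_d n)
    iota (xi (take k w)) * iota (eta (drop k w)) * \prod_(i <- w) rho i.
  rewrite exchange_big /= /hom [LHS]big_seq [RHS]big_seq; apply: eq_bigr => w.
  rewrite mem_words => /eqP wn; rewrite /tmul wn rmorph_sum mulr_suml.
  by apply: eq_bigr => k _; rewrite rmorphM.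
apply: eq_bigr => k _; have kn : (k <= n)%N by rewrite -ltnS.
rewrite -{1}(subnKC kn) big_words_cat /hom mulr_suml [LHS]big_seq [RHS]big_seq.
apply: eq_bigr => u; rewrite mem_words => /eqP uk.
rewrite mulr_sumr; apply: eq_bigr => v _.
rewrite take_size_cat // drop_size_cat // big_cat /= !mulrA; congr (_ * _).
by rewrite -!mulrA; congr (_ * _); exact: central.
Qed.

(** The powers of ['X] keep the degrees apart, so that up to degree N the product [tmul] becomes
    multiplication of polynomials over A, and [texp] and [tlog] become polynomials in [hpoly]. *)
Definition hpoly rho N xi := \poly_(n < N.+1) hom rho xi n.

Lemma coef_hpoly rho N xi n : (n <= N)%N -> (hpoly rho N xi)`_n = hom rho xi n.
Proof. by move=> nN; rewrite coef_poly ltnS nN. Qed.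

Lemma coef_hpolyM rho N xi eta n : (n <= N)%N ->
  (hpoly rho N xi * hpoly rho N eta)`_n = hom rho (tmul xi eta) n.
Proof.
move=> nN; rewrite coefM hom_tmul; apply: eq_bigr => k _.
by rewrite !coef_hpoly // (leq_trans _ nN) ?leq_subr // -ltnS.
Qed.

Lemma coef_hpolyX rho N xi k n : (n <= N)%N ->
  (hpoly rho N xi ^+ k)`_n = hom rho (tpow xi k) n.
Proof.
elim: k n => [|k IH] n nN; first by rewrite expr0 coef1 hom_tone.
rewrite exprS coefM /tpow iterS -/(tpow xi k) hom_tmul.
apply: eq_bigr => j _; rewrite IH ?coef_hpoly //.
  by rewrite (leq_trans _ nN) // -ltnS.
by rewrite (leq_trans _ nN) // leq_subr.
Qed.

Lemma tpow_small xi k w : xi [::] = 0 -> (size w < k)%N -> tpow xi k w = 0.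
Proof.
move=> x0; elim: k w => [//|k IH] w wk; rewrite /tpow iterS -/(tpow xi k) /tmul.
rewrite big_ord_recl take0 x0 mul0r add0r big1 // => j _.
rewrite IH ?mulr0 // size_drop /= /bump /=; move: (ltn_ord j) wk; lia.
Qed.

(** On the left the range of summation depends on the word. As [tpow xi k] vanishes on words shorter
    than k, it can be extended to N for all words at once. *)
Lemma hom_series (c : nat -> R) m rho xi N n : xi [::] = 0 -> (n <= N)%N ->
  hom rho (fun w => \sum_(m <= k < (size w).+1) c k * tpow xi k w) n =
  (\sum_(m <= k < N.+1) (iota (c k))%:P * hpoly rho N xi ^+ k)`_n.
Proof.
move=> x0 nN.
transitivity (\sum_(m <= k < N.+1) iota (c k) * hom rho (tpow xi k) n).
  rewrite /hom; under [RHS]eq_bigr do rewrite mulr_sumr.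
  rewrite exchange_big /= [LHS]big_seq [RHS]big_seq; apply: eq_bigr => w.
  rewrite mem_words => /eqP wn; rewrite rmorph_sum mulr_suml wn.
  under [RHS]eq_bigr do rewrite mulrA -rmorphM.
  have [mn|nm] := leqP m n.+1; last first.
    rewrite [LHS]big_geq ?(ltnW nm) // [RHS]big_nat [RHS]big1 // => k /andP[mk _].
    by rewrite tpow_small ?mulr0 ?rmorph0 ?mul0r // wn (leq_trans _ mk) // ltnW.
  rewrite [RHS](big_cat_nat (n := n.+1)) //= -[LHS]addr0; congr (_ + _).
  rewrite big_nat big1 //.
  move=> k /andP[nk _].
  by rewrite tpow_small ?mulr0 ?rmorph0 ?mul0r // wn.
rewrite coef_sum; apply: eq_bigr => k _; rewrite coefCM coef_hpolyX //.
Qed.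

(** Up to degree n, xi is 1 + P and its logarithm is a polynomial Q in P with central coefficients,
    so the two commute. *)
Lemma hom_tlog_comm rho xi n : xi [::] = 1 ->
  hom rho (tmul xi (tlog xi)) n = hom rho (tmul (tlog xi) xi) n.
Proof.
move=> x1; pose u := (fun w => xi w - tone R w) : tseries R d.
have u0 : u [::] = 0 by rewrite /u x1 /tone eqxx subrr.
pose P := hpoly rho n u.
pose Q := \sum_(1 <= k < n.+1) (iota ((-1) ^+ k.-1 / k%:R))%:P * P ^+ k.
have homL k : (k <= n)%N -> hom rho (tlog xi) k = Q`_k.
  by move=> kn; rewrite -(hom_series _ _ _ u0 kn).
have homS k : (k <= n)%N -> hom rho xi k = (1 + P)`_k.
  move=> kn; rewrite coefD coef1 coef_hpoly // -(hom_tone rho) -homD.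
  by apply: eq_hom => w _; rewrite /u addrC subrK.
have PQ : P * Q = Q * P.
  rewrite mulr_sumr mulr_suml; apply: eq_bigr => k _.
  have cP : P * (iota ((-1) ^+ k.-1 / k%:R))%:P = (iota ((-1) ^+ k.-1 / k%:R))%:P * P.
    by apply/polyP => i; rewrite coefMC coefCM central.
  by rewrite mulrA cP -!mulrA -exprS -exprSr.
have : ((1 + P) * Q)`_n = (Q * (1 + P))`_n by rewrite mulrDl mulrDr mul1r mulr1 PQ.
rewrite !coefM !hom_tmul => E.
transitivity (\sum_(j < n.+1) (1 + P)`_j * Q`_(n - j)).
  apply: eq_bigr => j _; rewrite homL ?leq_subr // homS // -ltnS //.
rewrite E; apply: eq_bigr => j _; rewrite homS ?leq_subr // homL // -ltnS //.
Qed.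

End Homogeneous.

(** * Central shifts of Lie polynomials and of their exponentials *)

Section LieShift.
Variables (R : realType) (d : nat) (A : nzRingType) (iota : {rmorphism R -> A}).
Hypothesis central : forall r a, iota r * a = a * iota r.
Variables (rho : 'I_d -> A) (i0 : 'I_d) (s : A).
Hypothesis scentral : forall a, s * a = a * s.
Implicit Types (xi eta l : tseries R d).

Definition shifted (i : 'I_d) : A := rho i + (if i == i0 then s else 0).
Local Notation Phi := (hom iota).
Local Notation PhiX := (hpoly iota).

Lemma central_polyC (a : A) (p : {poly A}) : (forall b, a * b = b * a) ->
  (a%:P * 'X) * p = p * (a%:P * 'X).
Proof.
move=> ha; rewrite -mulrA -commr_polyX mulrA [RHS]mulrA; congr (_ * 'X).
by apply/polyP => i; rewrite coefMC coefCM.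
Qed.

Lemma shift_central r a : (iota r * s) * a = a * (iota r * s).
Proof. by rewrite -mulrA scentral !mulrA central. Qed.

Lemma hom_tvec rho' (v : 'rV[R]_d) n :
  Phi rho' (tvec v) n = if n == 1 then \sum_i iota (v 0 i) * rho' i else 0.
Proof.
case: n => [|[|n]]; rewrite /=.
- by rewrite hom0 /= rmorph0.
- rewrite /hom big_wordsS; apply: eq_bigr => i _.
  by rewrite big_words0 big_seq1.
by apply: hom_zero => -[|a [|b w]].
Qed.

Lemma lie_nil l : lie_polynomial l -> l [::] = 0.
Proof.
elim=> [v|a b _ a0 _ b0|c a _ a0|a b _ a0 _ b0] //=.
- by rewrite a0 b0 addr0.
- by rewrite a0 mulr0.
by rewrite /tmul !big_ord_recl !big_ord0 /= a0 b0 mul0r subrr.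
Qed.

(** Central summands disappear from brackets, so shifting the image of a letter by a central element
    changes a Lie polynomial in degree one only. *)
Lemma lie_shift l N : lie_polynomial l -> (0 < N)%N ->
  PhiX shifted N l = PhiX rho N l + (iota (l [:: i0]) * s)%:P * 'X.
Proof.
move=> hl N0.
have high n : (N < n)%N -> (n == 0%N) = false /\ (n.-1 == 0%N) = false.
  by case: n => [|[|n]] //; rewrite ltnS leqNgt N0.
elim: hl => [v|a b _ ha _ hb|c a _ ha|a b la ha lb hb]; apply/polyP => n;
  rewrite coefD coefMX coefC.
- rewrite !coef_poly; case: ltnP => nN; last first.
    by have [-> ->] := high n nN; rewrite addr0.
  rewrite !hom_tvec; case: n nN => [|[|n]] /= _; rewrite ?addr0 //.
  rewrite (bigD1 i0) //= [in RHS](bigD1 i0) //= /shifted eqxx mulrDr -!addrA.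
  congr (_ + _); rewrite addrC; congr (_ + _).
  by apply: eq_bigr => i /negPf ->; rewrite addr0.
- have := congr1 (fun p : {poly A} => p`_n) ha; have := congr1 (fun p : {poly A} => p`_n) hb.
  rewrite !coefD !coefMX !coefC !coef_poly; case: ltnP => nN; last first.
    by have [-> ->] := high n nN; rewrite addr0.
  rewrite !homD => -> ->; rewrite rmorphD mulrDl.
  by case: (n == 0); case: (n.-1 == 0); rewrite ?addr0 // addrACA.
- have := congr1 (fun p : {poly A} => p`_n) ha.
  rewrite !coefD !coefMX !coefC !coef_poly; case: ltnP => nN; last first.
    by have [-> ->] := high n nN; rewrite addr0.
  rewrite !homZ => ->; rewrite rmorphM -mulrA mulrDr.
  by case: (n == 0); case: (n.-1 == 0); rewrite ?mulr0.
rewrite !coef_poly; case: ltnP => nN; last first.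
  by have [-> ->] := high n nN; rewrite addr0.
(* A bracket has no part of degree one, so the correction term of the statement is 0 here. *)
have E : tmul a b [:: i0] - tmul b a [:: i0] = 0.
  by rewrite /tmul !big_ord_recl !big_ord0 /=; ring.
rewrite E rmorph0 mul0r !if_same addr0.
have sub rho' : Phi rho' (fun w => tmul a b w - tmul b a w) n =
    Phi rho' (tmul a b) n - Phi rho' (tmul b a) n.
  transitivity (Phi rho' (fun w => tmul a b w + (-1) * tmul b a w) n).
    by apply: eq_hom => w _; rewrite mulN1r.
  by rewrite homD homZ rmorphN1 mulN1r.
rewrite !sub -!(@coef_hpolyM _ _ _ _ central _ N) // ha hb.
set a1 := _%:P * 'X; set b1 := _%:P * 'X.
have ca p : a1 * p = p * a1 by apply: central_polyC; exact: shift_central.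
have cb p : b1 * p = p * b1 by apply: central_polyC; exact: shift_central.
rewrite -!coefB; congr (_`_n); move: ca cb.
set x := PhiX rho N a; set y := PhiX rho N b => ca cb.
have H (p q r t u : {poly A}) : p + q + (r + t) - (u + r + (q + t)) = p - u.
  have -> : u + r + (q + t) = u + (q + (r + t)) by rewrite -addrA (addrCA r).
  by rewrite -(addrA p q) opprD addrACA subrr addr0.
by rewrite !mulrDl !mulrDr (ca y) (ca b1) (cb x) H.
Qed.

End LieShift.

Lemma triangular_sum (V : nmodType) n (F : nat -> nat -> V) :
  \sum_(k < n.+1) \sum_(j < k.+1) F j (k - j)%N =
  \sum_(j < n.+1) \sum_(i < (n - j).+1) F j i.
Proof.
elim: n => [|n IH]; first by rewrite !big_ord1.
rewrite big_ord_recr /= IH [RHS]big_ord_recr /= subnn [\sum_(i < 1) _]big_ord1.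
rewrite [X in _ + X = _]big_ord_recr /= subnn addrA; congr (_ + _).
rewrite -big_split; apply: eq_bigr => j _ /=.
have jn : (j <= n)%N by rewrite -ltnS.
by rewrite subSn // [RHS]big_ord_recr.
Qed.

Section ExpShift.
Variables (R : realType) (d : nat) (A : nzRingType) (iota : {rmorphism R -> A}).
Hypothesis central : forall r a, iota r * a = a * iota r.
Variables (rho : 'I_d -> A) (i0 : 'I_d) (s : A).
Hypothesis scentral : forall a, s * a = a * s.
Local Notation Phi := (hom iota).
Local Notation rho' := (shifted rho i0 s).

Lemma hom_texp rho1 (l : tseries R d) N n : l [::] = 0 -> (n <= N)%N ->
  Phi rho1 (texp l) n =
  (\sum_(0 <= k < N.+1) (iota (k`!%:R^-1))%:P * hpoly iota rho1 N l ^+ k)`_n.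
Proof.
move=> l0 nN; rewrite -(hom_series central (fun k => k`!%:R^-1) 0 rho1 l0 nN).
by apply: eq_hom => w _; rewrite /texp; apply: eq_bigr => k _; rewrite mulrC.
Qed.

(* Adding a central element s to the image of one letter multiplies the image
   of the exponential of a Lie element by exp (c s). *)
Lemma hom_texp_shift (l : tseries R d) n : lie_polynomial l ->
  Phi rho' (texp l) n = \sum_(j < n.+1)
    iota (j`!%:R^-1) * (iota (l [:: i0]) * s) ^+ j * Phi rho (texp l) (n - j).
Proof.
(* N = n + 1 rather than n, because [lie_shift] requires N > 0 also when n = 0. The extra power k =
   n + 1 contributes nothing in degree n. *)
move=> hl; have l0 := lie_nil hl; pose N := n.+1.
pose t := iota (l [:: i0]) * s.
have tc a : t * a = a * t by exact: shift_central.
have tXc a j : t ^+ j * a = a * t ^+ j.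
  by apply/esym; apply: commrX; rewrite /GRing.comm tc.
rewrite (hom_texp rho' l0 (leqnSn n)) lie_shift // -/t.
rewrite big_mkord coef_sum.
have coefT k j : ((t%:P * 'X) ^+ j : {poly A})`_k = if k == j then t ^+ j else 0.
  have -> : (t%:P * 'X) ^+ j = (t ^+ j)%:P * 'X^j :> {poly A}.
    by rewrite exprMn_comm ?rmorphXn //; exact: commr_polyX.
  by rewrite coefCM coefXn; case: eqP; rewrite ?mulr1 ?mulr0.
have coefMT (p : {poly A}) j : (p * (t%:P * 'X) ^+ j)`_n =
    if (j <= n)%N then t ^+ j * p`_(n - j) else 0.
  rewrite coefMr; case: leqP => jn.
    rewrite (bigD1 (Ordinal (jn : (j < n.+1)%N))) //= big1 ?addr0.
      by rewrite coefT eqxx tXc.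
    by move=> i ij; rewrite coefT (negPf (ij : val i != j)) mulr0.
  rewrite big1 // => i _; rewrite coefT.
  by rewrite ltn_eqF ?mulr0 // (leq_ltn_trans _ jn) // -ltnS.
pose F j i : A := iota (j`!%:R^-1) * t ^+ j *
  (iota (i`!%:R^-1) * Phi rho (tpow l i) (n - j)).
transitivity (\sum_(k < n.+1) \sum_(j < k.+1) F j (k - j)%N).
  rewrite big_ord_recr /= [X in _ + X](_ : _ = 0) ?addr0; last first.
    rewrite coefCM exprDn_comm; last by rewrite /GRing.comm central_polyC.
    rewrite coef_sum big1 ?mulr0 // => j _; rewrite coefMn coefMT.
    case: ifP; rewrite ?mul0rn // => jn.
    rewrite coef_hpolyX ?(leq_trans (leq_subr _ _)) // hom_zero ?mulr0 ?mul0rn //.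
    move=> w wn; rewrite tpow_small // wn; move: (ltn_ord j) jn; rewrite /N; lia.
  apply: eq_bigr => k _; rewrite coefCM exprDn_comm; last by rewrite /GRing.comm central_polyC.
  rewrite coef_sum mulr_sumr; apply: eq_bigr => j _; rewrite coefMn coefMT.
  have jk : (j <= k)%N by rewrite -ltnS.
  have kn : (k <= n)%N by rewrite -ltnS.
  rewrite (leq_trans jk kn) coef_hpolyX ?(leq_trans (leq_subr _ _)) // /F.
  set Z := Phi rho _ _.
  have -> : iota (j`!%:R^-1) * t ^+ j * (iota ((k - j)`!%:R^-1) * Z) =
      iota (j`!%:R^-1) * iota ((k - j)`!%:R^-1) * (t ^+ j * Z).
    rewrite -!mulrA; congr (_ * _); rewrite !mulrA; congr (_ * Z).
    exact: tXc.
  rewrite mulrnAr -mulrnAl -rmorphM -raddfMn; congr (iota _ * _).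
  have nz m : m`!%:R != 0 :> R by rewrite pnatr_eq0 -lt0n fact_gt0.
  rewrite -mulr_natr -(bin_fact jk) !natrM; field.
  by rewrite !nz pnatr_eq0 -lt0n bin_gt0.
rewrite (triangular_sum n F); apply: eq_bigr => j _.
rewrite (hom_texp rho l0 (leqnn _)) big_mkord coef_sum mulr_sumr.
apply: eq_bigr => i _; rewrite coefCM coef_hpolyX ?leqnn //.
Qed.

End ExpShift.

(** * The formal logarithm of the exponential series *)

Section LogExp.
Variable R : realType.

Lemma coefX_small (A : nzRingType) (P : {poly A}) k n : P`_0 = 0 -> (n < k)%N ->
  (P ^+ k)`_n = 0.
Proof.
move=> P0; elim: k n => [//|k IH] n nk; rewrite exprS coefM big_ord_recl P0 mul0r add0r.
rewrite big1 // => i _; rewrite IH ?mulr0 //= /bump /=.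
by move: (ltn_ord i) nk; lia.
Qed.

(** P is e^X - 1 and Q is log (1 + P), both up to degree N. Then Q' (1 + P) = P' - (-P)^N P' while
    P' agrees with 1 + P below degree N, so (Q' - 1)(1 + P) vanishes there. Since 1 + P has constant
    term 1, Q' = 1 below degree N. *)
Lemma log_exp_poly (P : {poly R}) N n : P`_0 = 0 ->
    (forall k, (0 < k <= N)%N -> P`_k = k`!%:R^-1) -> (0 < n <= N)%N ->
  (\sum_(1 <= k < N.+1) ((-1) ^+ k.-1 / k%:R)%:P * P ^+ k)`_n = (n == 1)%:R.
Proof.
move=> P0 hP /andP[n0 nN]; set Q := \sum_(1 <= k < _) _.
have dQ : Q^`() * (1 + P) = P^`() - (- P) ^+ N * P^`().
  have -> : Q^`() = (\sum_(0 <= k < N) (- P) ^+ k) * P^`().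
    rewrite /Q raddf_sum /= big_add1 mulr_suml; apply: eq_bigr => k _.
    rewrite derivM derivC mul0r add0r deriv_exp /= -[X in _ * X]mulr_natl.
    have -> : (- P) ^+ k = ((-1) ^+ k)%:P * P ^+ k.
      by rewrite polyC_exp polyCN exprNn.
    have -> : k.+1%:R = (k.+1%:R)%:P :> {poly R} by rewrite polyC_natr.
    by rewrite [LHS]mulrA -polyCM divfK ?pnatr_eq0 //; ring.
  have := subrX1 (- P) N; rewrite -(big_mkord xpredT (fun k => (- P) ^+ k)).
  set W := \sum_(0 <= k < N) _ => E.
  have -> : P^`() - (- P) ^+ N * P^`() = - ((- P) ^+ N - 1) * P^`() by ring.
  by rewrite E; ring.
have Q1 k : (k < N)%N -> (Q^`() - 1)`_k = 0.
  have [m] := ubnP k; elim: m k => // m IH k /ltnSE km kN.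
  have : ((Q^`() - 1) * (1 + P))`_k = 0.
    rewrite mulrBl mul1r dQ !coefB coefD coef_deriv hP //.
    have -> : ((- P) ^+ N * P^`())`_k = 0.
      rewrite coefM big1 // => i _; rewrite coefX_small ?mul0r //.
        by rewrite coefN P0 oppr0.
      by rewrite (leq_ltn_trans _ kN) // -ltnS.
    rewrite subr0 coef1; case: k {km} kN => [|k] kN.
      by rewrite P0 addr0 (_ : 1`! = 1%N) // invr1 subrr.
    rewrite hP ?(ltnW kN) //= add0r (factS k.+1) natrM -[X in X - _]mulr_natr.
    have f0 : (k.+1)`!%:R != 0 :> R by rewrite pnatr_eq0 -lt0n fact_gt0.
    have k0 : k.+2%:R != 0 :> R by rewrite pnatr_eq0.
    by rewrite invfM mulrAC mulVf // mul1r subrr.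
  rewrite coefM big_ord_recr /= subnn (coefD 1 P 0) coef1 P0 addr0 mulr1 big1 ?add0r //.
  by move=> i _; rewrite IH ?mul0r // (leq_trans (ltn_ord i)) // ltnW.
have := Q1 n.-1; rewrite prednK // => /(_ nN) /eqP.
rewrite coefB coef_deriv coef1 prednK // subr_eq0 => /eqP E.
have n1 : n%:R != 0 :> R by rewrite pnatr_eq0 -lt0n.
apply: (mulIf n1); rewrite mulr_natr E -[n in RHS]prednK // eqSS.
by case: eqP => [->|]; rewrite ?mulr1 ?mul0r.
Qed.

End LogExp.

Section Development.
Variables (R : realType) (d m : nat).
Local Notation normc := (@ComplexField.Normc.normc R).
Local Notation A := 'M[R[i]]_m.+1.
Implicit Types (rho : 'I_d -> A) (xi eta : tseries R d) (w : seq 'I_d).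

Definition iotaM : {rmorphism R -> A} := (@scalar_mx R[i] m.+1 \o real_complex R)%FUN.

Lemma iotaM_central r (a : A) : iotaM r * a = a * iotaM r.
Proof. exact: esym (scalar_mxC (r%:C) a). Qed.

Lemma iotaM_mul r (a : A) i j : (iotaM r * a) i j = r%:C * a i j.
Proof. by rewrite -[_ * _]/(_ *m _) mul_scalar_mx mxE. Qed.

(** Decay is measured coefficient by coefficient; the d^n words of length n are absorbed by the
    constant of [hom_bound]. *)
Definition entire_series xi := forall rho : R, 0 < rho ->
  exists M, forall w, `|xi w| <= M * rho ^+ size w.

Lemma normc_rep rho : exists2 B : R, 0 < B & forall w i j,
  normc ((\prod_(a <- w) rho a) i j) <= B ^+ size w.
Proof.
pose B0 := 1 + \sum_a \sum_i \sum_j normc (rho a i j).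
have S0 a i : 0 <= \sum_j normc (rho a i j) by apply: sumr_ge0 => *; exact: normc_ge0.
have B01 : 1 <= B0.
  by rewrite lerDl; apply: sumr_ge0 => a _; apply: sumr_ge0.
have hB a i j : normc (rho a i j) <= B0.
  apply: le_trans (_ : \sum_j normc (rho a i j) <= _).
    by rewrite (bigD1 j) //= lerDl sumr_ge0 // => *; exact: normc_ge0.
  apply: le_trans (_ : \sum_i \sum_j normc (rho a i j) <= _).
    by rewrite [leRHS](bigD1 i) //= lerDl sumr_ge0.
  rewrite /B0 [X in 1 + X](bigD1 a) //= addrCA lerDl addr_ge0 // sumr_ge0 // => b _.
  exact: sumr_ge0.
have B0_ge0 : 0 <= B0 by apply: le_trans B01.
exists (m.+1%:R * B0); first by rewrite mulr_gt0 // (lt_le_trans ltr01).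
elim=> [|a w IH] i j.
  rewrite big_nil expr0 mxE; case: (i == j) => /=; rewrite ?mulr1n ?mulr0n.
    by rewrite expr1n expr0n addr0 sqrtr1.
  by rewrite !expr0n addr0 sqrtr0.
rewrite big_cons mxE /= exprS; apply: le_trans (normc_sum _ _ _) _.
apply: le_trans (_ : \sum_(k < m.+1) B0 * (m.+1%:R * B0) ^+ size w <= _).
  by apply: ler_sum => k _; rewrite normcM; apply: ler_pM; rewrite ?normc_ge0.
by rewrite sumr_const card_ord -[leLHS]mulr_natl mulrA.
Qed.

Lemma hom_bound rho : exists2 B : R, 0 < B & forall xi M r n i j, 0 <= r ->
  (forall w, `|xi w| <= M * r ^+ size w) ->
  normc (hom iotaM rho xi n i j) <= M * (B * r) ^+ n.
Proof.
have [B B0 hB] := normc_rep rho.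
(* The summand 1 keeps the constant positive when d = 0. *)
exists (d%:R * B + 1) => [|xi M r n i j r0 hxi].
  by rewrite ltr_wpDl // mulr_ge0 // ltW.
have M0 : 0 <= M by have := hxi [::]; rewrite expr0 mulr1; exact: le_trans.
apply: le_trans (_ : M * (d%:R * B * r) ^+ n <= _); last first.
  rewrite ler_wpM2l // lerXn2r ?nnegrE ?mulr_ge0 ?addr_ge0 ?mulr_ge0 ?(ltW B0) //.
  by rewrite ler_wpM2r // lerDl.
rewrite /hom summxE; apply: le_trans (normc_sum _ _ _) _.
apply: le_trans (_ : \sum_(w <- words 'I_d n) M * r ^+ n * B ^+ n <= _).
  rewrite !big_seq; apply: ler_sum => w; rewrite mem_words => /eqP wn.
  rewrite iotaM_mul normcM normcR -wn.
  by apply: ler_pM; rewrite ?normc_ge0.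
rewrite big_const_seq count_predT size_words card_ord iter_addr_0 -[leLHS]mulr_natl.
by rewrite natrX !exprMn le_eqVlt; apply/orP; left; apply/eqP; ring.
Qed.

Lemma entire_hom rho xi i j : entire_series xi ->
  entire_seq (fun n => hom iotaM rho xi n i j).
Proof.
have [B B0 hB] := hom_bound rho => hxi r r0.
have rB : 0 < r / B by rewrite divr_gt0.
have [M hM] := hxi _ rB; exists M => n.
have := hB xi M (r / B) n i j (ltW rB) hM.
by rewrite mulrCA divff ?mulr1 // gt_eqF.
Qed.

Definition development rho xi i j : R[i] :=
  csum (fun n => hom iotaM rho xi n i j).

Lemma developmentM rho xi eta i j : entire_series xi -> entire_series eta ->
  development rho (tmul xi eta) i j =
  \sum_k development rho xi i k * development rho eta k j.
Proof.
move=> hxi heta; rewrite /development.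
under [RHS]eq_bigr => k _.
  rewrite -csum_cauchy; [|exact: entire_hom|exact: entire_hom].
  over.
rewrite -csum_sum; last by move=> k; apply: entire_cauchy; exact: entire_hom.
apply: eq_csum => n; rewrite (hom_tmul iotaM_central) summxE /cauchy.
under [LHS]eq_bigr do rewrite mxE.
rewrite exchange_big /=; apply: eq_bigr => k _.
by rewrite big_mkord.
Qed.

Lemma development_tail rho : exists2 B : R, 0 < B &
  forall xi r n i j, 0 <= r -> B * r <= 2^-1 ->
  (forall w, `|xi w| <= r ^+ size w) ->
  normc (development rho xi i j - \sum_(0 <= k < n) hom iotaM rho xi k i j) <=
  4 * (B * r) ^+ n.
Proof.
have [B B0 hB] := hom_bound rho; exists B => // xi r n i j r0 Br hxi.
have := @csum_tail R (fun n => hom iotaM rho xi n i j) 1 (B * r) n.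
rewrite mulr1; apply; first by rewrite Br mulr_ge0 // ltW.
by move=> k; apply: hB => // w; rewrite mul1r.
Qed.

End Development.

Section EntireSeries.
Variables (R : realType) (d : nat).
Implicit Types (xi eta : tseries R d) (w : seq 'I_d).

(* The gap between the two radii keeps the radius of the product equal to r. *)
Lemma geometric_tmul (r M M' : R) xi eta : 0 < r ->
  (forall w, `|xi w| <= M * r ^+ size w) ->
  (forall w, `|eta w| <= M' * (r / 2) ^+ size w) ->
  forall w, `|tmul xi eta w| <= M * M' * 2 * r ^+ size w.
Proof.
move=> r_gt0 hM hM' w; have r0 := ltW r_gt0.
have M0 : 0 <= M by have := hM [::]; rewrite expr0 !mulr1; exact: le_trans.
have M0' : 0 <= M' by have := hM' [::]; rewrite expr0 !mulr1; exact: le_trans.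
set n := size w.
apply: le_trans (ler_norm_sum _ _ _) _.
apply: le_trans (_ : \sum_(k < n.+1) M * M' * r ^+ n * (2^-1) ^+ (n - k) <= _).
  apply: ler_sum => k _; have kn : (k <= n)%N by rewrite -ltnS.
  have := hM (take k w); have := hM' (drop k w).
  rewrite size_drop size_takel // -/n => h2 h1; rewrite normrM.
  have -> : M * M' * r ^+ n * (2^-1) ^+ (n - k) =
    (M * r ^+ k) * (M' * (r / 2) ^+ (n - k)).
    by rewrite -{1}(subnKC kn) exprD exprMn; ring.
  by apply: ler_pM.
rewrite -mulr_sumr [leRHS]mulrAC ler_wpM2l ?mulr_ge0 ?exprn_ge0 //.
have -> : \sum_(k < n.+1) (2^-1) ^+ (n - k) = 2 - (2^-1) ^+ n :> R.
  elim: n => [|k IH]; first by rewrite big_ord1 subn0 !expr0; ring.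
  rewrite big_ord_recl subn0; under eq_bigr do rewrite /= /bump /= add1n subSS.
  by rewrite IH exprS; field.
by rewrite gerBl exprn_ge0 // invr_ge0.
Qed.

End EntireSeries.

(** * The representation by triangular matrices and its entries *)

Section Triangular.
Variable R : realType.
Local Notation C := R[i].
Implicit Types (w : seq 'I_2) (xi : tseries R 2).

Definition o0 : 'I_3 := ord0.
Definition o1 : 'I_3 := @Ordinal 3 1 isT.
Definition o2 : 'I_3 := ord_max.

Lemma sum_ord3 (V : nmodType) (F : 'I_3 -> V) : \sum_k F k = F o0 + F o1 + F o2.
Proof.
rewrite !big_ord_recl big_ord0 addr0 addrA; congr (_ + F _ + F _); exact: val_inj.
Qed.

Definition lam3 (a b c : C) (k : 'I_3) : C := nth 0 [:: a; b; c] k.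

Definition tri (lam : 'I_3 -> C) (i : 'I_2) : 'M[C]_3 :=
  \matrix_(a, b) (if i == 0 then (a == b)%:R * lam a else (b == a.+1 :> nat)%:R).

Lemma letter_cases (a : 'I_2) : a = 0 \/ a = ycoord.
Proof.
by case: a => [[|[|//]] h]; [left|right]; apply: val_inj.
Qed.

(** The derivative of e^(z x) in the direction w, divided by e^(z x). *)
Definition zero_word (z : C) w : C := if all (pred1 0) w then z ^+ size w else 0.

(** It equals z1^i z2^j on the word x^i y x^j, and 0 on words without exactly one y. *)
Fixpoint one_y (z1 z2 : C) w : C :=
  if w is a :: w' then
    if a == 0 then z1 * one_y z1 z2 w' else zero_word z2 w'
  else 0.

Definition rep lam w : 'M[C]_3 := \prod_(a <- w) tri lam a.

Lemma rep_cons lam a w i j : rep lam (a :: w) i j =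
  if a == 0 then lam i * rep lam w i j
  else \sum_(k < 3) (k == i.+1 :> nat)%:R * rep lam w k j.
Proof.
rewrite /rep big_cons mxE; case: ifP => ha.
  rewrite (bigD1 i) //= mxE ha eqxx mul1r [X in _ + X]big1 ?addr0 // => k ki.
  by rewrite mxE ha eq_sym (negPf ki) !mul0r.
by apply: eq_bigr => k _; rewrite mxE ha.
Qed.

Lemma rep_nil lam i j : rep lam [::] i j = (i == j)%:R.
Proof. by rewrite /rep big_nil mxE. Qed.

Lemma rep_low lam w (i j : 'I_3) : (j < i)%N -> rep lam w i j = 0.
Proof.
elim: w i j => [|a w IH] i j ji.
  by rewrite rep_nil -val_eqE /= gtn_eqF.
rewrite rep_cons; case: ifP => _; first by rewrite IH // mulr0.
rewrite big1 // => k _; have [e|] := eqVneq (k : nat) i.+1.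
  by rewrite IH ?mulr0 // e ltnS ltnW.
by rewrite mul0r.
Qed.

Lemma rep_diag lam w i : rep lam w i i = zero_word (lam i) w.
Proof.
rewrite /zero_word; elim: w => [|a w IH]; first by rewrite rep_nil eqxx.
rewrite rep_cons /=; case: ifP => /= _; first by rewrite IH exprS; case: all => //; rewrite mulr0.
rewrite big1 // => k _; have [e|] := eqVneq (k : nat) i.+1.
  by rewrite rep_low ?mulr0 // e.
by rewrite mul0r.
Qed.

Lemma rep01 lam w : rep lam w o0 o1 = one_y (lam o0) (lam o1) w.
Proof.
elim: w => [|a w IH]; first by rewrite rep_nil.
rewrite rep_cons /= IH; case: ifP => // _.
by rewrite sum_ord3 /= !mul0r add0r addr0 mul1r rep_diag.
Qed.

Lemma rep12 lam w : rep lam w o1 o2 = one_y (lam o1) (lam o2) w.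
Proof.
elim: w => [|a w IH]; first by rewrite rep_nil.
rewrite rep_cons /= IH; case: ifP => // _.
by rewrite sum_ord3 /= !mul0r !add0r mul1r rep_diag.
Qed.

Lemma rep_rcons lam a w i j : rep lam (rcons w a) i j =
  if a == 0 then rep lam w i j * lam j
  else \sum_(k < 3) rep lam w i k * (j == k.+1 :> nat)%:R.
Proof.
rewrite /rep -cats1 big_cat /= big_seq1 mxE; case: ifP => ha.
  rewrite (bigD1 j) //= mxE ha eqxx mul1r [X in _ + X]big1 ?addr0 // => k ki.
  by rewrite mxE ha (negPf ki) mul0r mulr0.
by apply: eq_bigr => k _; rewrite mxE ha.
Qed.

Local Notation Phi lam := (hom (iotaM R 2) (tri lam)).

Lemma homE lam xi n i j :
  Phi lam xi n i j = \sum_(w <- words 'I_2 n) (xi w)%:C * rep lam w i j.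
Proof. by rewrite /hom summxE; apply: eq_bigr => w _; rewrite iotaM_mul. Qed.

Lemma hom_low lam xi n (i j : 'I_3) : (j < i)%N -> Phi lam xi n i j = 0.
Proof. by move=> ji; rewrite homE big1 // => w _; rewrite rep_low // mulr0. Qed.

Lemma sum_zero_word (F : seq 'I_2 -> C) n z :
  \sum_(w <- words 'I_2 n) F w * zero_word z w = F (nseq n 0) * z ^+ n.
Proof.
rewrite (bigD1_seq (nseq n 0)) /= ?uniq_words ?mem_words ?size_nseq //.
rewrite {1}/zero_word all_nseq /= eqxx orbT size_nseq big1_seq ?addr0 //.
move=> w /andP[wn]; rewrite mem_words => /eqP sw.
rewrite /zero_word; case: all_pred1P => [e|_]; last by rewrite mulr0.
by rewrite e sw eqxx in wn.
Qed.

Lemma hom_diag lam xi n i : Phi lam xi n i i = (xi (nseq n 0))%:C * lam i ^+ n.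
Proof.
rewrite homE; under eq_bigr do rewrite rep_diag.
exact: (sum_zero_word (fun w => (xi w)%:C)).
Qed.

(** With [lam o2 = 0] the words ending in x contribute nothing, and a final y reaches column 2 from
    column 1 only. The result has the form of a compensated Riemann term for integration against
    y. *)
Lemma hom_last lam xi n (i j : 'I_3) : lam o2 = 0 -> (j.+1 = 2)%N -> i != o2 ->
  Phi lam xi n.+1 i o2 =
  \sum_(w <- words 'I_2 n) (xi (rcons w ycoord))%:C * rep lam w i j.
Proof.
move=> l2 j1 i2; rewrite homE big_words_rcons; apply: eq_bigr => w _.
rewrite big_ord_recl big_ord1 !rep_rcons /= l2 mulr0 mulr0 add0r.
have -> : lift ord0 ord0 = ycoord :> 'I_2 by apply: val_inj.
congr (_ * _); rewrite (bigD1 j) //= j1 mulr1 big1 ?addr0 // => k kj.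
have : (2 == k.+1)%N = false by apply: contra_neqF kj => /eqP e; apply: val_inj; apply: succn_inj; rewrite -e j1.
by move=> ->; rewrite mulr0.
Qed.

Lemma hom_offdiag0 lam xi i j : i != j -> Phi lam xi 0 i j = 0.
Proof. by move=> ij; rewrite homE big_words0 rep_nil (negPf ij) mulr0. Qed.

End Triangular.

(** * Developments of the signature *)

Section RiemannLimit.
Variable R : realType.
Local Notation normc := (@ComplexField.Normc.normc R).
Implicit Types (om : R -> R -> R) (D : seq R).

Lemma normc_psum (A : R -> R -> R[i]) s D :
  normc (psum A s D) <= psum (fun u v => normc (A u v)) s D.
Proof.
elim: D s => [|x D IH] s /=; first by rewrite expr0n addr0 sqrtr0.
by apply: le_trans (normcD _ _) _; rewrite lerD2l.
Qed.

Lemma psum_telescope (A : R -> R -> R[i]) (J : R -> R[i]) s D :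
  psum A s D - (J (last s D) - J s) = psum (fun u v => A u v - (J v - J u)) s D.
Proof.
elim: D s => [|x D IH] s /=; first by rewrite subrr subr0.
by rewrite -IH; ring.
Qed.

(** After telescoping J the error is a sum of terms B om^th, at most B times the largest om^(th - 1)
    times om(0, T) by superadditivity. The estimate is asked for only where om <= e0, since
    developments are controlled only on short intervals. *)
Lemma riemann_limit om (th B e0 : R) (A : R -> R -> R[i]) (J : R -> R[i]) (T : R) :
    control om -> 1 < th -> 0 < e0 -> 0 <= T -> T <= 1 ->
    (forall u v, 0 <= u -> u <= v -> v <= 1 -> om u v <= e0 ->
      normc (A u v - (J v - J u)) <= B * om u v `^ th) ->
  forall e, 0 < e -> exists2 r, 0 < r & forall D, itv_partition 0 T D ->
    mesh_lt 0 D r -> normc (psum A 0 D - (J T - J 0)) < e.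
Proof.
move=> hom th1 e00 T0 T1 hA e epos; case: (hom) => om0 omD omS.
have th0 : 0 < th by lra.
have thm : 0 < th - 1 by lra.
pose W := om 0 T; have W0 : 0 <= W by exact: om0.
pose K := (`|B| + 1) * (W + 1).
have K0 : 0 < K by rewrite mulr_gt0 // ltr_wpDl.
pose eta := Num.min e0 ((e / 2 / K) `^ (th - 1)^-1).
have eta0 : 0 < eta by rewrite lt_min e00 powR_gt0 // !divr_gt0.
have [r r0 hr] := omS eta eta0; exists r => // D hD mD.
have lastD : last 0 D = T by case: hD => _ /eqP.
have := psum_telescope A J 0 D; rewrite lastD => ->.
apply: le_lt_trans (normc_psum _ _ _) _.
apply: le_lt_trans (_ : psum (fun u v => (`|B| + 1) * (e / 2 / K) * om u v) 0 D < e).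
  apply: le_psum_mesh hD mD => u v u0 uv vT uvr.
  have v1 := le_trans vT T1.
  have omuv := hr u v u0 uv v1 uvr; have om_ge := om0 u v u0 uv v1.
  have ome : om u v <= e0 by apply: le_trans omuv _; rewrite ge_min lexx.
  apply: le_trans (hA u v u0 uv v1 ome) _.
  rewrite -(mulr_powRB1 om_ge th0) mulrCA mulrC.
  apply: ler_wpM2r => //.
  have le1 : om u v `^ (th - 1) <= e / 2 / K.
    have -> : e / 2 / K = ((e / 2 / K) `^ (th - 1)^-1) `^ (th - 1).
      by rewrite -powRrM mulVf ?gt_eqF // powRr1 // !divr_ge0 // ltW.
    apply: ge0_ler_powR; rewrite ?nnegrE ?powR_ge0 ?(ltW thm) //.
    by apply: le_trans omuv _; rewrite ge_min lexx orbT.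
  apply: le_trans (_ : (`|B| + 1) * om u v `^ (th - 1) <= _).
    by rewrite ler_wpM2r ?powR_ge0 // (le_trans (ler_norm B)) // lerDl.
  by rewrite ler_wpM2l // addr_ge0.
rewrite psumZ; have := psum_control hom (lexx 0) T0 T1 hD; rewrite -/W => hW.
have c0 : 0 <= (`|B| + 1) * (e / 2 / K).
  by rewrite mulr_ge0 ?addr_ge0 // !divr_ge0 // ltW.
apply: le_lt_trans (ler_wpM2l c0 hW) _.
have B1 : 0 < `|B| + 1 by rewrite ltr_wpDl.
have W1 : 0 < W + 1 by rewrite ltr_wpDl.
have -> : (`|B| + 1) * (e / 2 / K) * W = e / 2 * (W / (W + 1)).
  by rewrite /K; field; rewrite !gt_eqF.
have : W / (W + 1) <= 1 by rewrite ler_pdivrMr // mul1r lerDl.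
have e2 : 0 <= e / 2 by rewrite divr_ge0 // ltW.
by move=> /(ler_wpM2l e2); lra.
Qed.

(** The case A = 0 of [riemann_limit]: all Riemann sums are 0 and they converge to J T - J 0. *)
Lemma almost_constant om (th B e0 : R) (J : R -> R[i]) (T : R) :
    control om -> 1 < th -> 0 < e0 -> 0 <= T -> T <= 1 ->
    (forall u v, 0 <= u -> u <= v -> v <= 1 -> om u v <= e0 ->
      normc (J v - J u) <= B * om u v `^ th) ->
  J T = J 0.
Proof.
move=> hom th1 e00 T0 T1 hJ; apply/eqP; rewrite -subr_eq0; apply/eqP.
apply: eq0_normc; apply/eqP; rewrite eq_le normc_ge0 andbT.
apply/ler_addgt0Pr => e epos; rewrite add0r.
have [|r r0 hr] := @riemann_limit om th B e0 (fun _ _ => 0) J T hom th1 e00 T0 T1 _ e epos.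
  by move=> u v *; rewrite sub0r normc_opp hJ.
have [D hD mD] := uniform_partition T0 r0.
have := hr D hD mD.
have -> : psum (fun _ _ => 0) 0 D = 0 :> R[i].
  by elim: (D) (0 : R) => //= x D' IH y; rewrite IH addr0.
by rewrite sub0r normc_opp => /ltW.
Qed.

End RiemannLimit.

Section UniformEntire.
Variables (R : realType) (d : nat) (p q K : R) (S : R -> R -> tseries R d).
Variable om : R -> R -> R.
Hypothesis hS : forall n, multiplicative_functional p n S.
Hypothesis q0 : 0 < q.
Hypothesis K0 : 0 <= K.
Hypothesis hom : control om.
Hypothesis hgeo : forall w s t, 0 <= s -> s <= t -> t <= 1 ->
  `|S s t w| <= (K * om s t `^ q^-1) ^+ size w.

Lemma radius_le e s t : 0 < e -> 0 <= s -> s <= t -> t <= 1 ->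
  om s t <= (e / (K + 1)) `^ q -> K * om s t `^ q^-1 <= e.
Proof.
move=> e0 s0 st t1 h; have [om0 _ _] := hom.
have K1 : 0 < K + 1 by rewrite ltr_wpDl.
have : om s t `^ q^-1 <= e / (K + 1).
  have -> : e / (K + 1) = ((e / (K + 1)) `^ q) `^ q^-1.
    by rewrite -powRrM divff ?gt_eqF // powRr1 // divr_ge0 // ltW.
  by apply: ge0_ler_powR; rewrite ?nnegrE ?powR_ge0 ?invr_ge0 ?(ltW q0) ?om0.
move=> /(ler_wpM2l K0) /le_trans; apply.
rewrite mulrCA -[leRHS]mulr1 ler_pM2l // ler_pdivrMr // mul1r.
by rewrite lerDl.
Qed.

Lemma radius_small e : 0 < e -> exists2 r, 0 < r & forall s t, 0 <= s -> s <= t ->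
  t <= 1 -> t - s < r -> K * om s t `^ q^-1 <= e.
Proof.
move=> e0; have [_ _ omS] := hom.
have K1 : 0 < K + 1 by rewrite ltr_wpDl.
have [|r r0 hr] := omS ((e / (K + 1)) `^ q); first by rewrite powR_gt0 // divr_gt0.
by exists r => // s t s0 st t1 tsr; apply: radius_le => //; exact: hr.
Qed.

(** The rate K om(s,t)^(1/q) is at most rho / 2 on short intervals. Boundedly many of them cover
    [s, t], and Chen's identity glues them: each one multiplies M by 2 and keeps the rate rho. *)
Lemma uniform_entire (rho : R) : 0 < rho -> exists M, forall s t, 0 <= s ->
  s <= t -> t <= 1 -> forall w, `|S s t w| <= M * rho ^+ size w.
Proof.
move=> rho0; have rho2 : 0 < rho / 2 by rewrite divr_gt0.
have [r r0 hr] := radius_small rho2.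
have r2 : 0 < r / 2 by rewrite divr_gt0.
have H k : exists M, forall s t, 0 <= s -> s <= t -> t <= 1 ->
    t - s <= k%:R * (r / 2) -> forall w, `|S s t w| <= M * rho ^+ size w.
  elim: k => [|k [M IH]].
    exists 1 => s t s0 st t1; rewrite mul0r subr_le0 => ts w.
    have -> : t = s by apply/eqP; rewrite eq_le ts st.
    have [/size0nil ->|w0] := posnP (size w).
      by rewrite (mf_nil hS) ?lexx // ?(le_trans st) // normr1 expr0 mulr1.
    by rewrite (mf_diag hS) ?(le_trans st) // normr0 mul1r exprn_ge0 // ltW.
  exists (M * 1 * 2) => s t s0 st t1 hts w.
  pose u := Num.max s (t - r / 2).
  have su : s <= u by rewrite le_max lexx.
  have ut : u <= t by rewrite ge_max st lerBlDr lerDl ltW.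
  have us : u - s <= k%:R * (r / 2).
    rewrite lerBlDr ge_max lerDr mulr_ge0 ?(ltW r2) //=.
    by move: hts; rewrite -natr1 mulrDl mul1r; lra.
  have tu : t - u < r.
    have : t - r / 2 <= u by rewrite le_max lexx orbT.
    by lra.
  rewrite (mf_mul hS w s0 su ut t1); apply: geometric_tmul => // v.
    exact: IH s0 su (le_trans ut t1) us v.
  rewrite mul1r; have u0 := le_trans s0 su.
  apply: le_trans (hgeo v u0 ut t1) _.
  have rut := hr u t u0 ut t1 tu.
  apply: lerXn2r => //; rewrite nnegrE ?(ltW rho2) //.
  by rewrite mulr_ge0 // powR_ge0.
have [M hM] := H (Num.truncn (r / 2)^-1).+1; exists M => s t s0 st t1.
apply: hM => //; apply: le_trans (_ : 1 <= _); first by lra.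
by rewrite -ler_pdivrMr // div1r ltW // truncnS_gt.
Qed.

End UniformEntire.

Section Signature.
Variables (R : realType) (p q K : R) (X S : R -> R -> tseries R 2).
Variables (gamma : R -> 'rV[R]_2) (om : R -> R -> R).
Hypothesis hX : weakly_geometric p X.
Hypothesis hgamma : first_level X gamma.
Hypothesis hS : lyons_extension p X S.
Hypothesis gamma0 : gamma 0 = 0.
Hypothesis q0 : 0 < q.
Hypothesis qN : q < (Num.truncn p).+1%:R.
Hypothesis K0 : 0 <= K.
Hypothesis homc : control om.
Hypothesis hgeo : forall w s t, 0 <= s -> s <= t -> t <= 1 ->
  `|S s t w| <= (K * om s t `^ q^-1) ^+ size w.
Local Notation normc := (@ComplexField.Normc.normc R).
Local Notation C := R[i].
Local Notation N := (Num.truncn p).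
Local Notation x t := (gamma t 0 0).
Local Notation rad s t := (K * om s t `^ q^-1).
Local Notation hSm := (proj1 hS).

Lemma truncn_gt0 : (0 < N)%N.
Proof. by have [[p1 _ _] _] := hX; rewrite truncn_gt0. Qed.

Lemma signature_low s t w : 0 <= s -> s <= t -> t <= 1 -> (size w <= N)%N ->
  S s t w = X s t w.
Proof. by move=> s0 st t1 wN; apply: (proj2 hS) => //; split. Qed.

Lemma signature_x s t : 0 <= s -> s <= t -> t <= 1 -> S s t [:: 0] = x t - x s.
Proof.
move=> s0 st t1; rewrite signature_low //; first by apply: hgamma; split.
exact: truncn_gt0.
Qed.

Lemma radX s t n : 0 <= s -> s <= t -> t <= 1 ->
  rad s t ^+ n = K ^+ n * om s t `^ (n%:R / q).
Proof.
move=> *; rewrite exprMn -[(_ `^ _) ^+ n]powR_mulrn ?powR_ge0 //.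
by rewrite -powRrM [q^-1 * _]mulrC.
Qed.

Lemma rad_ge0 s t : 0 <= rad s t.
Proof. by rewrite mulr_ge0 ?powR_ge0. Qed.

Lemma x_le_rad s t : 0 <= s -> s <= t -> t <= 1 -> `|x t - x s| <= rad s t.
Proof. by move=> s0 st t1; rewrite -signature_x // -[leRHS]expr1; exact: hgeo. Qed.

(** Restricted to n <= [p], where S_(s,t) agrees with the exponential of a Lie polynomial, whose
    degree one coefficient at the letter x is x_t - x_s. *)
Lemma weakly_geometric_shift (A : nzRingType) (iota : {rmorphism R -> A})
    (rho : 'I_2 -> A) (c : A) s t n :
    (forall r a, iota r * a = a * iota r) -> (forall a, c * a = a * c) ->
    0 <= s -> s <= t -> t <= 1 -> (n <= N)%N ->
  hom iota (shifted rho 0 c) (S s t) n = \sum_(j < n.+1)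
    iota (j`!%:R^-1) * (iota (x t - x s) * c) ^+ j * hom iota rho (S s t) (n - j).
Proof.
move=> hi hc s0 st t1 nN.
have [_ /(_ s t) []] := hX; first by split.
move=> l hl hXl.
have Sl w : (size w <= N)%N -> S s t w = texp l w.
  by move=> wN; rewrite signature_low // hXl.
have l0 := lie_nil hl.
have -> : x t - x s = l [:: 0].
  rewrite -signature_x // Sl ?truncn_gt0 // /texp !big_nat_recr //= big_geq // add0r.
  rewrite /tpow /= {1}/tone /= mul0r add0r divr1.
  by rewrite /tmul !big_ord_recl big_ord0 /= l0 mul0r addr0 add0r /tone eqxx mulr1.
transitivity (hom iota (shifted rho 0 c) (texp l) n).
  by apply: eq_hom => w wn; apply: Sl; rewrite wn.
rewrite (hom_texp_shift hi _ _ hc n hl); apply: eq_bigr => j _; congr (_ * _).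
by apply: eq_hom => w wn; rewrite Sl // wn (leq_trans (leq_subr _ _)).
Qed.

(** Sending e_x to 1 and e_y to 0 reads off the coefficients of the words x...x. *)
Lemma hom_letter (A : comNzRingType) (iota : {rmorphism R -> A}) (xi : tseries R 2) n :
  hom iota (shifted (fun=> 0) 0 1) xi n = iota (xi (nseq n 0)).
Proof.
rewrite /hom (bigD1_seq (nseq n 0)) /= ?uniq_words ?mem_words ?size_nseq //.
rewrite [X in _ * X + _]big1_seq; last first.
  by move=> i /andP[_ /nseqP[-> _]]; rewrite /shifted eqxx add0r.
rewrite mulr1 big1_seq ?addr0 // => w /andP[wn]; rewrite mem_words => /eqP sw.
have /hasP [a aw a0] : has (predC1 0) w.
  rewrite has_predC; apply: contra wn => /all_pred1P ->.
  by rewrite sw.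
by rewrite (big_rem a) //= /shifted (negPf a0) addr0 mul0r mulr0.
Qed.

(** Up to degree [p] this is the shift of the zero representation by 1. In a higher degree n, Chen's
    identity, the binomial formula and induction make the difference f of the two sides additive; as
    it is O(om^(n / q)) with n / q > 1, it vanishes. *)
Lemma signature_zero_word n s t : 0 <= s -> s <= t -> t <= 1 ->
  S s t (nseq n 0) = (x t - x s) ^+ n / n`!%:R.
Proof.
have [m] := ubnP n; elim: m n s t => // m IH n s t /ltnSE nm s0 st t1.
have [nN|Nn] := leqP n N.
  have /(_ (fun r a => mulrC r a) (fun a => mulrC 1 a)) :=
    @weakly_geometric_shift R idfun (fun=> 0) 1 s t n.
  rewrite hom_letter /= => -> //.
  rewrite big_ord_recr /= subnn hom0 /= (mf_nil hSm) // mulr1 big1 ?add0r.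
    by rewrite mulr1 mulrC.
  move=> j _; rewrite [hom _ _ _ _](_ : _ = 0) ?mulr0 //.
  rewrite /hom big_seq big1 // => w; rewrite mem_words => /eqP.
  case: w => [|a w] sw; last by rewrite big_cons mul0r mulr0.
  by move/eqP: sw; rewrite eq_sym subn_eq0 leqNgt ltn_ord.
pose f u v : R := S u v (nseq n 0) - (x v - x u) ^+ n / n`!%:R.
have n0 : (0 < n)%N by apply: leq_ltn_trans Nn.
have fadd u v : 0 <= u -> u <= v -> v <= 1 -> f 0 v - f 0 u = f u v.
  move=> u0 uv v1; have u1 := le_trans uv v1; have v0 := le_trans u0 uv.
  have nz k : k`!%:R != 0 :> R by rewrite pnatr_eq0 -lt0n fact_gt0.
  pose a k := S 0 u (nseq k 0); pose b k := S u v (nseq k 0).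
  pose al k := (x u - x 0) ^+ k / k`!%:R; pose be k := (x v - x u) ^+ k / k`!%:R.
  have E1 : S 0 v (nseq n 0) = \sum_(k < n.+1) a k * b (n - k)%N.
    rewrite (mf_mul hSm _ (lexx 0) u0 uv v1) /tmul size_nseq; apply: eq_bigr => k _.
    by rewrite take_nseq ?drop_nseq // -ltnS.
  have E2 : (x v - x 0) ^+ n / n`!%:R = \sum_(k < n.+1) al k * be (n - k)%N.
    have -> : x v - x 0 = (x v - x u) + (x u - x 0) by ring.
    rewrite exprDn mulr_suml; apply: eq_bigr => i _.
    rewrite -[X in X / _]mulr_natr.
    have -> : 'C(n, i)%:R = n`!%:R / (i`!%:R * (n - i)`!%:R) :> R.
      apply: (canRL (mulfK _)); first by rewrite mulf_neq0.
      by rewrite -!natrM bin_fact // -ltnS.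
    by rewrite /al /be; field; rewrite !nz.
  have mid k : (0 < k < n)%N -> a k * b (n - k)%N = al k * be (n - k)%N.
    move=> /andP[k0 kn]; have km := leq_trans kn nm.
    have nkm : (n - k < m)%N by apply: leq_trans nm; rewrite ltn_subrL k0.
    by rewrite /a /b !IH.
  have ends (F : nat -> R) :
      \sum_(k < n.+1) F k = F 0%N + \sum_(1 <= k < n) F k + F n.
    by rewrite big_ord_recr /= -(big_mkord xpredT F) big_ltn.
  rewrite /f E1 E2 (ends (fun k => a k * b (n - k)%N)).
  rewrite (ends (fun k => al k * be (n - k)%N)) !subn0 !subnn.
  rewrite (eq_big_nat _ _ (F2 := fun k => al k * be (n - k)%N)) //.
  have -> : a 0%N = 1 by exact: (mf_nil hSm).
  have -> : b 0%N = 1 by exact: (mf_nil hSm).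
  have -> : al 0%N = 1 by rewrite /al expr0 fact0 divr1.
  have -> : be 0%N = 1 by rewrite /be expr0 fact0 divr1.
  by rewrite /a /b /al /be; ring.
have f00 : f 0 0 = 0.
  by rewrite /f (mf_diag hSm) ?size_nseq // subrr expr0n gtn_eqF // mul0r subrr.
have f0 T : 0 <= T -> T <= 1 -> f 0 T = 0.
  move=> T0 T1; have th1 : 1 < n%:R / q.
    by rewrite ltr_pdivlMr // mul1r (lt_le_trans qN) // ler_nat.
  have := @almost_constant R om (n%:R / q) (2 * K ^+ n) 1
    (fun t => (f 0 t)%:C) T homc th1 ltr01 T0 T1 _.
  rewrite f00 => H; have {}H := H _; apply: complexI; apply: H.
  move=> u v u0 uv v1 _; rewrite -rmorphB normcR fadd // /f.
  apply: le_trans (ler_normB _ _) _.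
  have := hgeo (nseq n 0) u0 uv v1; rewrite size_nseq => h1.
  rewrite -mulrA -radX // mulr_natl mulr2n lerD //.
  have fV : 0 <= n`!%:R^-1 :> R by rewrite invr_ge0.
  rewrite normrM normrX (ger0_norm fV).
  apply: le_trans (_ : `|x v - x u| ^+ n <= _).
    by rewrite ler_piMr ?exprn_ge0 // invf_le1 ?ltr0n ?fact_gt0 // ler1n fact_gt0.
  by rewrite lerXn2r ?nnegrE ?rad_ge0 // x_le_rad.
have t0 := le_trans s0 st; have s1 := le_trans st t1.
have := fadd s t s0 st t1; rewrite !f0 // subrr => /esym/eqP.
by rewrite subr_eq0 => /eqP.
Qed.

Lemma signature_entire s t : 0 <= s -> s <= t -> t <= 1 -> entire_series (S s t).
Proof.
move=> s0 st t1 rho r0.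
have [M hM] := uniform_entire hSm q0 K0 homc hgeo r0.
by exists M; exact: hM.
Qed.

Definition sig_entry lam s t i j := development (tri lam) (S s t) i j.
Local Notation Phi lam := (hom (iotaM R 2) (tri lam)).

Lemma sig_entry_diag lam s t i : 0 <= s -> s <= t -> t <= 1 ->
  sig_entry lam s t i i = cexp (lam i * (x t - x s)%:C).
Proof.
move=> s0 st t1; rewrite /sig_entry /development -csum_cexp; apply: eq_csum => n.
rewrite hom_diag signature_zero_word // /cexp_terms exprMn rmorphM fmorphV.
by rewrite rmorphXn rmorph_nat; ring.
Qed.

Lemma sig_entry_low lam s t (i j : 'I_3) : (j < i)%N -> sig_entry lam s t i j = 0.
Proof.
move=> ji; rewrite /sig_entry /development -[RHS](@csum0 R); apply: eq_csum => n.
exact: hom_low.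
Qed.

Lemma sig_entryM lam s t u i j : 0 <= s -> s <= t -> t <= u -> u <= 1 ->
  sig_entry lam s u i j = \sum_k sig_entry lam s t i k * sig_entry lam t u k j.
Proof.
move=> s0 st tu u1; rewrite /sig_entry -developmentM.
- apply: eq_csum => n.
  have -> : Phi lam (S s u) n = Phi lam (tmul (S s t) (S t u)) n.
    by apply: eq_hom => w _; exact: (mf_mul hSm).
  by [].
- by apply: signature_entire => //; apply: le_trans u1.
- by apply: signature_entire => //; apply: le_trans st.
Qed.

Lemma sig_entry01 lam s t u : 0 <= s -> s <= t -> t <= u -> u <= 1 ->
  sig_entry lam s u o0 o1 = cexp (lam o0 * (x t - x s)%:C) * sig_entry lam t u o0 o1 +
    sig_entry lam s t o0 o1 * cexp (lam o1 * (x u - x t)%:C).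
Proof.
move=> s0 st tu u1; rewrite (sig_entryM _ _ _ s0 st tu u1) sum_ord3.
rewrite (@sig_entry_low _ _ _ o2 o1) // mulr0 addr0 !sig_entry_diag //.
  exact: le_trans s0 st.
exact: le_trans tu u1.
Qed.

Lemma sig_entry12 lam s t u : 0 <= s -> s <= t -> t <= u -> u <= 1 ->
  sig_entry lam s u o1 o2 = cexp (lam o1 * (x t - x s)%:C) * sig_entry lam t u o1 o2 +
    sig_entry lam s t o1 o2 * cexp (lam o2 * (x u - x t)%:C).
Proof.
move=> s0 st tu u1; rewrite (sig_entryM _ _ _ s0 st tu u1) sum_ord3.
rewrite (@sig_entry_low _ _ _ o1 o0) // mul0r add0r !sig_entry_diag //.
  exact: le_trans s0 st.
exact: le_trans tu u1.
Qed.

Lemma sig_entry02 lam s t u : 0 <= s -> s <= t -> t <= u -> u <= 1 ->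
  sig_entry lam s u o0 o2 = cexp (lam o0 * (x t - x s)%:C) * sig_entry lam t u o0 o2 +
    sig_entry lam s t o0 o1 * sig_entry lam t u o1 o2 +
    sig_entry lam s t o0 o2 * cexp (lam o2 * (x u - x t)%:C).
Proof.
move=> s0 st tu u1; rewrite (sig_entryM _ _ _ s0 st tu u1) sum_ord3 !sig_entry_diag //.
  exact: le_trans s0 st.
exact: le_trans tu u1.
Qed.

Lemma sig_entry_refl lam s i j : 0 <= s -> s <= 1 -> i != j -> sig_entry lam s s i j = 0.
Proof.
move=> s0 s1 ij; rewrite /sig_entry /development -[RHS](@csum0 R); apply: eq_csum => n.
rewrite homE big_seq big1 // => w; rewrite mem_words => /eqP wn.
case: w wn => [|a w] wn; first by rewrite rep_nil (negPf ij) mulr0.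
by rewrite (mf_diag hSm) // mul0r.
Qed.

Lemma sig_entry_bounded lam : exists M : R, 0 <= M /\ forall s t i j, 0 <= s -> s <= t -> t <= 1 ->
  normc (sig_entry lam s t i j) <= M.
Proof.
have [B B0 hB] := hom_bound (tri lam).
(* With this rate for the coefficients, the entries of degree k are at most M 2^(-k). *)
have rho0 : 0 < (2 * B)^-1 by rewrite invr_gt0 mulr_gt0.
have [M hM] := uniform_entire hSm q0 K0 homc hgeo rho0.
exists (`|4 * M|); split => // s t i j s0 st t1.
have := @csum_tail R (fun n => Phi lam (S s t) n i j) M (2^-1) 0.
rewrite big_geq // subr0 expr0 mulr1 => H; apply: le_trans (ler_norm _).
apply: H; first by rewrite invr_ge0 lexx ler0n.
move=> k; have := hB (S s t) M _ k i j (ltW rho0) (hM s t s0 st t1).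
by rewrite invfM mulrCA divff ?mulr1 // gt_eqF.
Qed.

Lemma sig_entry_tail lam : exists B e0 : R, [/\ 0 <= B, 0 < e0 & forall s t i j,
  0 <= s -> s <= t -> t <= 1 -> om s t <= e0 ->
  normc (sig_entry lam s t i j - \sum_(0 <= k < N.+1) Phi lam (S s t) k i j) <=
  B * om s t `^ (N.+1%:R / q)].
Proof.
have [B B0 hB] := development_tail (tri lam).
have e1 : 0 < (2^-1 / B : R) by rewrite divr_gt0 ?invr_gt0.
exists (4 * (B ^+ N.+1 * K ^+ N.+1)), ((2^-1 / B / (K + 1)) `^ q); split.
- by rewrite !mulr_ge0 ?exprn_ge0 // ltW.
- by rewrite powR_gt0 // divr_gt0 // ltr_wpDl.
move=> s t i j s0 st t1 ome.
have := radius_le q0 K0 homc e1 s0 st t1 ome.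
rewrite ler_pdivlMr // mulrC => Br.
have := hB (S s t) _ N.+1 i j (rad_ge0 s t) Br (fun w => hgeo w s0 st t1).
by rewrite exprMn radX // !mulrA.
Qed.

(** The exponential is a diagonal entry of the development of S_(0,t), and these are uniformly
    bounded. *)
Lemma cexp_bound (c : C) : exists M : R, 0 <= M /\ forall t, 0 <= t -> t <= 1 ->
  normc (cexp (c * (x t)%:C)) <= M.
Proof.
have [M [M0 hM]] := sig_entry_bounded (lam3 c 0 0); exists M; split => // t t0 t1.
have := hM 0 t o0 o0 (lexx 0) t0 t1; rewrite sig_entry_diag //.
by rewrite gamma0 mxE subr0.
Qed.

End Signature.

(** * Rough integrals of exponentials *)

Section Derivatives.
Variable R : realType.
Local Notation C := R[i].
Implicit Types (g : R -> R) (v : 'rV[R]_2).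

Lemma derive_coord g v (i : 'I_2) :
  'D_(delta_mx 0 i) (fun u : 'rV[R]_2 => g (u 0 0) : R^o) v =
  if i == 0 then 'D_1 (g : R^o -> R^o) (v 0 0) else 0.
Proof.
rewrite /derive; case: ifP => hi.
  rewrite (_ : (fun h => _) = fun h : R => h^-1 *: ((g (h *: 1 + v 0 0) : R^o) - g (v 0 0))) //.
  apply/funext => h /=.
  by rewrite !mxE (eqP hi) eqxx /= mulr1 [h *: 1]mulr1.
rewrite (_ : (fun h => _) = fun=> 0); first by apply: lim_cst; exact: norm_hausdorff.
by apply/funext => h /=; rewrite !mxE eq_sym hi /= mulr0 add0r subrr scaler0.
Qed.

Lemma derive_exp_cos_sin (a b c d t : R) :
  is_derive t 1 (fun y => expR (c * y) * (a * cos (d * y) + b * sin (d * y)) : R^o)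
    (expR (c * t) * ((a * c + b * d) * cos (d * t) + (b * c - a * d) * sin (d * t))).
Proof.
have D (e : R) : is_derive (t : R^o) (1 : R^o) (e \*: (id : R^o -> R^o)) (e *: (1 : R^o)).
  exact: is_deriveZ.
have he := is_derive1_comp (is_derive_expR (c * t)) (D c).
have hc := is_derive1_comp (is_derive_cos (d * t)) (D d).
have hs := is_derive1_comp (is_derive_sin (d * t)) (D d).
have H := is_deriveM he (is_deriveD (is_deriveZ a hc) (is_deriveZ b hs)).
have -> : (fun y => expR (c * y) * (a * cos (d * y) + b * sin (d * y)) : R^o) =
  ((expR \o (c \*: id : R^o -> R^o)) *
    (a \*: (cos \o (d \*: id : R^o -> R^o)) + b \*: (sin \o (d \*: id : R^o -> R^o))))%R.
  by apply/funext => y.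
apply: (is_derive_eq H); rewrite /GRing.scale /=.
rewrite /GRing.scale /= -[(a \*: _ + _) t]/(a * cos (d * t) + b * sin (d * t)); ring.
Qed.

(** Two exponentials are treated together because the kernel of the double integral is a difference
    of two; this family is stable under [pderiv]. *)
Lemma pderiv_cexp (A c A' c' : C) (i : 'I_2) :
  pderiv i (fun v => A * cexp (c * xcoord v) + A' * cexp (c' * xcoord v)) =
  (fun v => (i == 0)%:R * (A * c) * cexp (c * xcoord v) +
            (i == 0)%:R * (A' * c') * cexp (c' * xcoord v)).
Proof.
have E (a c1 : C) (y : R) : a * cexp (c1 * y%:C) =
    (expR (complex.Re c1 * y) * (complex.Re a * cos (complex.Im c1 * y) +
       - complex.Im a * sin (complex.Im c1 * y))) +i*
    (expR (complex.Re c1 * y) * (complex.Im a * cos (complex.Im c1 * y) +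
       complex.Re a * sin (complex.Im c1 * y))).
  case: a => a1 a2; case: c1 => c1 c2; rewrite /cexp; simpc => /=.
  by apply/eqP; rewrite eq_complex /=; apply/andP; split; apply/eqP; ring.
apply/funext => v; rewrite /pderiv.
pose f (a b c1 c2 : R) (y : R) : R^o := expR (c1 * y) * (a * cos (c2 * y) + b * sin (c2 * y)).
have -> : (fun u : 'rV[R]_2 => complex.Re (A * cexp (c * xcoord u) + A' * cexp (c' * xcoord u)) : R^o) =
   (fun u => (f (complex.Re A) (- complex.Im A) (complex.Re c) (complex.Im c) +
     f (complex.Re A') (- complex.Im A') (complex.Re c') (complex.Im c')) (u 0 0)).
  by apply/funext => u; rewrite /xcoord !E.
have -> : (fun u : 'rV[R]_2 => complex.Im (A * cexp (c * xcoord u) + A' * cexp (c' * xcoord u)) : R^o) =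
   (fun u => (f (complex.Im A) (complex.Re A) (complex.Re c) (complex.Im c) +
     f (complex.Im A') (complex.Re A') (complex.Re c') (complex.Im c')) (u 0 0)).
  by apply/funext => u; rewrite /xcoord !E.
rewrite !derive_coord; case: (i == 0); last by rewrite !mul0r addr0.
have D a b a' b' c1 c2 c1' c2' y : 'D_1 (f a b c1 c2 + f a' b' c1' c2') y =
   expR (c1 * y) * ((a * c1 + b * c2) * cos (c2 * y) + (b * c1 - a * c2) * sin (c2 * y)) +
   expR (c1' * y) * ((a' * c1' + b' * c2') * cos (c2' * y) + (b' * c1' - a' * c2') * sin (c2' * y)).
  have h1 := derive_exp_cos_sin a b c1 c2 y.
  have h2 := derive_exp_cos_sin a' b' c1' c2' y.
  have h := is_deriveD h1 h2; exact: derive_val.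
rewrite !D !mul1r /xcoord !E; case: (A) (A') (c) (c') => [a1 a2] [a1' a2'] [c1 c2] [c1' c2'].
by simpc => /=; apply/eqP; rewrite eq_complex /=; apply/andP; split; apply/eqP; ring.
Qed.

Lemma pderivs_cexp (A c A' c' : C) (w : seq 'I_2) :
  pderivs w (fun v => A * cexp (c * xcoord v) + A' * cexp (c' * xcoord v)) =
  (fun v => A * zero_word c w * cexp (c * xcoord v) +
            A' * zero_word c' w * cexp (c' * xcoord v)).
Proof.
elim: w => [|i w IH]; first by apply/funext => v; rewrite /zero_word /= !expr0 !mulr1.
rewrite /pderivs /= -/(pderivs w _) IH pderiv_cexp; apply/funext => v.
rewrite /zero_word /=; case: (i == 0) => /=; last by rewrite !mul0r !mulr0 !mul0r.
by rewrite !exprS; case: all; rewrite ?mulr0 ?mul0r //; ring.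
Qed.

End Derivatives.

Section MaskSums.
Variable R : realType.
Local Notation C := R[i].
Implicit Types (w v : seq 'I_2).

(* Gubinelli derivatives of t |-> \int_0^t e^(alpha x) dy, divided by
   e^(alpha x_t), in the direction of a nonempty word. *)
Fixpoint primitive_word (alpha : C) v : C :=
  if v is a :: v' then
    if a == 0 then alpha * primitive_word alpha v' else (v' == [::])%:R
  else 0.

Lemma primitive_word_rev alpha v : primitive_word alpha v =
  if rev v is i :: v' then if i == ycoord then zero_word alpha (rev v') else 0 else 0.
Proof.
elim: v => [//|a v IH] /=; rewrite IH rev_cons.
case: (lastP v) => [|u i].
  by case: (letter_cases a) => ->; rewrite /= /zero_word /= ?mulr0 ?expr0.
rewrite !rev_rcons /= rev_rcons revK /=.
have -> : (rcons u i == [::]) = false by case: (u).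
case: (i == ycoord); last by rewrite mulr0 if_same.
rewrite /zero_word /=; case: (a == 0) => //=.
by case: all; rewrite ?mulr0 // exprS.
Qed.

Lemma mask_sum_nil (beta : C) w :
  \sum_(m <- words bool (size w))
    zero_word beta (mask m w) * (mask (map negb m) w == [::])%:R = zero_word beta w.
Proof.
elim: w => [|a w IH]; first by rewrite big_words0 mulr1.
rewrite /= big_wordsS big_bool /= [X in _ + X]big1 ?addr0; last first.
  by move=> m _; rewrite mulr0.
rewrite /zero_word /=; case: (a == 0) => /=; last by rewrite big1 // => m _; rewrite mul0r.
transitivity (beta * zero_word beta w).
  rewrite -IH mulr_sumr; apply: eq_bigr => m _; rewrite mulrA; congr (_ * _).
  by rewrite /zero_word; case: all; rewrite ?mulr0 // exprS.
by rewrite /zero_word; case: all; rewrite ?mulr0 // exprS.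
Qed.

(** Product rule for e^(beta x) times the integral of e^(alpha x) dy. In a word x^i y x^j the
    letters after y must fall on the exponential, while each letter before y may fall on either
    factor, whence (alpha + beta)^i beta^j. *)
Lemma mask_sum_primitive (alpha beta : C) w :
  \sum_(m <- words bool (size w))
    zero_word beta (mask m w) * primitive_word alpha (mask (map negb m) w) =
  one_y (alpha + beta) beta w.
Proof.
elim: w => [|a w IH]; first by rewrite big_words0 mulr0.
rewrite /= big_wordsS big_bool /=; case: (letter_cases a) => -> /=.
  rewrite -IH mulrDl addrC !mulr_sumr; congr (_ + _); apply: eq_bigr => m _.
    by rewrite mulrCA.
  by rewrite mulrA; congr (_ * _); rewrite /zero_word /=; case: all; rewrite ?mulr0 // exprS.
rewrite big1 ?add0r; last by move=> m _; rewrite /zero_word /= mul0r.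
exact: mask_sum_nil.
Qed.

End MaskSums.

Section RoughIntegralLinear.
Variables (R : realType) (d : nat) (p : R) (X : R -> R -> tseries R d) (j : 'I_d).
Local Notation normc := (@ComplexField.Normc.normc R).
Local Notation C := R[i].
Implicit Types (F G : seq 'I_d -> R -> C) (T : R).

Definition riemann_term F u v : C :=
  \sum_(n < Num.truncn p) \sum_(w : n.-tuple 'I_d) F w u * (X u v (rcons w j))%:C.

Lemma rough_riemann_sumE F t :
  rough_riemann_sum p X j F t = psum (riemann_term F) 0 t.
Proof. exact: partition_sumE. Qed.

Lemma is_rough_integral_eq F G T I : (forall w u, 0 <= u -> u <= T -> F w u = G w u) ->
  is_rough_integral p X j G T I -> is_rough_integral p X j F T I.
Proof.
move=> FG hI e e0; have [r r0 hr] := hI e e0; exists r => // t ht mt.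
suff -> : rough_riemann_sum p X j F t = rough_riemann_sum p X j G t by exact: hr.
rewrite !rough_riemann_sumE.
have H s y : 0 <= y -> y <= T -> {in s, forall x, 0 <= x <= T} ->
    psum (riemann_term F) y s = psum (riemann_term G) y s.
  elim: s y => [//|x s IH] y y0 yT hs /=.
  have /andP[x0 xT] := hs x (mem_head _ _).
  rewrite IH // => [|z zs]; last by apply: hs; rewrite inE zs orbT.
  by congr (_ + _); apply: eq_bigr => n _; apply: eq_bigr => w _; rewrite FG.
apply: H => //; first exact: itv_partition_le ht.
by move=> x xt; have /andP[/ltW -> ->] := partition_bounds ht xt.
Qed.

Lemma is_rough_integral_comb (a b : C) F G T I J :
  is_rough_integral p X j F T I -> is_rough_integral p X j G T J ->
  is_rough_integral p X j (fun w u => a * F w u + b * G w u) T (a * I + b * J).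
Proof.
move=> hI hJ e e0; pose K := normc a + normc b + 1.
have K0 : 0 < K by rewrite ltr_wpDl // addr_ge0 ?normc_ge0.
have eK : 0 < e / K by rewrite divr_gt0.
have [r r0 hr] := hI _ eK; have [r' r'0 hr'] := hJ _ eK.
exists (Num.min r r'); first by rewrite lt_min r0.
move=> t ht mt.
have h1 : normc (rough_riemann_sum p X j F t - I) < e / K.
  by apply: hr => // l lt; have := mt l lt; rewrite lt_min => /andP[].
have h2 : normc (rough_riemann_sum p X j G t - J) < e / K.
  by apply: hr' => // l lt; have := mt l lt; rewrite lt_min => /andP[].
have -> : rough_riemann_sum p X j (fun w u => a * F w u + b * G w u) t =
    a * rough_riemann_sum p X j F t + b * rough_riemann_sum p X j G t.
  rewrite !rough_riemann_sumE; elim: (t) (0 : R) => [|x t' IH] y /=.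
    by rewrite !mulr0 addr0.
  rewrite IH !mulrDr addrACA; congr (_ + _); rewrite /riemann_term !mulr_sumr -big_split.
  apply: eq_bigr => n _; rewrite !mulr_sumr -big_split; apply: eq_bigr => w _.
  by rewrite /= mulrDl !mulrA.
have -> (s s' : C) : a * s + b * s' - (a * I + b * J) = a * (s - I) + b * (s' - J).
  by ring.
apply: le_lt_trans (normcD _ _) _; rewrite !normcM.
apply: le_lt_trans (_ : normc a * (e / K) + normc b * (e / K) < e).
  by rewrite lerD // ler_wpM2l ?normc_ge0 // ltW.
rewrite -mulrDl mulrCA -[ltRHS]mulr1 ltr_pM2l // ltr_pdivrMr // mul1r.
by rewrite ltrDl.
Qed.

(** Limits are unique because [0, T] has partitions of arbitrarily small mesh. *)
Lemma rough_integralE F T I : 0 <= T -> is_rough_integral p X j F T I ->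
  rough_integral p X j F T = I.
Proof.
move=> T0 hI; have hJ : is_rough_integral p X j F T (rough_integral p X j F T).
  by rewrite /rough_integral; apply: xgetI hI.
set J := rough_integral _ _ _ _ _ in hJ *.
apply/eqP; rewrite -subr_eq0; apply/eqP; apply: eq0_normc; apply/eqP.
rewrite eq_le normc_ge0 andbT; apply/ler_addgt0Pr => e e0; rewrite add0r.
have e2 : 0 < e / 2 by rewrite divr_gt0.
have [r r0 hr] := hI _ e2; have [r' r'0 hr'] := hJ _ e2.
have m0 : 0 < Num.min r r' by rewrite lt_min r0.
have [t ht mt] := uniform_partition T0 m0.
have h1 : normc (rough_riemann_sum p X j F t - I) < e / 2.
  by apply: hr => // l lt; have := mt l lt; rewrite lt_min => /andP[].
have h2 : normc (rough_riemann_sum p X j F t - J) < e / 2.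
  by apply: hr' => // l lt; have := mt l lt; rewrite lt_min => /andP[].
set s := rough_riemann_sum p X j F t in h1 h2.
have -> : J - I = (s - I) - (s - J) by ring.
by have := normcB (s - I) (s - J); lra.
Qed.

End RoughIntegralLinear.

Section Integrals.
Variables (R : realType) (p q K : R) (X S : R -> R -> tseries R 2).
Variables (gamma : R -> 'rV[R]_2) (om : R -> R -> R).
Hypothesis hX : weakly_geometric p X.
Hypothesis hgamma : first_level X gamma.
Hypothesis hS : lyons_extension p X S.
Hypothesis gamma0 : gamma 0 = 0.
Hypothesis q0 : 0 < q.
Hypothesis qN : q < (Num.truncn p).+1%:R.
Hypothesis K0 : 0 <= K.
Hypothesis homc : control om.
Hypothesis hgeo : forall w s t, 0 <= s -> s <= t -> t <= 1 ->
  `|S s t w| <= (K * om s t `^ q^-1) ^+ size w.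
Local Notation normc := (@ComplexField.Normc.normc R).
Local Notation C := R[i].
Local Notation N := (Num.truncn p).
Local Notation x t := (gamma t 0 0).
Local Notation rad s t := (K * om s t `^ q^-1).
Local Notation Phi lam := (hom (iotaM R 2) (tri lam)).
Local Notation sig_entry := (sig_entry S).

Lemma path_start : x 0 = 0. Proof. by rewrite gamma0 mxE. Qed.

Let th := N.+1%:R / q.
Let th1 : 1 < th. Proof. by rewrite ltr_pdivlMr ?mul1r. Qed.

(* The Gubinelli derivatives F of the integrand are those of the matrix
   entries appearing in Chen's identity for the increment of J. *)
Lemma is_rough_integral_dv (l0 l1 : C) F (P Q J : R -> C) (T M : R) :
    0 <= T -> T <= 1 ->
    (forall w u, 0 <= u -> u <= 1 ->
      F w u = P u * zero_word l1 w + Q u * one_y l0 l1 w) ->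
    (forall u, 0 <= u -> u <= 1 -> normc (P u) <= M) ->
    (forall u, 0 <= u -> u <= 1 -> normc (Q u) <= M) ->
    (forall u v, 0 <= u -> u <= v -> v <= 1 ->
      J v - J u = P u * sig_entry (lam3 l0 l1 0) u v o1 o2 + Q u * sig_entry (lam3 l0 l1 0) u v o0 o2) ->
  J 0 = 0 -> is_rough_integral p X ycoord F T (J T).
Proof.
move=> T0 T1 hF hP hQ hJ J0 e epos; set lam := lam3 l0 l1 0 in hJ.
have [B [e0 [B0 e00 hB]]] := sig_entry_tail p q0 K0 homc hgeo lam.
have termE u v : 0 <= u -> u <= v -> v <= 1 -> riemann_term p X ycoord F u v =
    P u * (\sum_(0 <= k < N.+1) Phi lam (S u v) k o1 o2) +
    Q u * (\sum_(0 <= k < N.+1) Phi lam (S u v) k o0 o2).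
  (* Degree 0 vanishes off the diagonal. Degree n + 1 <= [p] corresponds to the words w y with w of
     length n < [p], on which S and X agree. *)
  move=> u0 uv v1; rewrite !(big_nat_recl N) //= !hom_offdiag0 // !add0r !mulr_sumr.
  rewrite -big_split big_mkord; apply: eq_bigr => n _ /=.
  rewrite (@hom_last _ _ _ _ _ o1) // (@hom_last _ _ _ _ _ o1) // !mulr_sumr -big_split.
  rewrite (big_words_tuple _ (fun w => F w u * (X u v (rcons w ycoord))%:C)).
  rewrite [LHS]big_seq [RHS]big_seq; apply: eq_bigr => w.
  rewrite mem_words => /eqP wn; rewrite hF ?(le_trans uv) // rep_diag rep01.
  rewrite -(signature_low hS) ?size_rcons ?wn //.
  by rewrite /lam /lam3 /=; ring.
have [|r r0 hr] := @riemann_limit R om th (2 * M * B) e0 (riemann_term p X ycoord F) J T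
    homc th1 e00 T0 T1 _ e epos.
  move=> u v u0 uv v1 ome; have u1 := le_trans uv v1.
  rewrite termE // hJ //.
  set s := \sum_(0 <= k < N.+1) _; set s' := \sum_(0 <= k < N.+1) _.
  have := hB u v o1 o2 u0 uv v1 ome; rewrite -/s => h1.
  have := hB u v o0 o2 u0 uv v1 ome; rewrite -/s' => h2.
  have -> : P u * s + Q u * s' - (P u * sig_entry lam u v o1 o2 + Q u * sig_entry lam u v o0 o2) =
    - (P u * (sig_entry lam u v o1 o2 - s) + Q u * (sig_entry lam u v o0 o2 - s')) by ring.
  rewrite normc_opp; apply: le_trans (normcD _ _) _; rewrite !normcM.
  have -> : 2 * M * B * om u v `^ th = M * (B * om u v `^ th) + M * (B * om u v `^ th) by ring.
  apply: lerD; apply: ler_pM; rewrite ?normc_ge0 //; [exact: hP|exact: hQ].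
by exists r => // t ht mt; rewrite rough_riemann_sumE -(subr0 (J T)) -J0; exact: hr.
Qed.

Definition primitive (alpha : C) t := sig_entry (lam3 0 alpha 0) 0 t o1 o2.

Lemma is_rough_integral_cexp (alpha : C) T : 0 <= T -> T <= 1 ->
  is_rough_integral p X ycoord
    (fun w u => zero_word alpha w * cexp (alpha * (x u)%:C)) T (primitive alpha T).
Proof.
move=> T0 T1.
have [M [M0 hM]] := cexp_bound hX hgamma hS gamma0 q0 qN K0 homc hgeo alpha.
apply: (@is_rough_integral_dv 0 alpha _
  (fun u => cexp (alpha * (x u)%:C)) (fun _ => 0) (primitive alpha) T M T0 T1).
- by move=> w u _ _; rewrite mul0r addr0 mulrC.
- exact: hM.
- by move=> *; rewrite normc0.
- move=> u v u0 uv v1; rewrite {1}/primitive (sig_entry12 hX hgamma hS q0 qN K0 homc hgeo _ (lexx 0) u0 uv v1).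
  by rewrite /primitive /lam3 /= path_start subr0 !mul0r cexp0 mulr1 addr0 addrK.
exact: (sig_entry_refl hS).
Qed.

(** Both sides rest on diag(alpha, 0, -beta) = diag(alpha + beta, beta, 0) - beta I: entry (0,1) of
    the former representation is entry (1,2) for (0, alpha, 0), and the scalar shift gives the
    factor e^(-beta (x_v - x_u)). *)
Lemma hom_shift (alpha beta : C) u v n : 0 <= u -> u <= v -> v <= 1 -> (n <= N)%N ->
  Phi (lam3 0 alpha 0) (S u v) n o1 o2 =
  cauchy (cexp_terms (- (beta * (x v - x u)%:C)))
    (fun k => Phi (lam3 (alpha + beta) beta 0) (S u v) k o0 o1) n.
Proof.
move=> u0 uv v1 nN; set y := x v - x u; set lamA := lam3 (alpha + beta) beta 0.
have -> : Phi (lam3 0 alpha 0) (S u v) n o1 o2 =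
    Phi (lam3 alpha 0 (- beta)) (S u v) n o0 o1.
  by rewrite !homE; apply: eq_bigr => w _; rewrite rep12 rep01.
have -> : tri (lam3 alpha 0 (- beta)) = shifted (tri lamA) 0 ((- beta)%:M).
  apply/funext => i; apply/matrixP => a b; rewrite !mxE.
  case: (i == 0); last by rewrite !mxE addr0.
  rewrite !mxE; case: (a == b); last by rewrite !mul0r mulr0n addr0.
  rewrite !mul1r mulr1n; case: a => [[|[|[|//]]] ha]; rewrite /lamA /lam3 /=; ring.
have bc (a : 'M[C]_3) : (- beta)%:M * a = a * (- beta)%:M by exact: esym (scalar_mxC _ a).
rewrite (weakly_geometric_shift hX hgamma hS _ (@iotaM_central R 2) bc u0 uv v1 nN).
rewrite summxE /cauchy big_mkord; apply: eq_bigr => j _.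
have -> : iotaM R 2 (j`!%:R^-1) * (iotaM R 2 y * (- beta)%:M) ^+ j =
    (cexp_terms (- (beta * y%:C)) j)%:M :> 'M[C]_3.
  rewrite /iotaM /= -[_ * (- beta)%:M]scalar_mxM -rmorphXn -[LHS]scalar_mxM.
  congr (_%:M); rewrite /cexp_terms fmorphV rmorph_nat mulrC; congr (_ ^+ _ * _).
  by ring.
by rewrite -[_ * _]/(_ *m _) mul_scalar_mx mxE.
Qed.

(** By [hom_shift] the two power series agree up to degree [p]; what remains starts in degree [p] +
    1. *)
Lemma sig_entry_shift_increment (alpha beta : C) : exists B e0 : R, 0 < e0 /\ forall u v,
  0 <= u -> u <= v -> v <= 1 -> om u v <= e0 ->
  normc (cexp (- (beta * (x v - x u)%:C)) * sig_entry (lam3 (alpha + beta) beta 0) u v o0 o1 -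
         sig_entry (lam3 0 alpha 0) u v o1 o2) <= B * om u v `^ th.
Proof.
set lamA := lam3 (alpha + beta) beta 0; set lamB := lam3 0 alpha 0.
have [B1 B10 hB1] := hom_bound (tri lamA); have [B2 B20 hB2] := hom_bound (tri lamB).
(* A common rate for the exponential and both entries; the Cauchy product then has rate 2 L. *)
pose L := normc beta + B1 + B2.
have nb := normc_ge0 beta.
have L0 : 0 < L by rewrite /L; lra.
have e1 : 0 < (2^-1 / (2 * L) : R) by rewrite !divr_gt0 ?invr_gt0 ?mulr_gt0.
exists (4 * 2 * ((2 * L) ^+ N.+1 * K ^+ N.+1)), ((2^-1 / (2 * L) / (K + 1)) `^ q).
split; first by rewrite powR_gt0 // divr_gt0 // ltr_wpDl.
move=> u v u0 uv v1 ome; have r0 := rad_ge0 q om K0 u v.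
have := radius_le q0 K0 homc e1 u0 uv v1 ome.
rewrite ler_pdivlMr ?mulr_gt0 // mulrC => Lr.
pose a := cexp_terms (- (beta * (x v - x u)%:C)).
pose b k := Phi lamA (S u v) k o0 o1; pose c k := Phi lamB (S u v) k o1 o2.
have hw w : `|S u v w| <= 1 * rad u v ^+ size w by rewrite mul1r hgeo.
have ent := signature_entire hS q0 K0 homc hgeo u0 uv v1.
have ea : entire_seq a by exact: entire_cexp.
have eb : entire_seq b by exact: entire_hom.
have ec : entire_seq c by exact: entire_hom.
have ha k : normc (a k) <= 1 * (L * rad u v) ^+ k.
  rewrite /a /cexp_terms normcM normcX normc_natV mul1r.
  apply: le_trans (_ : normc (- (beta * (x v - x u)%:C)) ^+ k <= _).
    by rewrite ler_piMr ?exprn_ge0 ?normc_ge0 // invf_le1 ?ltr0n ?fact_gt0 // ler1n fact_gt0.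
  apply: lerXn2r; [by rewrite nnegrE normc_ge0|by rewrite nnegrE mulr_ge0 // ltW|].
  rewrite normc_opp normcM normcR; apply: ler_pM => //; first by rewrite /L; lra.
  exact: (x_le_rad hX hgamma hS hgeo).
have hb k : normc (b k) <= 1 * (L * rad u v) ^+ k.
  apply: le_trans (hB1 _ _ _ k o0 o1 r0 hw) _; rewrite !mul1r.
  apply: lerXn2r; [by rewrite nnegrE mulr_ge0 // ltW|by rewrite nnegrE mulr_ge0 // ltW|].
  by rewrite ler_wpM2r // /L; lra.
have hc k : normc (c k) <= (2 * L * rad u v) ^+ k.
  apply: le_trans (hB2 _ _ _ k o1 o2 r0 hw) _; rewrite mul1r.
  have L20 : 0 <= 2 * L by rewrite mulr_ge0 // ltW.
  apply: lerXn2r; [by rewrite nnegrE mulr_ge0 // ltW|by rewrite nnegrE mulr_ge0|].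
  by rewrite ler_wpM2r // /L; lra.
have -> : cexp (- (beta * (x v - x u)%:C)) * sig_entry lamA u v o0 o1 - sig_entry lamB u v o1 o2 =
    csum (fun n => cauchy a b n + -1 * c n).
  rewrite csumD ?csumZ ?csum_cauchy ?csum_cexp ?mulN1r //.
    exact: entire_cauchy.
  exact: entire_seqZ.
have := @csum_tail R (fun n => cauchy a b n + -1 * c n) 2 (2 * L * rad u v) N.+1.
rewrite [X in csum _ - X]big_nat [X in csum _ - X]big1 ?subr0; last first.
  move=> k /andP[_ kN]; rewrite /c (hom_shift alpha beta u0 uv v1) //.
  by rewrite mulN1r subrr.
have -> : 4 * 2 * ((2 * L) ^+ N.+1 * K ^+ N.+1) * om u v `^ th =
    4 * 2 * (2 * L * rad u v) ^+ N.+1.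
  by rewrite [(2 * L * _) ^+ _]exprMn radX // /th; ring.
apply; first by rewrite Lr mulr_ge0 // mulr_ge0 // ltW.
move=> k; apply: le_trans (normcD _ _) _; rewrite mulN1r normc_opp.
have h1 : normc (cauchy a b k) <= (2 * L * rad u v) ^+ k.
  have := cauchy_bound k (mulr_ge0 (ltW L0) r0) ha hb.
  by rewrite !mul1r [2 * (L * _)]mulrA.
by rewrite [leRHS]mulr_natl mulr2n lerD.
Qed.

(* Multiplying by e^(-beta x) turns the left-hand side into an additive
   functional of the same order as the remainder of a rough integral. *)
Lemma sig_entry_shift (alpha beta : C) T : 0 <= T -> T <= 1 ->
  sig_entry (lam3 (alpha + beta) beta 0) 0 T o0 o1 = cexp (beta * (x T)%:C) * primitive alpha T.
Proof.
move=> T0 T1; set lamA := lam3 (alpha + beta) beta 0.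
have [B [e0 [e00 hB]]] := sig_entry_shift_increment alpha beta.
have [M [M0 hM]] := cexp_bound hX hgamma hS gamma0 q0 qN K0 homc hgeo alpha.
pose J t := cexp (- (beta * (x t)%:C)) * sig_entry lamA 0 t o0 o1 - primitive alpha t.
have J0 : J 0 = 0.
  have d1 : sig_entry lamA 0 0 o0 o1 = 0 by exact: (sig_entry_refl hS).
  have d2 : primitive alpha 0 = 0 by exact: (sig_entry_refl hS).
  by rewrite /J d1 d2 mulr0 subr0.
have JT : J T = J 0.
  apply: (@almost_constant R om th (M * B) e0 J T homc th1 e00 T0 T1).
  move=> u v u0 uv v1 ome; have u1 := le_trans uv v1.
  have -> : J v - J u = cexp (alpha * (x u)%:C) *
      (cexp (- (beta * (x v - x u)%:C)) * sig_entry lamA u v o0 o1 - sig_entry (lam3 0 alpha 0) u v o1 o2).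
    rewrite /J /primitive (sig_entry01 hX hgamma hS q0 qN K0 homc hgeo lamA (lexx 0) u0 uv v1).
    rewrite (sig_entry12 hX hgamma hS q0 qN K0 homc hgeo _ (lexx 0) u0 uv v1).
    rewrite /lamA /lam3 /= path_start !subr0 mul0r cexp0 mulr1 -/(lam3 _ _ _).
    have e1 := cexpN (beta * (x u)%:C); have e2 := cexpN (beta * (x v - x u)%:C).
    have -> : - (beta * (x v)%:C) = - (beta * (x u)%:C) + - (beta * (x v - x u)%:C).
      by rewrite rmorphB /=; ring.
    rewrite mulrDl !cexpD; move: e1 e2.
    set ea := cexp (alpha * _); set b := cexp (beta * _); set b' := cexp (- (beta * (x u)%:C)).
    set e := cexp (beta * _); set e' := cexp (- (beta * (x v - x u)%:C)).
    set D := sig_entry _ u v o0 o1; set D0 := sig_entry _ 0 u o0 o1; set D' := sig_entry _ u v o1 o2.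
    set I := sig_entry _ 0 u o1 o2 => e1 e2.
    transitivity (ea * e' * D * (b * b') + b' * D0 * (e * e') - ea * D' - b' * D0).
      by ring.
    by rewrite e1 e2; ring.
  rewrite normcM -mulrA; apply: ler_pM; rewrite ?normc_ge0 //; [exact: hM|exact: hB].
move: JT; rewrite J0 /J => /eqP; rewrite subr_eq0 => /eqP <-.
by rewrite mulrA cexpN mul1r.
Qed.

(** Chen's identity for the corner entry gives its increments, and [sig_entry_shift] identifies the
    coefficient of [zero_word beta] with the value of the integrand. *)
Lemma is_rough_integral_double (alpha beta : C) :
  is_rough_integral p X ycoord
    (fun w t => cexp (beta * (x t)%:C) * primitive alpha t * zero_word beta w +
                cexp ((alpha + beta) * (x t)%:C) * one_y (alpha + beta) beta w)
    1 (sig_entry (lam3 (alpha + beta) beta 0) 0 1 o0 o2).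
Proof.
set lam := lam3 _ _ _.
have [M1 [M10 hM1]] := cexp_bound hX hgamma hS gamma0 q0 qN K0 homc hgeo (alpha + beta).
have [M2 [M20 hM2]] := sig_entry_bounded hS q0 K0 homc hgeo lam.
apply: (@is_rough_integral_dv (alpha + beta) beta _
  (fun u => sig_entry lam 0 u o0 o1) (fun u => cexp ((alpha + beta) * (x u)%:C))
  (fun t => sig_entry lam 0 t o0 o2) 1 (M1 + M2) ler01 (lexx 1)).
- by move=> w u u0 u1; rewrite /lam sig_entry_shift.
- by move=> u u0 u1; rewrite -[leLHS]add0r lerD // hM2.
- by move=> u u0 u1; rewrite -[leLHS]addr0 lerD // hM1.
- move=> u v u0 uv v1.
  have := sig_entry02 hX hgamma hS q0 qN K0 homc hgeo lam (lexx 0) u0 uv v1.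
  have -> : lam o0 = alpha + beta by [].
  have -> : lam o2 = 0 by [].
  by rewrite path_start subr0 mul0r cexp0 mulr1 => ->; rewrite addrK addrC.
exact: (sig_entry_refl hS).
Qed.

End Integrals.

Section LogSignature.
Variables (R : realType) (d : nat).
Local Notation normc := (@ComplexField.Normc.normc R).

(** For given rho the series converges at some r > 1 / rho. Each of its terms is at most its sum,
    which bounds the norm in degree n by a constant times r^(-n), hence times rho^n. *)
Lemma radius_entire (xi : tseries R d) : tseries_radius xi = +oo%E -> entire_series xi.
Proof.
move=> hr rho rho0.
have : (rho^-1%:E < tseries_radius xi)%E by rewrite hr ltry.
move=> /ereal_sup_gt[_ [r [r0 cv] <-]]; rewrite lte_fin => rr.
pose a n := projective_norm (component xi n).
exists (limn (series (fun n => `|a n| * r ^+ n))) => w.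
have rgt0 : 0 < r by apply: lt_trans rr; rewrite invr_gt0.
have t0 k : 0 <= `|a k| * r ^+ k by rewrite mulr_ge0 ?exprn_ge0.
have : `|a (size w)| * r ^+ size w <= limn (series (fun n => `|a n| * r ^+ n)).
  apply: le_trans (_ : series (fun n => `|a n| * r ^+ n) (size w).+1 <= _).
    by rewrite /series /= big_nat_recr //= lerDr sumr_ge0.
  apply: nondecreasing_cvgn_le => //.
  by apply: nondecreasing_series => k _ _.
set l := limn _ => hl.
apply: le_trans (_ : `|a (size w)| <= _).
  exact: le_trans (coef_le_projective_norm xi w) (ler_norm _).
have l0 : 0 <= l by apply: le_trans hl.
have : `|a (size w)| <= l * r^-1 ^+ size w.
  by rewrite exprVn ler_pdivlMr ?exprn_gt0.
move=> /le_trans; apply; rewrite ler_wpM2l //.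
apply: lerXn2r; rewrite ?nnegrE ?invr_ge0 ?(ltW rho0) //.
by rewrite -[leRHS]invrK lef_pV2 ?posrE ?invr_gt0 // ltW.
Qed.

Lemma csum_single (z : R[i]) : csum (fun n => if n == 1 then z else 0) = z.
Proof.
have hz := normc_ge0 z.
apply: (@csum_unique _ _ _ (2 * normc z)) => [n|rho rho0].
  have M0 : 0 <= 2 * normc z * 2^-1 ^+ n by rewrite !mulr_ge0 // exprn_ge0 // invr_ge0.
  case: n M0 => [|[|n]] M0.
  - by rewrite big_geq // subr0 expr0; lra.
  - by rewrite big_nat1 /= subr0 expr1; lra.
  rewrite big_ltn // big_ltn // big_nat big1 => [|k /andP[k2 _]].
    by rewrite /= add0r addr0 subrr normc0.
  by rewrite gtn_eqF.
exists (normc z / rho) => n; case: eqP => [->|_].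
  by rewrite expr1 divfK // gt_eqF.
by rewrite normc0 mulr_ge0 ?exprn_ge0 ?divr_ge0 // ltW.
Qed.

End LogSignature.

(** Through [hom_letter] the coefficients on the words x...x form the exponential series, whose
    logarithm is its variable. *)
Lemma tlog_zero_word (R : realType) (xi : tseries R 2) n :
  (forall k, xi (nseq k 0) = k`!%:R^-1) -> tlog xi (nseq n 0) = (n == 1)%:R.
Proof.
move=> hxi; have [->|n0] := posnP n; first by rewrite /tlog big_geq.
pose u := (fun w => xi w - tone R w) : tseries R 2.
have u0 : u [::] = 0 by rewrite /u (hxi 0) /tone eqxx fact0 invr1 subrr.
have c (r a : R) : idfun r * a = a * idfun r by rewrite mulrC.
rewrite -[LHS](@hom_letter R R idfun (tlog xi) n).
rewrite -(log_exp_poly (P := hpoly idfun (shifted (fun=> 0) 0 1) n u) (N := n)).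
- exact: (hom_series c (fun k => (-1) ^+ k.-1 / k%:R) 1 _ u0).
- by rewrite coef_hpoly // hom0.
- move=> k /andP[k0 kn]; rewrite coef_hpoly // hom_letter /= /u hxi /tone.
  by rewrite -size_eq0 size_nseq gtn_eqF // subr0.
by rewrite n0 leqnn.
Qed.

Lemma freq_neq0 (R : realType) (k : int) : k != 0 -> freq R k != 0.
Proof.
move=> k0; have pi0 : pi != 0 :> R by rewrite gt_eqF // pi_gt0.
by rewrite /freq eq_complex /= eqxx /= !mulf_eq0 pnatr_eq0 intr_eq0 (negPf k0) (negPf pi0).
Qed.

Section Evaluation.
Variables (R : realType) (p q K : R) (X S : R -> R -> tseries R 2).
Variables (gamma : R -> 'rV[R]_2) (om : R -> R -> R).
Hypothesis hX : weakly_geometric p X.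
Hypothesis hgamma : first_level X gamma.
Hypothesis hS : lyons_extension p X S.
Hypothesis gamma0 : gamma 0 = 0.
Hypothesis q0 : 0 < q.
Hypothesis qN : q < (Num.truncn p).+1%:R.
Hypothesis K0 : 0 <= K.
Hypothesis homc : control om.
Hypothesis hgeo : forall w s t, 0 <= s -> s <= t -> t <= 1 ->
  `|S s t w| <= (K * om s t `^ q^-1) ^+ size w.
Local Notation C := R[i].
Local Notation x t := (gamma t 0 0).
Local Notation Phi lam := (hom (iotaM R 2) (tri lam)).
Local Notation sig_entry := (sig_entry S).
Local Notation prim := (primitive S).

Lemma lift_function_cexp (A c A' c' : C) w t :
  lift_function gamma (fun v => A * cexp (c * xcoord v) + A' * cexp (c' * xcoord v)) w t =
  A * (zero_word c w * cexp (c * (x t)%:C)) + A' * (zero_word c' w * cexp (c' * (x t)%:C)).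
Proof. by rewrite /lift_function pderivs_cexp /xcoord !mulrA. Qed.

Lemma rough_integral_lift (A c A' c' : C) T : 0 <= T -> T <= 1 ->
  rough_integral p X ycoord
    (lift_function gamma (fun v => A * cexp (c * xcoord v) + A' * cexp (c' * xcoord v))) T =
  A * prim c T + A' * prim c' T.
Proof.
move=> T0 T1; apply: rough_integralE => //.
have h a := is_rough_integral_cexp hX hgamma hS gamma0 q0 qN K0 homc hgeo a T0 T1.
apply: is_rough_integral_eq (is_rough_integral_comb A A' (h c) (h c')).
by move=> w u _ _; rewrite lift_function_cexp.
Qed.

Lemma line_integral_cexp (c : C) :
  line_integral p X gamma ycoord (fun g => cexp (c * xcoord g)) = prim c 1.
Proof.
rewrite /line_integral (_ : (fun g => _) =
  (fun v => 1 * cexp (c * xcoord v) + 0 * cexp (c * xcoord v))).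
  by rewrite rough_integral_lift // mul1r mul0r addr0.
by apply/funext => v; rewrite mul1r mul0r addr0.
Qed.

(** The controlled path t |-> int_0^t e^(c x) dy: its value for the empty word, its derivatives for
    the other words. *)
Definition primitive_deriv (c : C) v t : C :=
  (v == [::])%:R * prim c t + primitive_word c v * cexp (c * (x t)%:C).

Lemma indefinite_integral_lift (A c A' c' : C) v t : 0 <= t -> t <= 1 ->
  indefinite_integral p X ycoord
    (lift_function gamma (fun v => A * cexp (c * xcoord v) + A' * cexp (c' * xcoord v))) v t =
  A * primitive_deriv c v t + A' * primitive_deriv c' v t.
Proof.
move=> t0 t1; rewrite /indefinite_integral /primitive_deriv !primitive_word_rev.
case: (lastP v) => [|v' i].
  rewrite /= rough_integral_lift //; move: (prim c t) (prim c' t) => P P'.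
  by move: (cexp _) (cexp _) => e e'; rewrite !mul1r !mul0r !addr0.
rewrite rev_rcons; have -> : (rcons v' i == [::]) = false by case: (v').
move: (prim c t) (prim c' t) => P P'.
case: (i == ycoord); first rewrite lift_function_cexp.
  move: (zero_word _ _) (zero_word _ _) (cexp _) (cexp _) => z z' e e'.
  by rewrite !mul0r !add0r.
by move: (cexp _) (cexp _) => e e'; rewrite !mul0r !addr0 !mulr0 addr0.
Qed.

Lemma mask_sum_primitive_deriv (alpha beta : C) w t :
  \sum_(m <- words bool (size w)) zero_word beta (mask m w) * cexp (beta * (x t)%:C) *
    primitive_deriv alpha (mask (map negb m) w) t =
  cexp (beta * (x t)%:C) * prim alpha t * zero_word beta w +
  cexp ((alpha + beta) * (x t)%:C) * one_y (alpha + beta) beta w.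
Proof.
rewrite -(mask_sum_nil beta w) -(mask_sum_primitive alpha beta w) !mulr_sumr.
rewrite -big_split mulrDl cexpD; apply: eq_bigr => m _.
rewrite /primitive_deriv.
set a := zero_word _ _; set e := cexp _; set f := cexp _; set P := prim _ _.
set c := (_ == _)%:R; set g := primitive_word _ _.
by rewrite /=; ring.
Qed.

(** The kernel separates into e^((c - b) x_s) e^(b x_t) - e^(b x_s) e^((c - b) x_t): the second term
    is the first one with c - b in place of b. *)
Lemma double_line_integral_cexp (c b : C) :
  double_line_integral p X gamma ycoord ycoord (fun g h =>
    cexp (c * xcoord g + b * (xcoord h - xcoord g))
    - cexp (c * xcoord h + b * (xcoord g - xcoord h))) =
  sig_entry (lam3 c b 0) 0 1 o0 o2 - sig_entry (lam3 c (c - b) 0) 0 1 o0 o2.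
Proof.
rewrite /double_line_integral; apply: rough_integralE => //.
have h a b' := is_rough_integral_double hX hgamma hS gamma0 q0 qN K0 homc hgeo a b'.
have := is_rough_integral_comb 1 (-1) (h (c - b) b) (h b (c - b)).
rewrite subrK [b + (c - b)]addrC subrK !mulN1r mul1r.
apply: is_rough_integral_eq => w t t0 t1.
rewrite /inner_integral.
have E m : indefinite_integral p X ycoord (lift_function gamma (fun a =>
      pderivs (mask m w) (fun h0 =>
        cexp (c * xcoord a + b * (xcoord h0 - xcoord a)) -
        cexp (c * xcoord h0 + b * (xcoord a - xcoord h0))) (gamma t)))
      (mask (map negb m) w) t =
    zero_word b (mask m w) * cexp (b * (x t)%:C) *
      primitive_deriv (c - b) (mask (map negb m) w) t -
    zero_word (c - b) (mask m w) * cexp ((c - b) * (x t)%:C) *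
      primitive_deriv b (mask (map negb m) w) t.
  rewrite -mulNr -indefinite_integral_lift //; congr indefinite_integral.
  congr lift_function; apply/funext => a.
  rewrite (_ : (fun h0 => _ - _) = (fun h0 =>
      cexp ((c - b) * xcoord a) * cexp (b * xcoord h0) +
      (- cexp (b * xcoord a)) * cexp ((c - b) * xcoord h0))); last first.
    by apply/funext => g; rewrite mulNr -!cexpD; congr (cexp _ - cexp _); ring.
  rewrite pderivs_cexp -/(xcoord (gamma t)).
  set e1 := cexp _; set e2 := cexp _; set e3 := cexp _; set e4 := cexp _.
  set z := zero_word _ _; set z' := zero_word _ _; ring.
rewrite (eq_bigr _ (fun (m : (size w).-tuple bool) _ => E m)) sumrB.
rewrite (big_words_tuple _ (fun m => zero_word b (mask m w) * cexp (b * (x t)%:C) *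
  primitive_deriv (c - b) (mask (map negb m) w) t)).
rewrite (big_words_tuple _ (fun m => zero_word (c - b) (mask m w) *
  cexp ((c - b) * (x t)%:C) * primitive_deriv b (mask (map negb m) w) t)).
rewrite !mask_sum_primitive_deriv subrK [b + (c - b)]addrC subrK.
by rewrite mul1r mulN1r.
Qed.

End Evaluation.

(** * Commutation with the logarithm *)

(* The three entries above the diagonal of the relation g l = l g, in which
   the equality of the extreme diagonal entries of g cancels the unknown
   corner entry of l. *)
Lemma triangular_commute (F : fieldType) (g l : 'I_3 -> 'I_3 -> F) (c b e : F) :
    (forall i j, \sum_k g i k * l k j = \sum_k l i k * g k j) ->
    (forall i j : 'I_3, (j < i)%N -> g i j = 0) ->
    (forall i j : 'I_3, (j < i)%N -> l i j = 0) ->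
    g o0 o0 = 1 -> g o1 o1 = e -> g o2 o2 = 1 ->
    l o0 o0 = c -> l o1 o1 = b -> l o2 o2 = 0 -> c != 0 ->
  (e - 1) * g o0 o2 = g o0 o1 * g o1 o2.
Proof.
move=> comm glow llow g00 g11 g22 l00 l11 l22 c0.
have := comm o0 o1; have := comm o1 o2; have := comm o0 o2; rewrite !sum_ord3.
rewrite (glow o1 o0) // (glow o2 o1) // (llow o1 o0) // (llow o2 o1) //.
rewrite g00 g11 g22 l00 l11 l22.
move: (g o0 o1) (g o1 o2) (g o0 o2) (l o0 o1) (l o1 o2) (l o0 o2).
move=> g01 g12 g02 l01 l12 l02 h02 h12 h01; apply: (mulfI c0).
(* l01 and l12 are used only through their products with e - 1, so that e = 1 is allowed; the only
   factor cancelled is c. *)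
have e1 : l01 * (1 - e) = (c - b) * g01.
  have -> : l01 * (1 - e) = (1 * l01 + g01 * b + g02 * 0) - g01 * b - l01 * e by ring.
  by rewrite h01; ring.
have e2 : l12 * (e - 1) = b * g12.
  have -> : l12 * (e - 1) = (0 * l02 + e * l12 + g12 * 0) - l12 by ring.
  by rewrite h12; ring.
have e3 : c * g02 = g01 * l12 - l01 * g12.
  have -> : g01 * l12 - l01 * g12 = (1 * l02 + g01 * l12 + g02 * 0) - l02 - l01 * g12 by ring.
  by rewrite h02; ring.
have -> : c * ((e - 1) * g02) = (e - 1) * (c * g02) by ring.
rewrite e3; have -> : (e - 1) * (g01 * l12 - l01 * g12) =
   g01 * (l12 * (e - 1)) + (l01 * (1 - e)) * g12 by ring.
by rewrite e1 e2; ring.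
Qed.

Section Commutation.
Variables (R : realType) (p q K : R) (X S : R -> R -> tseries R 2).
Variables (gamma : R -> 'rV[R]_2) (om : R -> R -> R).
Hypothesis hX : weakly_geometric p X.
Hypothesis hgamma : first_level X gamma.
Hypothesis hS : lyons_extension p X S.
Hypothesis gamma0 : gamma 0 = 0.
Hypothesis q0 : 0 < q.
Hypothesis qN : q < (Num.truncn p).+1%:R.
Hypothesis K0 : 0 <= K.
Hypothesis homc : control om.
Hypothesis hgeo : forall w s t, 0 <= s -> s <= t -> t <= 1 ->
  `|S s t w| <= (K * om s t `^ q^-1) ^+ size w.
Hypothesis x1 : gamma 1 0 0 = 1.
Hypothesis hlog : tseries_radius (tlog (S 0 1)) = +oo%E.
Local Notation C := R[i].
Local Notation sig_entry := (sig_entry S).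
Local Notation prim := (primitive S).
Local Notation L := (tlog (S 0 1)).
Local Notation log_entry lam := (development (tri lam) L).

(** As x_1 = 1, the signature takes the value 1 / k! on the word x^k. *)
Lemma log_diag lam i : log_entry lam i i = lam i.
Proof.
rewrite -[RHS]csum_single; apply: eq_csum => n; rewrite hom_diag tlog_zero_word.
  by case: eqP => [->|_]; rewrite /= ?expr1 ?mul1r ?mul0r.
move=> k; rewrite (signature_zero_word hX hgamma hS q0 qN K0 homc hgeo) ?ler01 //.
by rewrite x1 gamma0 mxE subr0 expr1n div1r.
Qed.

Lemma log_low lam (i j : 'I_3) : (j < i)%N -> log_entry lam i j = 0.
Proof.
by move=> ji; rewrite -[RHS](@csum0 R); apply: eq_csum => n; exact: hom_low.
Qed.

(** The infinite radius of convergence enters here: it makes the logarithm an entire series, so that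
    developing it is compatible with products. *)
Lemma development_comm lam i j :
  \sum_k sig_entry lam 0 1 i k * log_entry lam k j = \sum_k log_entry lam i k * sig_entry lam 0 1 k j.
Proof.
have eS := signature_entire hS q0 K0 homc hgeo (lexx 0) ler01 (lexx 1).
have eL := radius_entire hlog.
have E1 := developmentM (tri lam) i j eS eL.
have E2 := developmentM (tri lam) i j eL eS.
transitivity (development (tri lam) (tmul (S 0 1) L) i j); first exact: esym E1.
transitivity (development (tri lam) (tmul L (S 0 1)) i j); last exact: E2.
apply: eq_csum => n; rewrite (hom_tlog_comm (@iotaM_central R 2)) //.
by apply: (mf_nil (proj1 hS)).
Qed.

Lemma sig_entry_diag1 lam i : sig_entry lam 0 1 i i = cexp (lam i).
Proof.
rewrite (sig_entry_diag hX hgamma hS q0 qN K0 homc hgeo) ?ler01 //.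
by rewrite x1 gamma0 mxE subr0 mulr1.
Qed.

Lemma corner_relation (c b : C) : cexp c = 1 -> c != 0 ->
  (cexp b - 1) * sig_entry (lam3 c b 0) 0 1 o0 o2 =
  sig_entry (lam3 c b 0) 0 1 o0 o1 * sig_entry (lam3 c b 0) 0 1 o1 o2.
Proof.
move=> ec c0; apply: (triangular_commute (development_comm (lam3 c b 0)) _ _ _ _ _ _ _ _ c0).
- exact: sig_entry_low.
- exact: log_low.
- by rewrite sig_entry_diag1.
- by rewrite sig_entry_diag1.
- by rewrite sig_entry_diag1; exact: cexp0.
- exact: (log_diag (lam3 c b 0) o0).
- exact: (log_diag (lam3 c b 0) o1).
- exact: (log_diag (lam3 c b 0) o2).
Qed.

Lemma sig_entry12_primitive (c b : C) : sig_entry (lam3 c b 0) 0 1 o1 o2 = prim b 1.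
Proof.
apply: eq_csum => n; rewrite !homE; apply: eq_bigr => w _.
by rewrite !rep12.
Qed.

Lemma corner_primitive (c b : C) : cexp c = 1 -> c != 0 ->
  (cexp b - 1) * sig_entry (lam3 c b 0) 0 1 o0 o2 =
  cexp b * (prim (c - b) 1 * prim b 1).
Proof.
move=> ec c0; rewrite corner_relation // sig_entry12_primitive.
have := sig_entry_shift hX hgamma hS gamma0 q0 qN K0 homc hgeo (c - b) b ler01 (lexx 1).
by rewrite subrK => ->; rewrite x1 mulr1 mulrA.
Qed.

End Commutation.

Theorem theorem5p1 (R : realType) (p : R) (X S : R -> R -> tseries R 2)
    (gamma : R -> 'rV[R]_2)
    (hX : weakly_geometric p X)
    (hgamma : first_level X gamma)
    (hS : lyons_extension p X S)
    (gamma0 : gamma 0 = 0)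
    (x1 : gamma 1 0 0 = 1)
    (hlog : tseries_radius (tlog (S 0 1)) = +oo%E) :
  forall (k : int) (b : R[i]), k != 0 ->
    (1 - ccosh b) *
      double_line_integral p X gamma ycoord ycoord (fun g h =>
        cexp (freq R k * xcoord g + b * (xcoord h - xcoord g))
        - cexp (freq R k * xcoord h + b * (xcoord g - xcoord h)))
    + csinh b *
      line_integral p X gamma ycoord (fun g => cexp (b * xcoord g)) *
      line_integral p X gamma ycoord
        (fun g => cexp ((freq R k - b) * xcoord g)) = 0.
Proof.
have hSm := proj1 hS.
have p_ge1 : 1 <= p by case: hX => -[].
have [q [K [om [q0 qN K0 homc hgeo]]]] := geometric_bound p_ge1 hSm.
move=> k b k0; set c := freq R k.
have ec : cexp c = 1 := cexp_freq R k.
have c0 : c != 0 := freq_neq0 R k0.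
have D := double_line_integral_cexp hX hgamma hS gamma0 q0 qN K0 homc hgeo c b.
have I1 := line_integral_cexp hX hgamma hS gamma0 q0 qN K0 homc hgeo b.
have I2 := line_integral_cexp hX hgamma hS gamma0 q0 qN K0 homc hgeo (c - b).
have E1 := corner_primitive hX hgamma hS gamma0 q0 qN K0 homc hgeo x1 hlog b ec c0.
have E2 := corner_primitive hX hgamma hS gamma0 q0 qN K0 homc hgeo x1 hlog (c - b) ec c0.
have eN : cexp (c - b) = cexp (- b) by rewrite cexpD ec mul1r.
rewrite D I1 I2 /ccosh /csinh; move: E1 E2; rewrite eN (_ : c - (c - b) = b); last by ring.
have := cexpN b.
move: (cexp b) (cexp (- b)) (primitive S (c - b) 1) (primitive S b 1).
move: (sig_entry S (lam3 c b 0) 0 1 o0 o2) (sig_entry S (lam3 c (c - b) 0) 0 1 o0 o2).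
move=> G H e f P Q ef E1 E2.
(* With e f = 1 one has 1 - (e + f) / 2 = (e - 1)(f - 1) / 2 up to sign changes in both factors.
   Hence [E1] applies to the G part and [E2] to the H part; the term in 1 - e f collects the use of
   that relation. *)
have -> : (1 - (e + f) / 2) * (G - H) + (e - f) / 2 * Q * P =
  2^-1 * (- (1 - f) * ((e - 1) * G) - (e - 1) * ((f - 1) * H) * 1
    + (1 - e * f) * (G - H) + (e - f) * (Q * P)).
  by field.
rewrite E1 E2 ef.
have -> : - (1 - f) * (e * (P * Q)) - (e - 1) * (f * (Q * P)) * 1 +
  (1 - 1) * (G - H) + (e - f) * (Q * P) = 2 * (e * f - e * f) * (P * Q) by ring.
by rewrite subrr mulr0 mul0r mulr0.
Qed.
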